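(* Let $\Omega_{RB}$ be the Red-Black Robinson tiling (the subshift of finite type on $\mathbb{Z}^2$ described in the context). For every $\epsilon\in(0,1]$ there is a measure $\mu\in\mathcal{M}_{RB}^{\mathcal{B}}(\epsilon)$ such that $d_B\left(\mu,\mathcal{M}_{RB}\right)\geq\frac18$. Thus the SFT $\Omega_{RB}$ is unstable (that is, it is not stable).
   Context: **SFTs and noise.** Let $\mathcal{A}$ be a finite alphabet, $\Omega_{\mathcal{A}}=\mathcal{A}^{\mathbb{Z}^d}$ with the product topology, Borel $\sigma$-algebra and shifts $\sigma_k(\omega)_l=\omega_{k+l}$ ($k\in\mathbb{Z}^d$). For a finite set $\mathcal{F}$ of forbidden patterns $w\in\mathcal{A}^{I(w)}$ ($I(w)\subset\mathbb{Z}^d$ finite), $\Omega_{\mathcal{F}}$ is the set of $\omega\in\Omega_{\mathcal{A}}$ with $\sigma_k(\omega)|_{I(w)}\neq w$ for all $w\in\mathcal{F}$, $k\in\mathbb{Z}^d$. $\mathcal{M}_{\mathcal{F}}$ is the set of $\sigma$-invariant Borel probability measures supported by $\Omega_{\mathcal{F}}$. Put $\widetilde{\mathcal{A}}=\mathcal{A}\times\{0,1\}$ (second coordinate $1$ means the cell is obscured), with coordinate projections $\pi_1,\pi_2$, and $\widetilde{\mathcal{F}}=\{(w,0^{I(w)}):w\in\mathcal{F}\}$, a set of forbidden patterns on $\widetilde{\mathcal{A}}$. For $\epsilon\in[0,1]$, $\widetilde{\mathcal{M}_{\mathcal{F}}^{\mathcal{B}}}(\epsilon)$ is the set of $\lambda\in\mathcal{M}_{\widetilde{\mathcal{F}}}$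 whose pushforward $\pi_2^*(\lambda)$ is an i.i.d. Bernoulli measure $\mathcal{B}(\epsilon')^{\otimes\mathbb{Z}^d}$ with $\epsilon'\le\epsilon$, and $\mathcal{M}_{\mathcal{F}}^{\mathcal{B}}(\epsilon)=\pi_1^*\big(\widetilde{\mathcal{M}_{\mathcal{F}}^{\mathcal{B}}}(\epsilon)\big)$. **Besicovitch distance.** $d_H(x,y)=\limsup_{n\to\infty}\frac{1}{(2n+1)^d}\#\{k\in\{-n,\dots,n\}^d:x_k\neq y_k\}$ for $x,y\in\Omega_{\mathcal{A}}$. For $\sigma$-invariant measures, $d_B(\mu,\nu)=\inf_{\lambda}\int d_H(x,y)\,d\lambda(x,y)$, the infimum being over $\sigma$-invariant couplings $\lambda$ of $\mu$ and $\nu$ on $\Omega_{\mathcal{A}\times\mathcal{A}}$. $d_B(\mu,V)=\inf_{\nu\in V}d_B(\mu,\nu)$ for a set $V$. **Stability.** $\Omega_{\mathcal{F}}$ is stable if there is a non-decreasing $f:[0,1]\to[0,\infty)$, continuous at $0$ with $f(0)=0$, such that $\sup_{\mu\in\mathcal{M}_{\mathcal{F}}^{\mathcal{B}}(\epsilon)}d_B(\mu,\mathcal{M}_{\mathcal{F}})\le f(\epsilon)$ for all $\epsilon\in[0,1]$. **The Red-Black Robinson tileset** ($d=2$). Each of the four edges (north, east, south, west) of a unit square tile carries a central arrow, which is either outgoing from or ingoing to the tile, and carries either no side line or exactly one side line; a side line has a colour (Red or Black) and is placed off-centre, shifted towards one of the two endpoints of the edge. The tiles are all the images, under the rotations and reflections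 of the square, of the following 11 basic tiles. - Bumpy-corner of colour $c$ ($c\in\{\text{Red},\text{Black}\}$; 2 tiles): the four central arrows are outgoing; the north edge carries a side line of colour $c$ shifted east, the east edge carries a side line of colour $c$ shifted north, the south and west edges carry none. The tile is marked as ''bumpy''. - Non-bumpy cross of colour $c$ (2 tiles): same edges as the bumpy-corner of colour $c$, but not bumpy. - Arms (7 tiles, not bumpy): the central arrow of the south edge is outgoing, those of the north, east and west edges are ingoing. There is either no vertical side line, or a vertical side line of some colour, present on both the north and south edges and shifted east. There is either no horizontal side line, or a horizontal side line of some colour, present on both the east and west edges and shifted north. If both the vertical and horizontal side lines are present, their colours are different. Matching rules: for two laterally adjacent tiles, the shared edge must match (the central arrow is outgoing for one and ingoing for the other; side lines are both absent, or both present at the same position with the same colour), and each $2\times2$ square of tiles contains exactly one bumpy tile. $RB$ is the finite set of patterns of shape $1\times2$, $2\times1$ and $2\times2$ violating these rules, and $\Omega_{RB}$ is the resulting SFT. *)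

(* Defs.v *)
From HB Require Import structures.
From mathcomp Require Import all_boot all_order all_algebra finmap.
From mathcomp Require Import all_classical all_reals all_analysis.

Set Implicit Arguments.
Unset Strict Implicit.
Unset Printing Implicit Defensive.

Import Order.TTheory GRing.Theory Num.Theory.
Import numFieldNormedType.Exports.

Local Open Scope fset_scope.
Local Open Scope fmap_scope.
Local Open Scope classical_set_scope.
Local Open Scope ring_scope.

(* Measurable types of the library are pointed, so alphabets are taken to be
   nonempty finite types (there are no configurations otherwise). *)
#[short(type="pointedFinType")]
HB.structure Definition PointedFinite := {T of Finite T & isPointed T}.

HB.instance Definition _ := Pointed.on bool.
HB.instance Definition _ (A B : pointedFinType) := Pointed.on (A * B)%type.

Section SFT.
Variables (R : realType) (d : nat).

(* A^(Z^d) with the Borel sigma-algebra of the product topology; Z^d is the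
   group 'rV[int]_d. *)
Definition config (A : pointedFinType) : Type :=
  g_sigma_algebraType
    (@open (prod_topology (fun _ : 'rV[int]_d => discrete_topology A))).

Definition config_shift (A : pointedFinType) (k : 'rV[int]_d) (x : config A) :
  config A := fun l => x (k + l).

Definition pi1 (A B : pointedFinType) (z : config (A * B)%type) : config A :=
  fun k => (z k).1.

Definition pi2 (A B : pointedFinType) (z : config (A * B)%type) : config B :=
  fun k => (z k).2.

Definition pattern (A : pointedFinType) : choiceType :=
  {fmap 'rV[int]_d -> A}.

Definition subpattern (A : pointedFinType) (I : {fset 'rV[int]_d})
    (x : config A) : pattern A :=
  [fmap i : I => (x (val i) : A)].

Section forbidden_patterns.
Variable A : pointedFinType.
Implicit Type F : {fset pattern A}.

Definition Omega F : set (config A) :=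
  [set x | forall (w : pattern A) (k : 'rV[int]_d),
     w \in F -> subpattern (domf w) (config_shift k x) <> w].

Definition shift_invariant (mu : probability (config A) R) : Prop :=
  forall (k : 'rV[int]_d) (B : set (config A)), measurable B ->
    pushforward mu (config_shift k) B = mu B.

Definition inv_measures F : set (probability (config A) R) :=
  [set mu | shift_invariant mu /\ mu (Omega F) = 1%E].

End forbidden_patterns.

(* The pair (w, 0^I(w)): no cell is obscured. *)
Definition unobscured (A : pointedFinType) (w : pattern A) :
    pattern (A * bool)%type :=
  [fmap i : domf w => (w i, false)].

Definition unobscured_patterns (A : pointedFinType) (F : {fset pattern A}) :
    {fset pattern (A * bool)%type} :=
  [fset unobscured w | w in F].

(* The finite-dimensional marginals characterising the product measure
   B(p)^(Z^d). *)
Definition iid_bernoulli (p : R) (m : set (config bool) -> \bar R) : Prop :=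
  forall w : pattern bool,
    m [set x | subpattern (domf w) x = w] =
    (\prod_(i : domf w) bernoulli_pmf p (w i))%:E.

Definition noisy_lifts (A : pointedFinType) (F : {fset pattern A}) (eps : R) :
    set (probability (config (A * bool)%type) R) :=
  [set lam | inv_measures (unobscured_patterns F) lam /\
     exists2 p : R, 0 <= p <= eps &
       iid_bernoulli p (pushforward lam (@pi2 A bool))].

Definition noisy_measures (A : pointedFinType) (F : {fset pattern A})
    (eps : R) : set (probability (config A) R) :=
  [set mu | exists2 lam, noisy_lifts F eps lam &
     forall B : set (config A), measurable B ->
       mu B = pushforward lam (@pi1 A bool) B].

Section besicovitch.
Variable A : pointedFinType.
Implicit Types (mu nu : probability (config A) R).

(* The cube {-n, ..., n}^d is parametrised by 'rV['I_(2n+1)]_d. *)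
Definition cube_point (n : nat) (v : 'rV['I_(n.*2.+1)]_d) : 'rV[int]_d :=
  \row_j ((v 0 j)%:Z - n%:Z).

Definition num_diff (n : nat) (x y : config A) : nat :=
  #|[set v : 'rV['I_(n.*2.+1)]_d |
      (x (cube_point v) : A) != (y (cube_point v) : A)]%SET|.

Definition dH (x y : config A) : \bar R :=
  limn_esup (fun n => ((num_diff n x y)%:R / ((n.*2.+1) ^ d)%:R)%:E).

Definition couplings mu nu : set (probability (config (A * A)%type) R) :=
  [set lam | [/\ shift_invariant lam,
    forall B, measurable B -> pushforward lam (@pi1 A A) B = mu B &
    forall B, measurable B -> pushforward lam (@pi2 A A) B = nu B]].

Definition dB mu nu : \bar R :=
  ereal_inf [set (\int[lam]_z dH (pi1 z) (pi2 z))%E | lam in couplings mu nu].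

Definition dB_set mu (V : set (probability (config A) R)) : \bar R :=
  ereal_inf [set dB mu nu | nu in V].

End besicovitch.

Definition stable (A : pointedFinType) (F : {fset pattern A}) : Prop :=
  exists f : R -> R,
    [/\ {in `[0, 1] &, {homo f : x y / x <= y}},
        {in `[0, 1], forall x, 0 <= f x},
        f 0 = 0, f x @[x --> 0^'+] --> 0 &
        {in `[0, 1], forall eps,
          (ereal_sup [set dB_set mu (inv_measures F) |
                      mu in noisy_measures F eps] <= (f eps)%:E)%E}].

End SFT.

Inductive color := Red | Black.

Definition bool_of_color (c : color) : bool := if c is Red then true else false.
Definition color_of_bool (b : bool) : color := if b then Red else Black.
Lemma bool_of_colorK : cancel bool_of_color color_of_bool.
Proof. by case. Qed.
HB.instance Definition _ := Finite.copy color (can_type bool_of_colorK).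

(* Directions are numbered counterclockwise, so that the rotations and
   reflections of the square act by i |-> i + k and i |-> - i + k. *)
Definition dir := 'Z_4.
Definition east : dir := 0.
Definition north : dir := 1.
Definition west : dir := 2.
Definition south : dir := 3.

Definition dihedral (g : bool * 'Z_4) (i : dir) : dir := (-1) ^+ g.1 * i + g.2.

(* Whether the central arrow is outgoing, and the side line if there is one,
   with its colour and the direction towards which it is shifted. *)
Definition edge : finType := (bool * option (color * dir))%type.

(* The four edges, and whether the tile is bumpy. *)
Definition rawtile : finType := ({ffun dir -> edge} * bool)%type.

Definition edge_image (g : bool * 'Z_4) (e : edge) : edge :=
  (e.1, omap (fun l => (l.1, dihedral g l.2)) e.2).

Definition tile_image (g : bool * 'Z_4) (t u : rawtile) : bool :=
  (u.2 == t.2) && [forall i, u.1 (dihedral g i) == edge_image g (t.1 i)].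

Definition corner (c : color) (b : bool) : rawtile :=
  ([ffun i : dir =>
      (true, if i == north then Some (c, east)
             else if i == east then Some (c, north) else None)], b).

(* [v] and [h] are the colours of the vertical and horizontal side lines. *)
Definition arm (v h : option color) : rawtile :=
  ([ffun i : dir =>
      (i == south, if (i == north) || (i == south)
                   then omap (fun c => (c, east)) v
                   else omap (fun c => (c, north)) h)], false).

Definition basic_tiles : seq rawtile :=
  [:: corner Red true; corner Black true; corner Red false; corner Black false;
      arm None None;
      arm (Some Red) None; arm (Some Black) None;
      arm None (Some Red); arm None (Some Black);
      arm (Some Red) (Some Black); arm (Some Black) (Some Red)].

Definition is_tile (u : rawtile) : bool :=
  [exists g, has (fun t => tile_image g t u) basic_tiles].

Definition tile : Type := {u : rawtile | is_tile u}.
HB.instance Definition _ := Finite.on tile.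

Lemma arm_is_tile : is_tile (arm None None).
Proof.
apply/existsP; exists (false, 0); apply/hasP; exists (arm None None).
  by rewrite !inE eqxx !orbT.
rewrite /tile_image /=; apply/forallP => i.
by rewrite /dihedral expr0 mul1r addr0 !ffunE; case: ifP.
Qed.

HB.instance Definition _ :=
  isPointed.Build tile (exist is_tile (arm None None) arm_is_tile).

Definition bumpy (t : tile) : bool := (val t).2.

(* The edge of [a] in direction [i] matches the edge of the neighbour [b] of
   [a] in that direction. *)
Definition edge_match (i : dir) (a b : tile) : bool :=
  let e := (val a).1 i in let e' := (val b).1 (i + 2) in
  (e.1 != e'.1) && (e.2 == e'.2).

Definition unit_east : 'rV[int]_2 := delta_mx 0 0.
Definition unit_north : 'rV[int]_2 := delta_mx 0 1.

Definition domino (v : 'rV[int]_2) (a b : tile) : pattern 2 tile :=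
  [fmap].[0 <- a].[v <- b].

Definition square (q : 4.-tuple tile) : pattern 2 tile :=
  [fmap].[0 <- tnth q 0].[unit_east <- tnth q 1]
        .[unit_north <- tnth q 2].[unit_east + unit_north <- tnth q 3].

(* Only the bumpiness rule is used to forbid 2x2 patterns: those with two
   mismatched neighbours already contain a forbidden domino. *)
Definition RB : {fset pattern 2 tile} :=
  ([fset domino unit_east p.1 p.2 |
      p : tile * tile & ~~ edge_match east p.1 p.2]
   `|` [fset domino unit_north p.1 p.2 |
      p : tile * tile & ~~ edge_match north p.1 p.2]
   `|` [fset square q | q : 4.-tuple tile & count bumpy q != 1%N])%fset.

(* Main.v *)
From Stdlib Require Import ZArith Lia.
From HB Require Import structures.
Require Import Defs.
From mathcomp Require Import all_boot all_order all_algebra finmap.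
From mathcomp Require Import all_classical all_reals all_analysis.
From mathcomp Require Import measurable_realfun.
From mathcomp Require Import ssrZ lra.

Set Implicit Arguments.
Unset Strict Implicit.
Unset Printing Implicit Defensive.
Import Order.TTheory GRing.Theory Num.Theory.
Import numFieldNormedType.Exports.
Local Open Scope classical_set_scope.
Local Open Scope ring_scope.

(** Why a little noise moves the measure far away.

    In a clean tiling the bumpy tiles occupy one column out of two and one row
    out of two, and the tiles organise into supertiles: a supertile of level
    [n] has side [2 ^ n.+1 - 1] and consists of a central cross, four arms,
    and four supertiles of level [n - 1] in its corners, facing its centre.
    Two lines that cross have different colours, so the colour of the central
    cross determines by alternation the colour of all the bumpy tiles of the
    supertile. Every bumpy tile belongs to a supertile of each level
    ([all_covered]). Hence the bumpy tiles of one row change colour at most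
    once ([bump_colour_once]): among the positions [0, H, 2 H, ...] of the
    row, at most one can start a pair of bumpy tiles at distance [H] with
    opposite colours, and for a shift-invariant measure such a pair at a given
    place has probability 0 ([clean_opposite_null]).

    With noise, the colours can be exchanged independently in different
    places. Take the limit tiling of the hierarchy, positioned by two random
    2-adic integers, and cut it into blocks of side [2 ^ n.+2], separated by
    the rows and columns of higher levels. A block communicates with the rest
    of the tiling only through the four arms of its centre. The block is good
    if each arm carries an obscured cell in its outer half; then Red and Black
    can be exchanged inside the block up to these obscured cells, and no
    visible pair of cells violates a rule ([random_Omega]). The exchange is
    made in the good blocks of every other column of blocks. For a fixed noise
    level the probability of a bad block tends to 0 with [n], so with
    probability at least [1/4 - 1/24] the origin is a bumpy tile and the tile
    one block further east is a bumpy tile of the opposite colour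
    ([noisy_law]). Bumpy tiles never sit on the arms where a rule is broken,
    so they respect all rules around them.

    Finally let [x] and [y] be coupled, [x] noisy and [y] clean. Whenever [x]
    has an opposite pair at [0] and [H], the clean [y] almost surely has none,
    so [y] differs from [x] at one of these two bumpy tiles: the probability
    [a] that [x] is bumpy at the origin and differs there from [y] satisfies
    [2 a >= 5/24]. A bumpy tile is determined by its neighbours
    ([bumpy_determined]), so each such disagreement forces another one at one
    of five neighbouring sites, which are not bumpy in [x]: the probability
    [c] of a disagreement at a non-bumpy tile of [x] satisfies [a <= 5 c].
    Thus [x] and [y] disagree at the origin with probability
    [a + c >= 6/5 * 5/48 = 1/8], and by invariance this probability is at most
    the mean Besicovitch distance ([disagree_le_dH]). *)

(** * Cells and valid arrays of cells *)

Ltac liam := Z.div_mod_to_equations; lia.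

Section CleanTilings.
Local Open Scope Z_scope.

Inductive side := dE | dN | dW | dS.

Definition opp_side d :=
  match d with dE => dW | dN => dS | dW => dE | dS => dN end.
Definition flip_side d :=
  match d with dE => dW | dN => dN | dW => dE | dS => dS end.
Definition swap_side d :=
  match d with dE => dN | dN => dE | dW => dS | dS => dW end.
Definition side_eqb d d' :=
  match d, d' with
  | dE, dE | dN, dN | dW, dW | dS, dS => true
  | _, _ => false end.

(** A tile seen from its four sides: [out d] tells whether the central arrow
    of side [d] is outgoing, [line d] gives the colour of its side line and
    the direction of the shift. Colours are booleans, so that exchanging them
    is a negation. *)
Record cell := Cell
  { out : side -> bool; line : side -> option (bool * side); bump : bool }.

Definition hside (b : bool) := if b then dE else dW.
Definition vside (b : bool) := if b then dN else dS.

(** The lines of a cross facing east or west ([fe]) and north or south ([fn]):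
    the line of each faced side is shifted towards the other faced side. *)
Definition cross_line (fe fn c : bool) d : option (bool * side) :=
  match d with
  | dE => if fe then Some (c, vside fn) else None
  | dW => if fe then None else Some (c, vside fn)
  | dN => if fn then Some (c, hside fe) else None
  | dS => if fn then None else Some (c, hside fe)
  end.

(** The tileset up to rotations and reflections: in [ArmOk], [d0] is the side
    of the only outgoing arrow, lines go straight through, and the line
    perpendicular to [d0] is shifted to the side opposite to [d0]. *)
Inductive cell_ok (x : cell) : Prop :=
| CrossOk fe fn c of (forall d, out x d = true) &
    (forall d, line x d = cross_line fe fn c d)
| ArmOk d0 of bump x = false & (forall d, out x d = side_eqb d d0) &
    (forall d, line x (opp_side d) = line x d) &
    (forall c s, line x (swap_side d0) = Some (c, s) -> s = opp_side d0) &
    (forall c s, line x d0 = Some (c, s) ->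
       s = swap_side d0 \/ s = opp_side (swap_side d0)) &
    (forall c s c' s', line x d0 = Some (c, s) ->
       line x (swap_side d0) = Some (c', s') -> c' <> c).

Implicit Types w : Z -> Z -> cell.

Record valid w : Prop := Valid
  { vok : forall i j, cell_ok (w i j);
    voutE : forall i j, out (w (i + 1) j) dW = ~~ out (w i j) dE;
    vlineE : forall i j, line (w (i + 1) j) dW = line (w i j) dE;
    voutN : forall i j, out (w i (j + 1)) dS = ~~ out (w i j) dN;
    vlineN : forall i j, line (w i (j + 1)) dS = line (w i j) dN;
    vbump : forall i j, bump (w i j) = true \/ bump (w (i + 1) j) = true \/
      bump (w i (j + 1)) = true \/ bump (w (i + 1) (j + 1)) = true;
    vbump1 : forall i j i' j', -1 <= i - i' <= 1 -> -1 <= j - j' <= 1 ->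
      bump (w i j) = true -> bump (w i' j') = true -> i = i' /\ j = j' }.

(** The reflections [flip] (about a vertical axis) and [swap] (about the
    diagonal) generate the symmetries of the square; they reduce the four
    orientations of a supertile to one. *)
Definition flip_cell x :=
  Cell (fun d => out x (flip_side d))
       (fun d => omap (fun p => (p.1, flip_side p.2)) (line x (flip_side d)))
       (bump x).
Definition swap_cell x :=
  Cell (fun d => out x (swap_side d))
       (fun d => omap (fun p => (p.1, swap_side p.2)) (line x (swap_side d)))
       (bump x).
Definition flip_world w : Z -> Z -> cell := fun i j => flip_cell (w (- i) j).
Definition swap_world w : Z -> Z -> cell := fun i j => swap_cell (w j i).

Lemma flip_sideK d : flip_side (flip_side d) = d. Proof. by case: d. Qed.
Lemma swap_sideK d : swap_side (swap_side d) = d. Proof. by case: d. Qed.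

Lemma relabel_eq_Some (f : side -> side) (o : option (bool * side)) c s :
  omap (fun p => (p.1, f p.2)) o = Some (c, s) ->
  exists2 s', o = Some (c, s') & s = f s'.
Proof. by case: o => //= -[c' s'] [<- <-]; exists s'. Qed.

Lemma flip_cell_ok x : cell_ok x -> cell_ok (flip_cell x).
Proof.
case=> [fe fn c ho hl|d0 hb ho hop hp hs hc].
  apply: (@CrossOk _ (~~ fe) fn c) => d /=; first by rewrite ho.
  by rewrite hl; case: d; case: fe {hl}; case: fn.
apply: (@ArmOk _ (flip_side d0)) => //=.
- by move=> d; rewrite ho; case: d; case: (d0).
- by move=> d; have hE := hop dE; have hN := hop dN; case: d; rewrite /= ?hE ?hN.
- move=> c s /relabel_eq_Some[s' e ->].
  suff /hp -> : line x (swap_side d0) = Some (c, s') by case: (d0).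
  have hE := hop dE; have hN := hop dN.
  by rewrite -e; case: (d0); rewrite /= ?hE ?hN.
- move=> c s /relabel_eq_Some[s' + ->]; rewrite flip_sideK => /hs[]->;
  by case: (d0) => /=; auto.
- move=> c s c' s' /relabel_eq_Some[s1 + _]; rewrite flip_sideK => h1.
  move=> /relabel_eq_Some[s2 e _].
  apply: (hc _ _ _ s2 h1); rewrite -e.
  have hE := hop dE; have hN := hop dN.
  by case: (d0); rewrite /= ?hE ?hN.
Qed.

Lemma swap_cell_ok x : cell_ok x -> cell_ok (swap_cell x).
Proof.
case=> [fe fn c ho hl|d0 hb ho hop hp hs hc].
  apply: (@CrossOk _ fn fe c) => d /=; first by rewrite ho.
  by rewrite hl; case: d; case: fe {hl}; case: fn.
apply: (@ArmOk _ (swap_side d0)) => //=.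
- by move=> d; rewrite ho; case: d; case: (d0).
- by move=> d; rewrite -hop; case: d.
- move=> c s /relabel_eq_Some[s' e ->].
  by rewrite swap_sideK in e; rewrite (hp _ _ e); case: (d0).
- move=> c s /relabel_eq_Some[s' + ->]; rewrite swap_sideK => /hs[]->;
  by case: (d0) => /=; auto.
- move=> c s c' s' /relabel_eq_Some[s1 + _]; rewrite swap_sideK => h1.
  move=> /relabel_eq_Some[s2 e _].
  by exact: (hc _ _ _ s2 h1).
Qed.

Lemma flip_valid w : valid w -> valid (flip_world w).
Proof.
move=> v; split=> i j; rewrite /flip_world /=.
- exact/flip_cell_ok/vok.
- have <- : - (i + 1) + 1 = - i by lia.
  by rewrite voutE // negbK.
- have <- : - (i + 1) + 1 = - i by lia.
  by rewrite vlineE.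
- by rewrite voutN.
- by rewrite vlineN.
- have := vbump v (- (i + 1)) j; have -> : - (i + 1) + 1 = - i by lia.
  tauto.
- move=> i' j' hi hj b b'.
  by have := vbump1 v (i := - i) (j := j) (i' := - i') (j' := j') _ hj b b'; lia.
Qed.

Lemma swap_valid w : valid w -> valid (swap_world w).
Proof.
move=> v; split=> i j; rewrite /swap_world /=.
- exact/swap_cell_ok/vok.
- by rewrite voutN.
- by rewrite vlineN.
- by rewrite voutE.
- by rewrite vlineE.
- by have := vbump v j i; tauto.
- move=> i' j' hi hj b b'.
  by have := vbump1 v (i := j) (j := i) (i' := j') (j' := i') hj hi b b'; lia.
Qed.

(** * Supertiles *)

Definition pow2 (n : nat) : Z := Z.pow 2 (Z.of_nat n).

Lemma pow2S n : pow2 n.+1 = 2 * pow2 n.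
Proof. by rewrite /pow2 Nat2Z.inj_succ Z.pow_succ_r //; lia. Qed.

Lemma pow2_gt0 n : 0 < pow2 n.
Proof. by apply: Z.pow_pos_nonneg; lia. Qed.

Definition sgnb (b : bool) : Z := if b then 1 else -1.
Definition vx d : Z := match d with dE => 1 | dW => -1 | _ => 0 end.
Definition vy d : Z := match d with dN => 1 | dS => -1 | _ => 0 end.

(** The supertile of level [n] centred at [(i, j)], whose central cross faces
    [fe], [fn] and has colour [c]. The corner supertiles face the centre and
    have the other colour, because their lines cross the arms. *)
Fixpoint supertile (n : nat) w (i j : Z) (fe fn c : bool) : Prop :=
  (forall d, out (w i j) d = true) /\
  (forall d, line (w i j) d = cross_line fe fn c d) /\
  match n with
  | O => bump (w i j) = true
  | S n' => bump (w i j) = false /\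
    (forall d t, 0 < t < 2 * pow2 n' ->
       (forall d', out (w (i + t * vx d) (j + t * vy d)) d' = side_eqb d' d) /\
       line (w (i + t * vx d) (j + t * vy d)) d = cross_line fe fn c d) /\
    (forall se sn, supertile n' w (i + sgnb se * pow2 n')
       (j + sgnb sn * pow2 n') (~~ se) (~~ sn) (~~ c))
  end.

Lemma flip_cross_line x fe fn c d :
  line (flip_cell x) (flip_side d) = cross_line fe fn c (flip_side d) ->
  line x d = cross_line (~~ fe) fn c d.
Proof.
rewrite /= flip_sideK; case: (line x d) => [[c' s]|]; case: d; case: fe; case: fn => //=;
  by case: s => //= -[<-].
Qed.

Lemma supertile_flip n w i j fe fn c :
  supertile n (flip_world w) i j fe fn c -> supertile n w (- i) j (~~ fe) fn c.
Proof.
elim: n i j fe fn c => [|n IH] i j fe fn c.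
  move=> [ho [hl hb]]; split; [|split] => //= d.
    by have := ho (flip_side d); rewrite /= flip_sideK.
  exact: flip_cross_line (hl _).
move=> [ho [hl [hb [ha hs]]]]; split; [|split; [|split; [|split]]] => //=.
- by move=> d; have := ho (flip_side d); rewrite /= flip_sideK.
- by move=> d; exact: flip_cross_line (hl _).
- move=> d t ht; have := ha (flip_side d) t ht.
  rewrite /flip_world /=.
  have -> : - (i + t * vx (flip_side d)) = - i + t * vx d by case: d => /=; lia.
  have -> : vy (flip_side d) = vy d by case: d.
  move=> [h1 h2]; split.
    move=> d'; have := h1 (flip_side d'); rewrite flip_sideK => ->.
    by case: d' {h1 h2}; case: d.
  exact: flip_cross_line h2.
- move=> se sn; have := IH _ _ _ _ _ (hs (~~ se) sn).
  rewrite negbK; congr supertile.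
  by case: se; cbn [sgnb negb]; lia.
Qed.

Lemma swap_cross_line x fe fn c d :
  line (swap_cell x) (swap_side d) = cross_line fe fn c (swap_side d) ->
  line x d = cross_line fn fe c d.
Proof.
rewrite /= swap_sideK; case: (line x d) => [[c' s]|]; case: d; case: fe; case: fn => //=;
  by case: s => //= -[<-].
Qed.

Lemma supertile_swap n w i j fe fn c :
  supertile n (swap_world w) i j fe fn c -> supertile n w j i fn fe c.
Proof.
elim: n i j fe fn c => [|n IH] i j fe fn c.
  move=> [ho [hl hb]]; split; [|split] => //= d.
    by have := ho (swap_side d); rewrite /= swap_sideK.
  exact: swap_cross_line (hl _).
move=> [ho [hl [hb [ha hs]]]]; split; [|split; [|split; [|split]]] => //=.
- by move=> d; have := ho (swap_side d); rewrite /= swap_sideK.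
- by move=> d; exact: swap_cross_line (hl _).
- move=> d t ht; have := ha (swap_side d) t ht.
  rewrite /swap_world /=.
  have -> : vx (swap_side d) = vy d by case: d.
  have -> : vy (swap_side d) = vx d by case: d.
  move=> [h1 h2]; split.
    move=> d'; have := h1 (swap_side d'); rewrite swap_sideK => ->.
    by case: d' {h1 h2}; case: d.
  exact: swap_cross_line h2.
- by move=> se sn; exact: IH (hs sn se).
Qed.

Lemma flip_cellK : involutive flip_cell.
Proof.
case=> o l b; rewrite /flip_cell /=.
congr Cell; apply/funext => d; rewrite flip_sideK //.
by case: (l d) => [[c s]|] //=; rewrite flip_sideK.
Qed.

Lemma swap_cellK : involutive swap_cell.
Proof.
case=> o l b; rewrite /swap_cell /=.
congr Cell; apply/funext => d; rewrite swap_sideK //.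
by case: (l d) => [[c s]|] //=; rewrite swap_sideK.
Qed.

Lemma flip_worldK w : flip_world (flip_world w) = w.
Proof.
apply/funext => i; apply/funext => j.
by rewrite /flip_world flip_cellK Z.opp_involutive.
Qed.

Lemma swap_worldK w : swap_world (swap_world w) = w.
Proof.
apply/funext => i; apply/funext => j.
by rewrite /swap_world swap_cellK.
Qed.

(** A cross has only outgoing arrows, so one ingoing arrow identifies an arm. *)
Lemma in_arm w i j d : valid w -> out (w i j) d = false ->
  bump (w i j) = false /\ forall d', line (w i j) (opp_side d') = line (w i j) d'.
Proof. by move=> v o; case: (vok v i j) => [fe fn c ho|d0 //]; rewrite ho in o. Qed.

(** Seen from outside, a supertile looks like its central cross enlarged: all
    arrows of its border are outgoing, and a line leaves only at the middle of
    the two faced sides. The corner supertiles contribute nothing since they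
    face inwards. *)
Lemma supertile_border n w i j fe fn c d k : supertile n w i j fe fn c ->
  - pow2 n < k < pow2 n ->
  let p := w (i + (pow2 n - 1) * vx d + k * vx (swap_side d))
             (j + (pow2 n - 1) * vy d + k * vy (swap_side d)) in
  out p d = true /\ line p d = if k =? 0 then cross_line fe fn c d else None.
Proof.
cbv zeta; elim: n i j fe fn c k => [|n IH] i j fe fn c k.
  move=> [ho [hl _]]; rewrite /pow2 /= => hk; have -> : k = 0 by lia.
  have -> : i + (1 - 1) * vx d + 0 * vx (swap_side d) = i by lia.
  have -> : j + (1 - 1) * vy d + 0 * vy (swap_side d) = j by lia.
  by rewrite ho hl.
rewrite pow2S; move: (pow2_gt0 n) => m0 [ho [hl [hb [ha hs]]]] hk.
case: (Z.eqb_spec k 0) => [->|k0].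
  have [|h1 h2] := ha d (2 * pow2 n - 1); first by lia.
  have -> : i + (2 * pow2 n - 1) * vx d + 0 * vx (swap_side d) =
            i + (2 * pow2 n - 1) * vx d by lia.
  have -> : j + (2 * pow2 n - 1) * vy d + 0 * vy (swap_side d) =
            j + (2 * pow2 n - 1) * vy d by lia.
  by rewrite h1 h2; split => //; case: (d).
have aux se sn k' : -pow2 n < k' < pow2 n ->
  cross_line (~~ se) (~~ sn) (~~ c) d = None ->
  i + sgnb se * pow2 n + (pow2 n - 1) * vx d + k' * vx (swap_side d) =
  i + (2 * pow2 n - 1) * vx d + k * vx (swap_side d) ->
  j + sgnb sn * pow2 n + (pow2 n - 1) * vy d + k' * vy (swap_side d) =
  j + (2 * pow2 n - 1) * vy d + k * vy (swap_side d) ->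
  out (w (i + (2 * pow2 n - 1) * vx d + k * vx (swap_side d))
    (j + (2 * pow2 n - 1) * vy d + k * vy (swap_side d))) d = true /\
  line (w (i + (2 * pow2 n - 1) * vx d + k * vx (swap_side d))
    (j + (2 * pow2 n - 1) * vy d + k * vy (swap_side d))) d = None.
  move=> hk' hc <- <-; have [-> ->] := IH _ _ _ _ _ _ (hs se sn) hk'.
  by case: (_ =? _).
case: (Z.ltb_spec 0 k) => kp.
  have hk' : - pow2 n < k - pow2 n < pow2 n by lia.
  case: d {ho hl ha IH} aux => aux.
  - by apply: (aux true true _ hk') => //; cbn [sgnb vx vy swap_side]; lia.
  - by apply: (aux true true _ hk') => //; cbn [sgnb vx vy swap_side]; lia.
  - by apply: (aux false false _ hk') => //; cbn [sgnb vx vy swap_side]; lia.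
  - by apply: (aux false false _ hk') => //; cbn [sgnb vx vy swap_side]; lia.
have hk' : - pow2 n < k + pow2 n < pow2 n by lia.
case: d {ho hl ha IH} aux => aux.
- by apply: (aux true false _ hk') => //; cbn [sgnb vx vy swap_side]; lia.
- by apply: (aux false true _ hk') => //; cbn [sgnb vx vy swap_side]; lia.
- by apply: (aux false true _ hk') => //; cbn [sgnb vx vy swap_side]; lia.
- by apply: (aux true false _ hk') => //; cbn [sgnb vx vy swap_side]; lia.
Qed.

(** The quadrant that contains an offset from the centre; as a sign it selects
    the corner supertile. *)
Definition quadrant (a : Z) := 0 <? a.

(** Colours alternate at each level, so the centre fixes the colour of the
    level 0 cells. *)
Fixpoint bump_colour n (c : bool) := if n is n'.+1 then bump_colour n' (~~ c) else c.

Lemma supertile_axis w n i j fe fn c a b : valid w ->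
  supertile n.+1 w i j fe fn c -> -pow2 n.+1 < a < pow2 n.+1 ->
  -pow2 n.+1 < b < pow2 n.+1 -> a = 0 \/ b = 0 -> bump (w (i + a) (j + b)) = false.
Proof.
move=> v [ho [hl [hb [ha hs]]]]; rewrite pow2S => ha' hb' ab.
have aux d t : 0 < t < 2 * pow2 n -> a = t * vx d -> b = t * vy d ->
    bump (w (i + a) (j + b)) = false.
  move=> ht -> ->; have [h1 _] := ha d t ht.
  apply: (proj1 (@in_arm _ _ _ (opp_side d) v _)); rewrite h1.
  by case: (d).
have [a0|[a0|a0]] : a = 0 \/ 0 < a \/ a < 0 by lia.
- have [b0|[b0|b0]] : b = 0 \/ 0 < b \/ b < 0 by lia.
  + by rewrite a0 b0 !Z.add_0_r.
  + by apply: (aux dN b); cbn [vx vy]; lia.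
  + by apply: (aux dS (- b)); cbn [vx vy]; lia.
- by apply: (aux dE a); cbn [vx vy]; lia.
- by apply: (aux dW (- a)); cbn [vx vy]; lia.
Qed.

Lemma in_quadrant n a : - (2 * pow2 n) < a < 2 * pow2 n -> a <> 0 ->
  - pow2 n < a - sgnb (quadrant a) * pow2 n < pow2 n.
Proof. by rewrite /quadrant; case: Z.ltb_spec => h; cbn [sgnb]; lia. Qed.

(** Bumpy cells of a supertile form a sublattice of index 4: none lies on the
    axes, and the centres of the corner supertiles are shifted by powers of 2. *)
Lemma supertile_bump w n i j fe fn c a b : valid w -> supertile n w i j fe fn c ->
  - pow2 n < a < pow2 n -> - pow2 n < b < pow2 n ->
  bump (w (i + a) (j + b)) = true <->
  (a + pow2 n - 1) mod 2 = 0 /\ (b + pow2 n - 1) mod 2 = 0.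
Proof.
move=> v; elim: n i j fe fn c a b => [|n IH] i j fe fn c a b.
  rewrite /pow2 /= => -[_ [_ hb]] ha hb'.
  have -> : a = 0 by lia. have -> : b = 0 by lia.
  by rewrite !Z.add_0_r hb.
move=> st; have := supertile_axis v st; move: st; rewrite pow2S.
move=> [_ [_ [_ [_ hs]]]] hx ha hb.
have [a0|a0] := Z.eq_dec a 0.
  by rewrite hx //; [split => // -[h1 h2]; exfalso; liam|left].
have [b0|b0] := Z.eq_dec b 0.
  by rewrite hx //; [split => // -[h1 h2]; exfalso; liam|right].
have := IH _ _ _ _ _ _ _ (hs (quadrant a) (quadrant b))
  (in_quadrant ha a0) (in_quadrant hb b0).
have -> x y s : x + s * pow2 n + (y - s * pow2 n) = x + y by lia.
have -> x y s : x + s * pow2 n + (y - s * pow2 n) = x + y by lia.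
move=> ->.
have aux x : x <> 0 -> (x - sgnb (quadrant x) * pow2 n + pow2 n - 1) mod 2 = 0 <->
    (x + 2 * pow2 n - 1) mod 2 = 0.
  by rewrite /quadrant; case: Z.ltb_spec => h _; cbn [sgnb]; liam.
by rewrite !aux.
Qed.

Lemma supertile_bump_line w n i j fe fn c a b : valid w ->
  supertile n w i j fe fn c ->
  - pow2 n < a < pow2 n -> - pow2 n < b < pow2 n ->
  bump (w (i + a) (j + b)) = true -> exists fe' fn',
  forall d, line (w (i + a) (j + b)) d = cross_line fe' fn' (bump_colour n c) d.
Proof.
move=> v; elim: n i j fe fn c a b => [|n IH] i j fe fn c a b.
  rewrite /pow2 /= => -[_ [hl hb]] ha hb' _.
  have -> : a = 0 by lia. have -> : b = 0 by lia.
  by rewrite !Z.add_0_r; exists fe, fn.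
move=> st; have := supertile_axis v st; move: st; rewrite pow2S.
move=> [_ [_ [_ [_ hs]]]] hx ha hb bp.
have [a0|a0] := Z.eq_dec a 0; first by rewrite hx // in bp; left.
have [b0|b0] := Z.eq_dec b 0; first by rewrite hx // in bp; right.
have := IH _ _ _ _ _ _ _ (hs (quadrant a) (quadrant b))
  (in_quadrant ha a0) (in_quadrant hb b0).
have -> x y s : x + s * pow2 n + (y - s * pow2 n) = x + y by lia.
have -> x y s : x + s * pow2 n + (y - s * pow2 n) = x + y by lia.
exact.
Qed.

Lemma cross_line_inj fe fn c fe' fn' c' :
  (forall d, cross_line fe fn c d = cross_line fe' fn' c' d) ->
  [/\ fe = fe', fn = fn' & c = c'].
Proof.
move=> h; move: (h dE) (h dN) (h dW) (h dS).
by case: fe {h}; case: fe'; case: fn; case: fn' => //= *; split=> //; congruence.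
Qed.

(** Two supertiles of the same level that share a bumpy cell coincide. By
    induction the corner supertiles around that cell coincide, and the
    direction they face locates the centre. *)
Lemma supertile_unique w n i j fe fn c i' j' fe' fn' c' x y : valid w ->
  supertile n w i j fe fn c -> supertile n w i' j' fe' fn' c' ->
  bump (w x y) = true ->
  - pow2 n < x - i < pow2 n -> - pow2 n < y - j < pow2 n ->
  - pow2 n < x - i' < pow2 n -> - pow2 n < y - j' < pow2 n ->
  i = i' /\ j = j'.
Proof.
move=> v st st' bxy hx hy hx' hy'.
suff [] : [/\ i = i', j = j', fe = fe' & fn = fn'] by [].
elim: n i j fe fn c i' j' fe' fn' c' st st' hx hy hx' hy' =>
    [|n IH] i j fe fn c i' j' fe' fn' c'.
  move=> [_ [hl _]] [_ [hl' _]]; rewrite /pow2 /= => *.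
  have ei : i = i' by lia. have ej : j = j' by lia. subst i' j'.
  have [|e1 e2 e3] // := @cross_line_inj fe fn c fe' fn' c'.
  by move=> d; rewrite -hl hl'.
move=> st st'; have := supertile_axis v st; have := supertile_axis v st'.
move: st st'; rewrite pow2S.
move=> [_ [hl [_ [_ hs]]]] [_ [hl' [_ [_ hs']]]] ax' ax hx hy hx' hy'.
have e0 (p q : Z) : q + (p - q) = p by lia.
have xi : x - i <> 0.
  by move=> h; have := ax _ _ hx hy (or_introl h); rewrite !e0 bxy.
have yj : y - j <> 0.
  by move=> h; have := ax _ _ hx hy (or_intror h); rewrite !e0 bxy.
have xi' : x - i' <> 0.
  by move=> h; have := ax' _ _ hx' hy' (or_introl h); rewrite !e0 bxy.
have yj' : y - j' <> 0.
  by move=> h; have := ax' _ _ hx' hy' (or_intror h); rewrite !e0 bxy.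
have := in_quadrant hx xi; have := in_quadrant hy yj.
have := in_quadrant hx' xi'; have := in_quadrant hy' yj'.
move=> q1 q2 q3 q4.
have [||||e1 e2 e3 e4] :=
  IH _ _ _ _ _ _ _ _ _ _ (hs (quadrant (x - i)) (quadrant (y - j)))
    (hs' (quadrant (x - i')) (quadrant (y - j'))); try lia.
have e3' := negb_inj e3; have e4' := negb_inj e4.
rewrite e3' in e1; rewrite e4' in e2.
have ei : i = i' by lia. have ej : j = j' by lia. subst i' j'.
have [|f1 f2 f3] // := @cross_line_inj fe fn c fe' fn' c'.
by move=> d; rewrite -hl hl'.
Qed.

End CleanTilings.

(** * Growth of supertiles in a clean tiling *)

Section Growth.
Local Open Scope Z_scope.
Implicit Types w : Z -> Z -> cell.

Lemma supertile_center n w i j fe fn c : supertile n w i j fe fn c ->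
  (forall d, out (w i j) d = true) /\
  (forall d, line (w i j) d = cross_line fe fn c d).
Proof. by case: n => [|n] [? []]. Qed.

Lemma borderE n w i j fe fn c y : supertile n w i j fe fn c ->
  - pow2 n < y - j < pow2 n ->
  out (w (i + pow2 n - 1) y) dE = true /\
  line (w (i + pow2 n - 1) y) dE =
    if y - j =? 0 then cross_line fe fn c dE else None.
Proof.
move=> st h; have := supertile_border dE st h; cbv zeta; cbn [vx vy swap_side].
have -> : i + (pow2 n - 1) * 1 + (y - j) * 0 = i + pow2 n - 1 by lia.
by have -> : j + (pow2 n - 1) * 0 + (y - j) * 1 = y by lia.
Qed.

Lemma borderW n w i j fe fn c y : supertile n w i j fe fn c ->
  - pow2 n < y - j < pow2 n ->
  out (w (i - pow2 n + 1) y) dW = true /\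
  line (w (i - pow2 n + 1) y) dW =
    if y - j =? 0 then cross_line fe fn c dW else None.
Proof.
move=> st h; have h' : - pow2 n < j - y < pow2 n by lia.
have := supertile_border dW st h'; cbv zeta; cbn [vx vy swap_side].
have -> : i + (pow2 n - 1) * -1 + (j - y) * 0 = i - pow2 n + 1 by lia.
have -> : j + (pow2 n - 1) * 0 + (j - y) * -1 = y by lia.
by have -> : (j - y =? 0) = (y - j =? 0) by case: Z.eqb_spec; case: Z.eqb_spec => //; lia.
Qed.

Lemma borderN n w i j fe fn c x : supertile n w i j fe fn c ->
  - pow2 n < x - i < pow2 n ->
  out (w x (j + pow2 n - 1)) dN = true /\
  line (w x (j + pow2 n - 1)) dN =
    if x - i =? 0 then cross_line fe fn c dN else None.
Proof.
move=> st h; have := supertile_border dN st h; cbv zeta; cbn [vx vy swap_side].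
have -> : j + (pow2 n - 1) * 1 + (x - i) * 0 = j + pow2 n - 1 by lia.
by have -> : i + (pow2 n - 1) * 0 + (x - i) * 1 = x by lia.
Qed.

Lemma supertile_bumpP w n i j fe fn c x y : valid w ->
  supertile n w i j fe fn c ->
  - pow2 n < x - i < pow2 n -> - pow2 n < y - j < pow2 n ->
  bump (w x y) = true <->
  (x - i + pow2 n - 1) mod 2 = 0 /\ (y - j + pow2 n - 1) mod 2 = 0.
Proof.
move=> v st hx hy; have := supertile_bump v st hx hy.
have -> : i + (x - i) = x by lia.
by have -> : j + (y - j) = y by lia.
Qed.

(** Half-shifted supertiles of positive level share a bumpy cell; at level 0
    they are two adjacent bumpy cells. *)
Lemma supertile_exclusion n w i j fe fn c i' j' fe' fn' c' : valid w ->
  supertile n w i j fe fn c -> supertile n w i' j' fe' fn' c' ->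
  i' = i \/ i' = i + pow2 n \/ i' = i - pow2 n ->
  j' = j \/ j' = j + pow2 n \/ j' = j - pow2 n -> i = i' /\ j = j'.
Proof.
move=> v; case: n => [|n].
  rewrite /pow2 /= => -[_ [_ b]] [_ [_ b']] hi hj.
  by apply: (vbump1 v _ _ b b'); lia.
move=> st st' hi hj; have := pow2_gt0 n; have eq := pow2S n => m0.
have [x [hx1 [hx2 hx3]]] : exists x, - pow2 n.+1 < x - i < pow2 n.+1 /\
    - pow2 n.+1 < x - i' < pow2 n.+1 /\ (x - i + pow2 n.+1 - 1) mod 2 = 0.
  case: (Z.ltb_spec i' i) => h; [exists (i - 1)|exists (i + 1)];
    (split; [|split]); liam.
have [y [hy1 [hy2 hy3]]] : exists y, - pow2 n.+1 < y - j < pow2 n.+1 /\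
    - pow2 n.+1 < y - j' < pow2 n.+1 /\ (y - j + pow2 n.+1 - 1) mod 2 = 0.
  case: (Z.ltb_spec j' j) => h; [exists (j - 1)|exists (j + 1)];
    (split; [|split]); liam.
by apply: (supertile_unique v st st' (x := x) (y := y)) => //;
  apply/(supertile_bumpP v st).
Qed.

(** The induction hypothesis of the growth argument. *)
Definition covered n w := forall i j, bump (w i j) = true ->
  exists a b fe fn c, [/\ - pow2 n < i - a < pow2 n,
    - pow2 n < j - b < pow2 n & supertile n w a b fe fn c].

Definition occupied n w i j := exists fe fn c, supertile n w i j fe fn c.

(** The column next to the east border of a supertile receives arrows from it,
    so it contains only arms. *)
Lemma right_column n w i j fn c y : valid w -> supertile n w i j true fn c ->
  - pow2 n < y - j < pow2 n ->
  [/\ out (w (i + pow2 n) y) dW = false, bump (w (i + pow2 n) y) = false &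
      (forall d, line (w (i + pow2 n) y) (opp_side d) =
                 line (w (i + pow2 n) y) d)].
Proof.
move=> v st hy; have [ho _] := borderE st hy.
have o : out (w (i + pow2 n) y) dW = false.
  have -> : i + pow2 n = i + pow2 n - 1 + 1 by lia.
  by rewrite voutE // ho.
by have [] := in_arm v o.
Qed.

Lemma right_column_line n w i j fn c : valid w -> supertile n w i j true fn c ->
  line (w (i + pow2 n) j) dW = Some (c, vside fn) /\
  line (w (i + pow2 n + 1) j) dW = Some (c, vside fn).
Proof.
move=> v st; have m0 := pow2_gt0 n.
have hj : - pow2 n < j - j < pow2 n by lia.
have [_ hl] := borderE st hj; have [ o _ through] := right_column v st hj.
have e : line (w (i + pow2 n) j) dW = Some (c, vside fn).
  have -> : i + pow2 n = i + pow2 n - 1 + 1 by lia.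
  by rewrite vlineE // hl Z.sub_diag.
by split=> //; rewrite vlineE // -e; exact: (through dW).
Qed.

Lemma cross_lineW fe fn c c' fn' :
  cross_line fe fn c dW = Some (c', vside fn') -> [/\ fe = false, fn = fn' & c = c'].
Proof. by case: fe => //= -[-> e]; split=> //; move: e; case: fn; case: fn'. Qed.

(** Near the axis, the column next to a supertile contains no bumpy cell; the
    rule on 2 by 2 squares puts one in the following column, in the row of the
    centre or both in the row above and in the row below. *)
Lemma neighbour_east0 n w i j fn c : valid w -> supertile n w i j true fn c ->
  bump (w (i + pow2 n + 1) j) = true \/
  bump (w (i + pow2 n + 1) (j + 1)) = true /\
  bump (w (i + pow2 n + 1) (j - 1)) = true.
Proof.
move=> v st; have m0 := pow2_gt0 n.
have nb k : -1 <= k <= 1 -> bump (w (i + pow2 n) (j + k)) = false.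
  case: n st m0 => [[_ [_ b]] _|n st m0] hk.
    apply/negbTE/negP => b'.
    by have [] := vbump1 v _ _ b b'; rewrite /pow2 /=; lia.
  have e := pow2S n; have := pow2_gt0 n => m1.
  have hk' : - pow2 n.+1 < j + k - j < pow2 n.+1 by lia.
  by have [] := right_column v st hk'.
have := vbump v (i + pow2 n) j; have := vbump v (i + pow2 n) (j - 1).
have -> : j - 1 + 1 = j by lia.
have -> : j - 1 = j + -1 by lia.
have := nb 0; rewrite Z.add_0_r => -> //; rewrite !nb; lia.
Qed.

(** Otherwise the supertile of that bumpy cell would extend to the column of
    bumpy cells on the east border of the given one, and share a bumpy cell
    with it. *)
Lemma neighbour_east_border n w i j fn c s a b fe' fn' c' : valid w ->
  supertile n.+1 w i j true fn c ->
  -1 <= s <= 1 -> bump (w (i + pow2 n.+1 + 1) (j + s)) = true ->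
  - pow2 n.+1 < i + pow2 n.+1 + 1 - a < pow2 n.+1 ->
  - pow2 n.+1 < j + s - b < pow2 n.+1 -> supertile n.+1 w a b fe' fn' c' ->
  a = i + 2 * pow2 n.+1.
Proof.
move=> v st hs bp ha hb st'; have e := pow2S n; have m0 := pow2_gt0 n.
have := proj1 (supertile_bumpP v st' ha hb) bp => -[pa pb].
case: (Z.leb_spec (i + pow2 n.+1 - 1 - a) (- pow2 n.+1)) => h; first by liam.
have h' : - pow2 n.+1 < i + pow2 n.+1 - 1 - a < pow2 n.+1 by lia.
have b1 : bump (w (i + pow2 n.+1 - 1) (j + s)) = true.
  by apply/(supertile_bumpP v st') => //; split=> //; liam.
by have [] := supertile_unique v st st' b1; lia.
Qed.

(** The supertile found on the other side of the column is either shifted by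
    half a supertile, or aligned; in the aligned case the line that crosses
    the column forces it to face west with the same colour. *)
Lemma neighbour_east_side n w i j fn c s : valid w -> covered n.+1 w ->
  supertile n.+1 w i j true fn c -> s = 1 \/ s = -1 ->
  bump (w (i + pow2 n.+1 + 1) (j + s)) = true ->
  supertile n.+1 w (i + 2 * pow2 n.+1) j false fn c \/
  occupied n.+1 w (i + 2 * pow2 n.+1) (j + s * pow2 n.+1).
Proof.
move=> v cov st hs bp; have e := pow2S n; have m0 := pow2_gt0 n.
have [a [b [fe' [fn' [c' [ha hb st']]]]]] := cov _ _ bp.
have hs' : -1 <= s <= 1 by lia.
have ea := neighbour_east_border v st hs' bp ha hb st'; subst a.
have := proj1 (supertile_bumpP v st' ha hb) bp => -[_ pb].
have [hj|hj] : - pow2 n.+1 < j - b < pow2 n.+1 \/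
    b = j + s * pow2 n.+1 by move: pb hb {bp ha st' hs'}; case: hs => ->; liam.
  left; have [_ l1] := right_column_line v st.
  have [_] := borderW st' hj.
  have -> : i + 2 * pow2 n.+1 - pow2 n.+1 + 1 = i + pow2 n.+1 + 1 by lia.
  rewrite l1; case: Z.eqb_spec => // jb /esym/cross_lineW[efe efn ec].
  move: st'; have -> : b = j by lia.
  by rewrite efe efn ec.
by right; rewrite -hj; exists fe', fn', c'.
Qed.

(** On the other side of the column there is either the mirror image of the
    supertile, or a supertile shifted by [pow2 n] on each side of the axis.
    The line sent through the column by its cross excludes everything else. *)
Lemma neighbour_east n w i j fn c : valid w -> covered n w ->
  supertile n w i j true fn c ->
  supertile n w (i + 2 * pow2 n) j false fn c \/
  occupied n w (i + 2 * pow2 n) (j + pow2 n) /\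
  occupied n w (i + 2 * pow2 n) (j - pow2 n).
Proof.
move=> v cov st; have m0 := pow2_gt0 n.
case: n cov st m0 => [|n] cov st m0.
  have occ y : bump (w (i + 2 * pow2 0) y) = true ->
      occupied 0 w (i + 2 * pow2 0) y.
    move=> b; case: (vok v (i + 2 * pow2 0) y) => [fe fn' c' ho hl|d]; last first.
      by rewrite b.
    by exists fe, fn', c'; split.
  have := neighbour_east0 v st; have -> : i + pow2 0 + 1 = i + 2 * pow2 0.
    by rewrite /pow2 /=; lia.
  case=> [b|[b1 b2]]; last by right; split; exact: occ.
  left; have [fe [fn' [c' st']]] := occ _ b.
  have [_ l1] := right_column_line v st.
  have [_ l2] := supertile_center st'.
  move: l1; have -> : i + pow2 0 + 1 = i + 2 * pow2 0 by rewrite /pow2 /=; lia.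
  by rewrite l2 => /cross_lineW[efe efn ec]; move: st'; rewrite efe efn ec.
have e := pow2S n; have m1 := pow2_gt0 n.
case: (neighbour_east0 v st) => [b|[b1 b2]].
  have [a [b' [fe' [fn' [c' [ha hb st']]]]]] := cov _ _ b.
  have hs' : -1 <= 0 <= 1 by lia.
  have hb0 : - pow2 n.+1 < j + 0 - b' < pow2 n.+1 by lia.
  have bp0 : bump (w (i + pow2 n.+1 + 1) (j + 0)) = true by rewrite Z.add_0_r.
  have ea := neighbour_east_border v st hs' bp0 ha hb0 st'; subst a.
  have := proj1 (supertile_bumpP v st' ha hb) b => -[_ pb].
  have [_ l1] := right_column_line v st.
  have [_] := borderW st' hb.
  have -> : i + 2 * pow2 n.+1 - pow2 n.+1 + 1 = i + pow2 n.+1 + 1 by lia.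
  by rewrite l1; case: Z.eqb_spec => // jb _; liam.
case: (@neighbour_east_side _ _ _ _ _ _ 1 v cov st _ b1) => [|?|o1]; auto.
case: (@neighbour_east_side _ _ _ _ _ _ (-1) v cov st _ b2) => [|?|o2]; auto.
right; split; first by have -> : j + pow2 n.+1 = j + 1 * pow2 n.+1 by lia.
by have -> : j - pow2 n.+1 = j + -1 * pow2 n.+1 by lia.
Qed.

Lemma supertile_swapV n w i j fe fn c :
  supertile n w j i fn fe c -> supertile n (swap_world w) i j fe fn c.
Proof. by move=> st; apply: supertile_swap; rewrite swap_worldK. Qed.

Lemma supertile_flipV n w i j fe fn c :
  supertile n w i j fe fn c -> supertile n (flip_world w) (- i) j (~~ fe) fn c.
Proof. by move=> st; apply: supertile_flip; rewrite flip_worldK. Qed.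

Lemma swap_covered n w : covered n w -> covered n (swap_world w).
Proof.
move=> cov i j b; have [a [a' [fe [fn [c [? ? ?]]]]]] := cov j i b.
by exists a', a, fn, fe, c; split=> //; exact: supertile_swapV.
Qed.

Lemma flip_covered n w : covered n w -> covered n (flip_world w).
Proof.
move=> cov i j b; have [a [a' [fe [fn [c [? ? ?]]]]]] := cov (- i) j b.
exists (- a), a', (~~ fe), fn, c; split=> //; first by lia.
exact: supertile_flipV.
Qed.

Lemma neighbour_north n w i j fe c : valid w -> covered n w ->
  supertile n w i j fe true c ->
  supertile n w i (j + 2 * pow2 n) fe false c \/
  occupied n w (i + pow2 n) (j + 2 * pow2 n) /\
  occupied n w (i - pow2 n) (j + 2 * pow2 n).
Proof.
move=> v cov /supertile_swapV st.
case: (neighbour_east (swap_valid v) (swap_covered cov) st) => [st'|[ o o']].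
  by left; exact: supertile_swap.
right; case: o => [a [b [e /supertile_swap ?]]].
case: o' => [a' [b' [e' /supertile_swap ?]]].
by split; [exists b, a, e|exists b', a', e'].
Qed.

(** The borders of the three supertiles make the column between them a column
    of arms, at each height with an ingoing horizontal arrow. The line of the
    lower supertile, shifted north, keeps the arm at its height from pointing
    north; then the next arm has to point south, and so on up to the height of
    the upper supertile, whose line, shifted south, excludes it. *)
Lemma misaligned_east n w i j c c' : valid w ->
  supertile n w i j true true c ->
  supertile n w i (j + 2 * pow2 n) true false c' ->
  occupied n w (i + 2 * pow2 n) (j + pow2 n) -> False.
Proof.
move=> v s0 s1 [fe [fn [c2 s2]]]; have m0 := pow2_gt0 n.
have arm k : 0 <= k <= 2 * pow2 n ->
    exists d, out (w (i + pow2 n) (j + k)) d = false.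
  move=> hk; have [h|[h|h]] : - pow2 n < j + k - j < pow2 n \/
    - pow2 n < j + k - (j + 2 * pow2 n) < pow2 n \/ k = pow2 n by lia.
  - by exists dW; have [] := right_column v s0 h.
  - by exists dW; have [] := right_column v s1 h.
  exists dE; have h' : - pow2 n < j + k - (j + pow2 n) < pow2 n by lia.
  have [] := borderW s2 h'.
  have -> : i + 2 * pow2 n - pow2 n + 1 = i + pow2 n + 1 by lia.
  by rewrite voutE // => /negbTE.
have up k : 0 <= k -> k < 2 * pow2 n ->
    out (w (i + pow2 n) (j + (k + 1))) dS = true.
  move: k; apply: natlike_ind => [|k hk IH] h.
    have [|d hd] := arm 0; first by lia.
    rewrite Z.add_0_r in hd; rewrite Z.add_assoc Z.add_0_r voutN //.
    case: (vok v (i + pow2 n) j) => [? ? ? ho|d0 _ ho _ hp _ _].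
      by rewrite ho in hd.
    have [l _] := right_column_line v s0.
    move: hp; rewrite ho; case: d0 {ho} => //= /(_ _ _ _) hp.
    have [|_ _ th] := right_column (y := j) v s0; first by lia.
    by have := hp c (vside true); rewrite -(th dE) l => /(_ erefl).
  have hk1 : k < 2 * pow2 n by lia.
  have [|d hd] := arm (k + 1); first by lia.
  have := IH hk1.
  have -> : j + (Z.succ k + 1) = j + (k + 1) + 1 by lia.
  rewrite voutN //.
  case: (vok v (i + pow2 n) (j + (k + 1))) => [? ? ? ho|d0 _ ho _ _ _ _].
    by rewrite ho in hd.
  by rewrite !ho; case: d0 {ho}.
have := up (2 * pow2 n - 1).
have -> : 2 * pow2 n - 1 + 1 = 2 * pow2 n by lia.
move=> h; have {}h : out (w (i + pow2 n) (j + 2 * pow2 n)) dS = true by apply: h; lia.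
have [l _] := right_column_line v s1.
have [|o _ th] := right_column (y := j + 2 * pow2 n) v s1; first by lia.
case: (vok v (i + pow2 n) (j + 2 * pow2 n)) => [? ? ? ho|d0 _ ho _ hp _ _].
  by rewrite ho in o.
move: h hp; rewrite ho; case: d0 {ho} => //= _ hp.
by have := hp _ _ l.
Qed.

Lemma vertical_run w x y0 k : valid w ->
  (forall l, 0 <= l <= k -> out (w x (y0 + l)) dE = false /\
                            out (w x (y0 + l)) dW = false) ->
  forall l, 0 <= l -> l <= k -> out (w x (y0 + l)) dS = out (w x y0) dS.
Proof.
move=> v h; apply: natlike_ind => [|l l0 IH] lk.
  by rewrite Z.add_0_r.
rewrite -IH; last by lia.
have -> : y0 + Z.succ l = y0 + l + 1 by lia.
rewrite voutN //; have [|hE hW] := h l; first by lia.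
case: (vok v x (y0 + l)) => [? ? ? ho|d0 _ ho _ _ _ _].
  by rewrite ho in hE.
by move: hE hW; rewrite !ho; case: d0 {ho}.
Qed.

(** Between two supertiles facing each other all arms of the column point the
    same way, and the line that joins the two centres, being shifted away from
    the outgoing arrow, decides which. *)
Lemma channel n w i j fn c c' k : valid w ->
  supertile n w i j true fn c -> supertile n w (i + 2 * pow2 n) j false fn c' ->
  - pow2 n < k < pow2 n ->
  forall d, out (w (i + pow2 n) (j + k)) d = side_eqb d (vside (~~ fn)).
Proof.
move=> v s0 s1 hk; have m0 := pow2_gt0 n.
have hEW l : - pow2 n < l < pow2 n ->
    out (w (i + pow2 n) (j + l)) dE = false /\ out (w (i + pow2 n) (j + l)) dW = false.
  move=> hl; have hl' : - pow2 n < j + l - j < pow2 n by lia.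
  have [-> _ _] := right_column v s0 hl'; split=> //.
  have [] := borderW s1 hl'.
  have -> : i + 2 * pow2 n - pow2 n + 1 = i + pow2 n + 1 by lia.
  by rewrite voutE // => /negbTE.
have run l : - pow2 n < l < pow2 n ->
    out (w (i + pow2 n) (j + l)) dS = out (w (i + pow2 n) (j - pow2 n + 1)) dS.
  move=> hl; rewrite -(vertical_run (x := i + pow2 n) (y0 := j - pow2 n + 1) (k := 2 * pow2 n - 2) v _ (l := l + pow2 n - 1)); try lia.
    by congr (out (w _ _) _); lia.
  move=> l' hl'; have := hEW (l' - pow2 n + 1).
  have -> : j + (l' - pow2 n + 1) = j - pow2 n + 1 + l' by lia.
  by apply; lia.
have o0 : out (w (i + pow2 n) j) dS = fn.
  have := hEW 0; rewrite Z.add_0_r => -[]; first by lia.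
  case: (vok v (i + pow2 n) j) => [? ? ? ho|d0 _ ho _ hp _ _].
    by rewrite ho.
  have [l _] := right_column_line v s0.
  have [|_ _ th] := right_column (y := j) v s0; first by lia.
  move: hp; rewrite !ho; case: d0 {ho} => //= hp _ _.
    by have := hp c (vside fn); rewrite -(th dE) l => /(_ erefl); case: (fn).
  by have := hp c (vside fn); rewrite l => /(_ erefl); case: (fn).
have [hE hW] := hEW k hk.
have oS : out (w (i + pow2 n) (j + k)) dS = fn.
  by rewrite run // -(run 0) ?Z.add_0_r //; lia.
case: (vok v (i + pow2 n) (j + k)) => [? ? ? ho|d0 _ ho _ _ _ _].
  by rewrite ho in hE.
move: hE hW oS; rewrite !ho; case: d0 ho => //= ho _ _ <- d; exact: ho.
Qed.

Lemma channel_swap n w i j fe c c' k : valid w ->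
  supertile n w i j fe true c -> supertile n w i (j + 2 * pow2 n) fe false c' ->
  - pow2 n < k < pow2 n ->
  forall d, out (w (i + k) (j + pow2 n)) d = side_eqb d (hside (~~ fe)).
Proof.
move=> v /supertile_swapV s0 /supertile_swapV s1 hk d.
have := channel (swap_valid v) s0 s1 hk (swap_side d).
by rewrite /= swap_sideK => ->; case: d; case: (fe).
Qed.

Lemma line_step w x y d : valid w ->
  line (w (x + vx d) (y + vy d)) (opp_side d) = line (w x y) d.
Proof.
move=> v; case: d; cbn [vx vy opp_side]; rewrite ?Z.add_0_r.
- exact: vlineE.
- exact: vlineN.
- have {2}-> : x = x + -1 + 1 by lia.
  by rewrite vlineE.
- have {2}-> : y = y + -1 + 1 by lia.
  by rewrite vlineN.
Qed.

Lemma out_step w x y d : valid w ->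
  out (w (x + vx d) (y + vy d)) (opp_side d) = ~~ out (w x y) d.
Proof.
move=> v; case: d; cbn [vx vy opp_side]; rewrite ?Z.add_0_r.
- exact: voutE.
- exact: voutN.
- have {2}-> : x = x + -1 + 1 by lia.
  by rewrite voutE // negbK.
- have {2}-> : y = y + -1 + 1 by lia.
  by rewrite voutN // negbK.
Qed.

Lemma line_run w x y d k : valid w ->
  (forall t, 0 < t < k ->
     out (w (x + t * vx d) (y + t * vy d)) (opp_side d) = false) ->
  forall t, 0 <= t -> t < k ->
  line (w (x + t * vx d) (y + t * vy d)) d = line (w x y) d.
Proof.
move=> v h; apply: natlike_ind => [|t t0 IH] tk.
  by rewrite !Z.mul_0_l !Z.add_0_r.
rewrite -IH; last by lia.
have [|_ th] := in_arm v (h (Z.succ t) _); first by lia.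
rewrite -th -(line_step _ _ d v); congr (line (w _ _) _); lia.
Qed.

(** A supertile facing north-east is the south-west corner of a supertile of
    the next level. Its mates exist because misaligned neighbours are
    impossible on both sides; the four channels between the mates diverge from
    their common corner, which therefore is a cross, not bumpy since a bumpy
    cell touches it diagonally; and its colour differs from that of the corner
    supertiles since its line crosses the line joining two of them. *)
Lemma growth_NE n w i j c : valid w -> covered n w ->
  supertile n w i j true true c ->
  exists fe fn, supertile n.+1 w (i + pow2 n) (j + pow2 n) fe fn (~~ c).
Proof.
move=> v cov s00; have m0 := pow2_gt0 n.
(* The three mates. If both neighbours of [s00] were misaligned, they would
   overlap; if one were, the column or row beside it would contradict
   [misaligned_east]. *)
have [s10 [s01 s11]] : supertile n w (i + 2 * pow2 n) j false true c /\
    supertile n w i (j + 2 * pow2 n) true false c /\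
    supertile n w (i + 2 * pow2 n) (j + 2 * pow2 n) false false c.
  have [s10|[oE _]] := neighbour_east v cov s00; last first.
    have [s01|[[fe [fn [c' oN]]] _]] := neighbour_north v cov s00.
      by case: (misaligned_east v s00 s01 oE).
    have [fe' [fn' [c2 oE']]] := oE.
    by have [] := supertile_exclusion v oE' oN; lia.
  have [s01|[oN _]] := neighbour_north v cov s00; last first.
    have [fe' [fn' [c2 oN']]] := oN.
    case: (misaligned_east (n := n) (w := swap_world w) (i := j) (j := i)
             (c := c) (c' := c) (swap_valid v)); try exact: supertile_swapV.
    by exists fn', fe', c2; exact: supertile_swapV.
  split=> //; split=> //.
  have [//|[_ [fe [fn [c' o]]]]] := neighbour_north v cov s10.
  by have [] := supertile_exclusion v s01 o; lia.
(* The four channels, named by the direction in which their arms point. *)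
have chS k : - pow2 n < k < pow2 n -> forall d,
    out (w (i + pow2 n) (j + k)) d = side_eqb d dS.
  by move=> hk d; rewrite (channel v s00 s10).
have chN k : - pow2 n < k < pow2 n -> forall d,
    out (w (i + pow2 n) (j + 2 * pow2 n + k)) d = side_eqb d dN.
  by move=> hk d; rewrite (channel v s01 s11).
have chW k : - pow2 n < k < pow2 n -> forall d,
    out (w (i + k) (j + pow2 n)) d = side_eqb d dW.
  by move=> hk d; rewrite (channel_swap v s00 s01).
have chE k : - pow2 n < k < pow2 n -> forall d,
    out (w (i + 2 * pow2 n + k) (j + pow2 n)) d = side_eqb d dE.
  by move=> hk d; rewrite (channel_swap v s10 s11).
have ax d t : 0 < t < 2 * pow2 n -> forall d',
    out (w (i + pow2 n + t * vx d) (j + pow2 n + t * vy d)) d' = side_eqb d' d.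
  move=> ht d'; case: d; cbn [vx vy].
  - by rewrite -(chE (t - pow2 n)); [congr (out (w _ _) _); lia|lia].
  - by rewrite -(chN (t - pow2 n)); [congr (out (w _ _) _); lia|lia].
  - by rewrite -(chW (pow2 n - t)); [congr (out (w _ _) _); lia|lia].
  - by rewrite -(chS (pow2 n - t)); [congr (out (w _ _) _); lia|lia].
(* The four arms that touch the common corner point away from it. *)
have oc d : out (w (i + pow2 n) (j + pow2 n)) d = true.
  apply/negPn; rewrite -(out_step _ _ d v).
  have := ax d 1; rewrite !Z.mul_1_l => -> //; last by lia.
  by case: d.
have nb : bump (w (i + pow2 n) (j + pow2 n)) = false.
  apply/negbTE/negP => b.
  have b' : bump (w (i + pow2 n - 1) (j + pow2 n - 1)) = true.
    by apply/(supertile_bumpP v s00); try lia; split; liam.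
  by have [] := vbump1 v _ _ b b'; lia.
case: (vok v (i + pow2 n) (j + pow2 n)) => [fe fn c' _ hl|d0 _ ho]; last first.
  by have := oc (opp_side d0); rewrite ho; case: (d0).
have axl d t : 0 < t < 2 * pow2 n ->
    line (w (i + pow2 n + t * vx d) (j + pow2 n + t * vy d)) d =
    cross_line fe fn c' d.
  move=> ht; rewrite (line_run (k := 2 * pow2 n)) ?hl //; try lia.
  by move=> t' ht'; rewrite ax //; case: (d).
have ht : 0 < pow2 n < 2 * pow2 n by lia.
(* Follow the line of the cross to its crossing with a line that joins two
   corner supertiles: on an arm two lines have different colours. *)
have cc' : c' <> c.
  case: fe hl axl => hl axl.
    have := axl dE (pow2 n); have := ax dE (pow2 n); cbn [vx vy].
    have -> : i + pow2 n + pow2 n * 1 = i + 2 * pow2 n by lia.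
    have -> : j + pow2 n + pow2 n * 0 = j + pow2 n by lia.
    have hx : - pow2 n < i + 2 * pow2 n - (i + 2 * pow2 n) < pow2 n by lia.
    have [_] := borderN s10 hx; rewrite Z.sub_diag Z.eqb_refl; cbn [cross_line hside].
    have <- := line_step (i + 2 * pow2 n) (j + pow2 n - 1) dN v.
    cbn [vx vy opp_side]; rewrite Z.add_0_r.
    have -> : j + pow2 n - 1 + 1 = j + pow2 n by lia.
    move=> lS /(_ ht) o /(_ ht) lE.
    have oN : out (w (i + 2 * pow2 n) (j + pow2 n)) dN = false by rewrite o.
    have [_ th] := in_arm v oN.
    case: (vok v (i + 2 * pow2 n) (j + pow2 n)) => [? ? ? ho|d0 _ ho _ _ _ hc].
      by rewrite ho in oN.
    have ed : d0 = dE by have := o d0; rewrite ho; case: (d0).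
    rewrite ed /= in hc lE.
    by have := hc _ _ _ _ lE; rewrite -(th dN) lS => /(_ _ _ erefl) h e; apply: h.
  have := axl dW (pow2 n); have := ax dW (pow2 n); cbn [vx vy].
  have -> : i + pow2 n + pow2 n * -1 = i by lia.
  have -> : j + pow2 n + pow2 n * 0 = j + pow2 n by lia.
  have hx : - pow2 n < i - i < pow2 n by lia.
  have [_] := borderN s00 hx; rewrite Z.sub_diag Z.eqb_refl; cbn [cross_line hside].
  have <- := line_step i (j + pow2 n - 1) dN v.
  cbn [vx vy opp_side]; rewrite Z.add_0_r.
  have -> : j + pow2 n - 1 + 1 = j + pow2 n by lia.
  move=> lS /(_ ht) o /(_ ht) lW.
  have oN : out (w i (j + pow2 n)) dN = false by rewrite o.
  case: (vok v i (j + pow2 n)) => [? ? ? ho|d0 _ ho _ _ _ hc].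
    by rewrite ho in oN.
  have ed : d0 = dW by have := o d0; rewrite ho; case: (d0).
  rewrite ed /= in hc lW.
  by have := hc _ _ _ _ lW lS => h e; apply: h.
have -> : ~~ c = c' by move: cc'; case: (c); case: (c').
exists fe, fn; split; [|split; [|split; [|split]]] => //.
  by move=> d t ht0; split; [exact: (ax _ _ ht0)|exact: (axl _ _ ht0)].
move=> se sn; have -> : ~~ c' = c by move: cc'; case: (c); case: (c').
case: se; case: sn; cbn [sgnb negb].
- by move: s11; congr supertile; lia.
- by move: s10; congr supertile; lia.
- by move: s01; congr supertile; lia.
- by move: s00; congr supertile; lia.
Qed.

(** The other orientations follow by reflection. *)
Lemma growth_N n w i j fe c : valid w -> covered n w ->
  supertile n w i j fe true c -> exists fe' fn',
  supertile n.+1 w (i + sgnb fe * pow2 n) (j + pow2 n) fe' fn' (~~ c).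
Proof.
move=> v cov; case: fe => st.
  by have := growth_NE v cov st; cbn [sgnb]; rewrite Z.mul_1_l.
have [fe' [fn' s]] := growth_NE (flip_valid v) (flip_covered cov) (supertile_flipV st).
exists (~~ fe'), fn'; have := supertile_flip s; cbn [sgnb].
by congr supertile; lia.
Qed.

Lemma growth n w i j fe fn c : valid w -> covered n w ->
  supertile n w i j fe fn c -> exists fe' fn',
  supertile n.+1 w (i + sgnb fe * pow2 n) (j + sgnb fn * pow2 n) fe' fn' (~~ c).
Proof.
move=> v cov; case: fn => st.
  by have := growth_N v cov st; cbn [sgnb]; rewrite Z.mul_1_l.
have st' := supertile_swapV (supertile_flipV (supertile_swapV st)).
have v' := swap_valid (flip_valid (swap_valid v)).
have cov' := swap_covered (flip_covered (swap_covered cov)).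
have [fe' [fn' /supertile_swap/supertile_flip/supertile_swap s]] :=
  growth_N v' cov' st'.
exists fe', (~~ fn'); move: s; cbn [sgnb].
by congr supertile; lia.
Qed.

Lemma all_covered n w : valid w -> covered n w.
Proof.
move=> v; elim: n => [|n IH] i j b.
  case: (vok v i j) => [fe fn c ho hl|d0]; last by rewrite b.
  by exists i, j, fe, fn, c; rewrite /pow2 /=; split; try lia.
have [a [b' [fe [fn [c [ha hb st]]]]]] := IH _ _ b.
have [fe' [fn' st']] := growth v IH st.
exists (a + sgnb fe * pow2 n), (b' + sgnb fn * pow2 n), fe', fn', (~~ c).
by split=> //; rewrite pow2S; [case: (fe)|case: (fn)]; cbn [sgnb]; lia.
Qed.

Definition has_colour (x : cell) c :=
  exists fe fn, forall d, line x d = cross_line fe fn c d.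

Lemma has_colour_inj x c c' : has_colour x c -> has_colour x c' -> c = c'.
Proof.
move=> [fe [fn h]] [fe' [fn' h']].
have [|_ _ //] := @cross_line_inj fe fn c fe' fn' c'.
by move=> d; rewrite -h h'.
Qed.

Lemma pow2_gt z : exists n, z < pow2 n.
Proof.
exists (Z.to_nat z); have := Z.pow_gt_lin_r 2 (Z.of_nat (Z.to_nat z)).
by rewrite /pow2; lia.
Qed.

(** Take a level [n] whose supertiles are wider than the stretch considered.
    The supertile of the cell [i + h] cannot contain the cell [i], which has
    another colour; so it extends to the east beyond [x], and imposes its
    colour there. *)
Lemma bump_colour_once w i j h x c c' c2 : valid w -> 0 < h -> i + h <= x ->
  bump (w i j) = true -> has_colour (w i j) c ->
  bump (w (i + h) j) = true -> has_colour (w (i + h) j) c' -> c <> c' ->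
  bump (w x j) = true -> has_colour (w x j) c2 -> c2 = c'.
Proof.
move=> v h0 hx b hc b' hc' cc' b2 hc2.
have [n hn] := pow2_gt (x - i).
have [a [a' [fe [fn [e [ha hb st]]]]]] := all_covered n v b'.
have col y : - pow2 n < y - a < pow2 n -> bump (w y j) = true ->
    has_colour (w y j) (bump_colour n e).
  move=> hy; have := supertile_bump_line v st hy hb.
  have -> : a + (y - a) = y by lia. have -> : a' + (j - a') = j by lia.
  exact.
have e' := has_colour_inj (col _ ha b') hc'.
case: (Z.leb_spec (i - a) (- pow2 n)) => hi; last first.
  by case: cc'; rewrite -e'; apply: has_colour_inj hc (col i _ b); lia.
by rewrite -e'; apply: has_colour_inj hc2 (col x _ b2); lia.
Qed.

End Growth.

(** * The hierarchical tiling and its recoloured blocks *)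

Section Hierarchy.
Local Open Scope Z_scope.

(** The 2-adic integers, as compatible residues [p n] modulo [2 ^ n]. The
    column and the row of a cell in the infinite hierarchy are 2-adic
    integers; adding an integer translates the hierarchy. *)
Definition adic (p : nat -> Z) :=
  forall n, 0 <= p n < pow2 n /\ p n.+1 mod pow2 n = p n.

Definition adic_add (k : Z) (p : nat -> Z) : nat -> Z :=
  fun n => (p n + k) mod pow2 n.

Implicit Types p q : nat -> Z.

Lemma mod_pow2S x n : (x mod pow2 n.+1) mod pow2 n = x mod pow2 n.
Proof.
have m0 := pow2_gt0 n; rewrite pow2S (Z.mul_comm 2) Z.rem_mul_r; try lia.
by rewrite (Z.mul_comm (pow2 n)) Z.mod_add ?Z.mod_mod //; lia.
Qed.

Lemma adic_range p n : adic p -> 0 <= p n < pow2 n.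
Proof. by move=> a; case: (a n). Qed.

Lemma adic_add_adic k p : adic p -> adic (adic_add k p).
Proof.
move=> a n; have m0 := pow2_gt0 n; split; first exact: Z.mod_pos_bound.
rewrite /adic_add mod_pow2S Z.add_mod; last by lia.
by case: (a n) => _ ->; rewrite Z.add_mod_idemp_r //; lia.
Qed.

Lemma adic_addA k l p : adic_add k (adic_add l p) = adic_add (l + k) p.
Proof.
apply/funext => n; have m0 := pow2_gt0 n.
by rewrite /adic_add Z.add_mod_idemp_l; [congr Z.modulo; lia|lia].
Qed.

Lemma adic_add0 p : adic p -> adic_add 0 p = p.
Proof.
move=> a; apply/funext => n.
by rewrite /adic_add Z.add_0_r Z.mod_small //; exact: adic_range.
Qed.

Lemma mod_pow2_le x n k : (x mod pow2 (k + n)%N) mod pow2 n = x mod pow2 n.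
Proof.
elim: k x => [|k IH] x; first by rewrite add0n Z.mod_mod //; have := pow2_gt0 n; lia.
by rewrite addSn -(IH (x mod pow2 (k + n).+1)) mod_pow2S IH.
Qed.

Lemma adic_mod p n k : adic p -> p (k + n)%N mod pow2 n = p n.
Proof.
move=> a; have h := adic_range n a.
elim: k => [|k IH]; first by rewrite add0n Z.mod_small.
by rewrite addSn -(mod_pow2_le _ _ k) (proj2 (a (k + n)%N)).
Qed.

Lemma adic_mod_le p n m : adic p -> (n <= m)%N -> p m mod pow2 n = p n.
Proof. by move=> a nm; rewrite -(subnK nm) adic_mod. Qed.

Lemma pow2_mod_le n m : (n <= m)%N -> pow2 m mod pow2 n = 0.
Proof.
move=> nm; apply/Z.mod_divide; first by have := pow2_gt0 n; lia.
exists (pow2 (m - n)); rewrite /pow2 -Z.pow_add_r; try lia.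
by congr (Z.pow 2 _); rewrite -Nat2Z.inj_add plusE subnK.
Qed.

(** The 2-adic valuation of [p] is [b]. *)
Definition has_val p (b : nat) : bool := p b.+1 =? pow2 b.

Lemma has_valP p b : reflect (p b.+1 = pow2 b) (has_val p b).
Proof. exact: Z.eqb_spec. Qed.

(** The position of [p] in the period [4 * 2 ^ b] of level [b]: crosses of
    level [b] have digits 1 and 3, those of digit 1 facing those of digit 3. *)
Definition digit p (b : nat) : Z := p b.+2 / pow2 b.

Definition adic_pred p := adic_add (-1) p.

Lemma adic_pred_at p n : adic p -> adic_pred p n = if p n =? 0 then pow2 n - 1 else p n - 1.
Proof.
move=> a; have h := adic_range n a; rewrite /adic_pred /adic_add.
case: Z.eqb_spec => [->|e]; last by rewrite Z.mod_small; lia.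
by rewrite -(Z.mod_add _ 1) ?Z.mod_small; lia.
Qed.

Lemma pow2SS n : pow2 n.+2 = 4 * pow2 n.
Proof. by rewrite !pow2S; lia. Qed.

Lemma adic_split p n : adic p -> exists z, 0 <= z < 4 /\ digit p n = z /\
  p n.+2 = z * pow2 n + p n /\ p n.+1 = (z mod 2) * pow2 n + p n.
Proof.
move=> a; have m0 := pow2_gt0 n; have h0 := adic_range n a.
have h2 := adic_range n.+2 a; rewrite pow2SS in h2.
have e1 := adic_mod_le a (leqnSn n.+1); rewrite pow2S in e1.
have e0 : p n.+2 mod pow2 n = p n := adic_mod_le a (leqW (leqnSn n)).
have eq := Z.div_mod (p n.+2) (pow2 n) ltac:(lia).
exists (p n.+2 / pow2 n); split; first by nia.
split=> //; split; first by lia.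
move: eq; rewrite -e1 e0; set z := _ / _ => eq; rewrite eq.
have ez := Z.div_mod z 2 ltac:(lia).
symmetry; apply: (Z.mod_unique _ _ (z / 2)); first by left; have := Z.mod_pos_bound z 2; nia.
by nia.
Qed.

Lemma digit_eq p b a : adic p -> has_val p a -> a = b ->
  (digit p b = 1 \/ digit p b = 3) /\ digit (adic_pred p) b = digit p b - 1.
Proof.
move=> ap /has_valP ea ab; subst a; have m0 := pow2_gt0 b.
have [z [hz [e0 [e2 e1]]]] := adic_split b ap.
rewrite e1 in ea; have h0 := adic_range b ap.
have z1 : z mod 2 = 1 by have := Z.mod_pos_bound z 2; nia.
have p0 : p b = 0 by rewrite z1 in ea; lia.
rewrite e0 /digit adic_pred_at // e2 p0.
have [->|->] : z = 1 \/ z = 3 by liam.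
- case: Z.eqb_spec => ?; first by lia.
  split; first by left.
  by symmetry; apply: (Z.div_unique _ _ _ (pow2 b - 1)); lia.
- case: Z.eqb_spec => ?; first by lia.
  split; first by right.
  by symmetry; apply: (Z.div_unique _ _ _ (pow2 b - 1)); lia.
Qed.

(** Here and in [digit_gt]: how the digit of the other coordinate changes
    between two adjacent cells, when its valuation [a] is smaller, resp.
    greater, than the level [b]. The change determines the edges of the arms. *)
Lemma digit_lt p b a : adic p -> has_val p a -> (a < b)%N ->
  digit (adic_pred p) b = digit p b.
Proof.
move=> ap /has_valP ea ab; have m0 := pow2_gt0 b.
have [z [hz [e0 [e2 e1]]]] := adic_split b ap.
have h0 := adic_range b ap.
have p0 : p b <> 0.
  move=> e; have := adic_mod_le ap ab; rewrite e Z.mod_0_l ?ea; last first.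
    by have := pow2_gt0 a.+1; lia.
  by have := pow2_gt0 a; lia.
rewrite e0 /digit adic_pred_at // e2.
case: Z.eqb_spec => ?; first by nia.
by symmetry; apply: (Z.div_unique _ _ _ (p b - 1)); lia.
Qed.

Lemma digit_gt p b a : adic p -> has_val p a -> (b < a)%N ->
  (digit p b = 0 /\ digit (adic_pred p) b = 3 /\ a <> b.+1) \/
  (digit p b = 2 /\ digit (adic_pred p) b = 1 /\ a = b.+1).
Proof.
move=> ap /has_valP ea ab; have m0 := pow2_gt0 b.
have [z [hz [e0 [e2 e1]]]] := adic_split b ap.
have h0 := adic_range b ap.
have e b' : (b' <= a)%N -> p b' = 0.
  by move=> h; rewrite -(adic_mod_le ap (leqW h)) ea pow2_mod_le.
have p0 : p b = 0 by apply: e; apply: ltnW.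
have z1 : z mod 2 = 0 by have := e b.+1 ab; rewrite e1 p0; nia.
have [z2|z2] : z = 0 \/ z = 2 by liam.
  left; rewrite e0 z2; split=> //; split.
    rewrite /digit adic_pred_at // e2 p0 z2 Z.mul_0_l Z.add_0_l Z.eqb_refl pow2SS.
    by symmetry; apply: (Z.div_unique _ _ _ (pow2 b - 1)); lia.
  by move=> ab1; subst a; rewrite e2 p0 z2 pow2S in ea; lia.
right; rewrite e0 z2; split=> //; split.
  rewrite /digit adic_pred_at // e2 p0 z2.
  case: Z.eqb_spec => ?; first by lia.
  by symmetry; apply: (Z.div_unique _ _ _ (pow2 b - 1)); lia.
apply/eqP; rewrite eqn_leq ab andbT leqNgt; apply/negP => h.
by have := e _ h; rewrite e2 p0 z2; lia.
Qed.

(** The direction of an arm of level [b.+1] agrees with the half of the period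
    of level [b] it lies in; this ties the shift of a line to the arms it
    crosses. *)
Lemma digitS_odd p b : adic p -> Z.odd (digit p b.+1) = (2 <=? digit p b).
Proof.
move=> ap; have m0 := pow2_gt0 b.
have [z [hz [-> [e2 e1]]]] := adic_split b ap.
have [z' [hz' [-> [e2' e1']]]] := adic_split b.+1 ap.
have h0 := adic_range b ap.
rewrite pow2S in e1'; rewrite Zodd_mod.
have [t [ht1 [ht2 ht3]]] : exists t, z mod 2 = t /\ z' mod 2 = z' mod 2 /\ 0 <= t < 2.
  by exists (z mod 2); liam.
have [s [hs1 hs2]] : exists s, z' mod 2 = s /\ 0 <= s < 2.
  by exists (z' mod 2); liam.
rewrite hs1 ht1 in e1' e1 *; rewrite e2 e1 in e1'.
have ezs : z = 2 * s + t by nia.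
by case: Z.eqb_spec; case: Z.leb_spec => //; lia.
Qed.

Lemma has_val_inj p a b : adic p -> has_val p a -> has_val p b -> a = b.
Proof.
move=> ap; wlog ab : a b / (a <= b)%N => [H|].
  by case: (leqP a b) => [|/ltnW] h ha hb; [|symmetry]; apply: H.
move: ab; rewrite leq_eqVlt => /orP[/eqP//|ab] /has_valP ea /has_valP eb.
have := adic_mod_le ap (leqW ab); rewrite eb pow2_mod_le // ea.
by have := pow2_gt0 a; lia.
Qed.

(** The interval from a cross of digit 1 to the next one of digit 3, where a
    line runs; it stops at digit 2 because it is read on the east or north
    edge of a cell. *)
Definition lined (z : Z) : bool := (z =? 1) || (z =? 2).

Definition xor_colour (f : bool) (x : cell) : cell :=
  Cell (out x) (fun d => omap (fun l => (l.1 (+) f, l.2)) (line x d)) (bump x).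

(** The colour of a line is the parity of its level; it is shifted towards the
    centre of the enclosing square. *)
Definition hline p q (b : nat) : option (bool * side) :=
  if lined (digit p b) then Some (odd b, vside (digit q b =? 1)) else None.
Definition vline p q (a : nat) : option (bool * side) :=
  if lined (digit q a) then Some (odd a, hside (digit p a =? 1)) else None.

(** The cell of the hierarchical tiling in the column [p] of valuation [a] and
    the row [q] of valuation [b]: a cross if [a = b], and otherwise an arm of
    the higher level. The west and south edges are the east and north edges of
    the preceding cells, so that edges match by construction. *)
Definition base_cell (a b : nat) p q : cell :=
  Cell (fun d => match d with
        | dE => Z.odd (digit p b) | dW => ~~ Z.odd (digit (adic_pred p) b)
        | dN => Z.odd (digit q a) | dS => ~~ Z.odd (digit (adic_pred q) a) end)
       (fun d => match d with
        | dE => hline p q b | dW => hline (adic_pred p) q b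
        | dN => vline p q a | dS => vline p (adic_pred q) a end)
       ((a == 0%N) && (b == 0%N)).

Lemma base_cell_swap a b p q : base_cell a b p q = swap_cell (base_cell b a q p).
Proof.
rewrite /swap_cell /base_cell /=; congr Cell; last by rewrite andbC.
  by apply/funext => -[].
apply/funext => -[] /=; rewrite /hline /vline.
- by case: lined => //=; case: (_ =? 1).
- by case: lined => //=; case: (_ =? 1).
- by case: lined => //=; case: (_ =? 1).
- by case: lined => //=; case: (_ =? 1).
Qed.

(** The perpendicular line has level [a], and it reaches this cell only if
    [b = a.+1]; the parities of two consecutive levels differ, which is the
    colour condition. *)
Lemma base_arm_ok a b p q : adic p -> adic q -> has_val p a -> has_val q b ->
  (a < b)%N -> cell_ok (base_cell a b p q).
Proof.
move=> ap aq va vb ab; have hd := digit_lt ap va ab.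
have hq := digit_gt aq vb ab; have eS := digitS_odd a ap.
have [za _] := digit_eq ap va erefl.
have hl : hline (adic_pred p) q b = hline p q b by rewrite /hline hd.
have vl : vline p (adic_pred q) a = vline p q a.
  by rewrite /vline; case: hq => [[-> [-> _]]|[-> [-> _]]].
have b0 : (b == 0%N) = false by case: (b) ab.
rewrite /base_cell b0 andbF hl vl hd.
have perp c s : vline p q a = Some (c, s) ->
    c = odd a /\ b = a.+1 /\ s = hside (~~ Z.odd (digit p b)).
  rewrite /vline; case: hq => [[-> [_ _]]//|[-> [_ eb]] /= [<- <-]].
  by rewrite eb eS; split=> //; split=> //; case: za => ->.
have par c s : hline p q b = Some (c, s) ->
    c = odd b /\ (s = dN \/ s = dS).
  by rewrite /hline; case: lined => //= -[<- <-]; case: (_ =? 1); auto.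
apply: (@ArmOk _ (hside (Z.odd (digit p b)))) => //=.
- by case=> /=; case: hq => [[h1 [h2 _]]|[h1 [h2 _]]]; rewrite ?h1 ?h2 //=;
    case: Z.odd.
- by case.
- move=> c s h; have {h} : vline p q a = Some (c, s) by move: h; case: Z.odd.
  by case/perp => _ [_ ->]; case: Z.odd.
- move=> c s h; have {h} : hline p q b = Some (c, s) by move: h; case: Z.odd.
  by case/par => _ [] ->; case: Z.odd; auto.
move=> c s c' s' h h'.
have {h} : hline p q b = Some (c, s) by move: h; case: Z.odd.
have {h'} : vline p q a = Some (c', s') by move: h'; case: Z.odd.
by case/perp => -> [e _] /par[-> _]; rewrite e /=; case: odd.
Qed.

Lemma base_cell_ok a b p q : adic p -> adic q -> has_val p a -> has_val q b ->
  cell_ok (base_cell a b p q).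
Proof.
move=> ap aq va vb; case: (ltngtP a b) => ab.
- exact: base_arm_ok.
- by rewrite base_cell_swap; apply: swap_cell_ok; exact: base_arm_ok.
subst b; have [zp dp] := digit_eq ap va erefl; have [zq dq] := digit_eq aq vb erefl.
apply: (@CrossOk _ (digit p a =? 1) (digit q a =? 1) (odd a)) => -[] /=;
  rewrite /hline /vline ?dp ?dq; case: zp => zp; case: zq => zq;
  by rewrite ?zp ?zq.
Qed.

Lemma xor_colour_ok f x : cell_ok x -> cell_ok (xor_colour f x).
Proof.
have inv (o : option (bool * side)) c s :
    omap (fun l => (l.1 (+) f, l.2)) o = Some (c, s) -> o = Some (c (+) f, s).
  by case: o => //= -[c' s'] [<- <-]; rewrite addbK.
case=> [fe fn c ho hl|d0 hb ho hop hp hs hc].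
  apply: (@CrossOk _ fe fn (c (+) f)) => d /=; rewrite ?ho ?hl //.
  by case: d; case: fe {hl}; case: fn.
apply: (@ArmOk _ d0) => //=.
- by move=> d; rewrite hop.
- by move=> c s /inv; exact: hp.
- by move=> c s /inv; exact: hs.
move=> c s c' s' /inv h /inv /(hc _ _ _ _ h).
by move=> hcc ecc; apply: hcc; rewrite ecc.
Qed.

Section Flip.

(** Blocks have side [pow2 n.+2], four times [pow2 n]; the column and row of
    residue 0 separate them, and the centre has residue [2 * pow2 n]. *)
Variable n : nat.
Let N := n.+2.

(** Obscured cells are sought beyond distance [pow2 n] of the centre, where
    the arm is crossed by a line of level [n]: up to there its colour has to
    change together with that of the block. Positions are relative to the
    current cell, which lies at [0]. *)
Definition far_arm p q (noise : Z -> Z -> bool) d (t : Z) :=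
  exists s, pow2 n < s < t /\
    noise (2 * pow2 n - p N + s * vx d) (2 * pow2 n - q N + s * vy d).

Definition good_block p q noise := forall d, far_arm p q noise d (2 * pow2 n).

(** The current cell is on an arm of the block, strictly further from the
    centre than some obscured cell of the arm. *)
Definition beyond_noise p q noise := exists d t,
  [/\ 2 * pow2 n - p N + t * vx d = 0, 2 * pow2 n - q N + t * vy d = 0 &
      far_arm p q noise d t].

(** Whether the colours of the current cell are exchanged; [side_ok] selects
    one column of blocks out of two. *)
Definition flipped (side_ok : bool) p q noise : bool :=
  `[< [/\ side_ok, p N <> 0 /\ q N <> 0, good_block p q noise &
          ~ beyond_noise p q noise] >].

Definition shift_noise (k l : Z) (noise : Z -> Z -> bool) : Z -> Z -> bool :=
  fun i j => noise (k + i) (l + j).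

Lemma adic_succ p m : adic p ->
  adic_add 1 p m = if p m =? pow2 m - 1 then 0 else p m + 1.
Proof.
move=> a; have h := adic_range m a; rewrite /adic_add.
case: Z.eqb_spec => [->|e]; last by rewrite Z.mod_small; lia.
have -> : pow2 m - 1 + 1 = pow2 m by lia.
by rewrite Z.mod_same; lia.
Qed.

(** Along an arm the exchange stops exactly at the first obscured cell of its
    outer half, hence before leaving the block. *)
Lemma flipped_axis_step (L L' : bool) p q noise : adic p -> adic q ->
  q N = 2 * pow2 n -> (p N <> pow2 N - 1 -> L = L') ->
  flipped L p q noise != flipped L' (adic_add 1 p) q (shift_noise 1 0 noise) ->
  noise 0 0 \/ noise 1 0.
Proof.
move=> ap aq hq LL'; have m0 := pow2_gt0 n; have e4 : pow2 N = 4 * pow2 n := pow2SS n.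
have hp := adic_range N ap.
have e' := adic_succ N ap.
rewrite /flipped; set A := [/\ _, _, _ & _]; set B := [/\ _, _, _ & _].
case: (asboolP A) => hA; case: (asboolP B) => hB // _.
- left; case: hA => l [p0 q0] g nb.
  move: e'; case: Z.eqb_spec => [pM|pM] e'.
    have [s [hs ns]] := g dE.
    case: (Z.eq_dec s (2 * pow2 n - 1)) => es.
      move: ns; rewrite es hq pM; cbn [vx vy].
      by congr (is_true (noise _ _)); lia.
    case: nb; exists dE, (2 * pow2 n - 1); split; cbn [vx vy]; try lia.
    by exists s; split=> //; lia.
  have g' : good_block (adic_add 1 p) q (shift_noise 1 0 noise).
    move=> d; have [s [hs ns]] := g d; exists s; split=> //.
    by move: ns; rewrite /shift_noise e'; congr (is_true (noise _ _)); lia.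
  have [d [t [h1 h2 [s [hs ns]]]]] : beyond_noise (adic_add 1 p) q (shift_noise 1 0 noise).
    apply: contrapT => nb'; apply: hB; split=> //; first by rewrite -LL'.
    by split=> //; lia.
  rewrite /shift_noise e' in ns; rewrite e' in h1.
  case: d h1 h2 ns; cbn [vx vy] => h1 h2 ns; try lia.
  - case: (Z.eq_dec s (t - 1)) => es.
      by move: ns; congr (is_true (noise _ _)); lia.
    case: nb; exists dE, (t - 1); split; cbn [vx vy]; try lia.
    exists s; split; first lia.
    by move: ns; congr (is_true (noise _ _)); cbn [vx vy]; lia.
  - case: nb; exists dW, (t + 1); split; cbn [vx vy]; try lia.
    exists s; split; first lia.
    by move: ns; congr (is_true (noise _ _)); cbn [vx vy]; lia.
- right; case: hB => l [p0 q0] g nb.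
  move: e'; case: Z.eqb_spec => [pM|pM] e'; first by [].
  case: (Z.eq_dec (p N) 0) => pz.
    have [s [hs ns]] := g dW; rewrite /shift_noise e' in ns.
    case: (Z.eq_dec s (2 * pow2 n - 1)) => es.
      move: ns; rewrite es hq pz; cbn [vx vy].
      by congr (is_true (noise _ _)); lia.
    case: nb; exists dW, (2 * pow2 n - 1); rewrite e'; split; cbn [vx vy]; try lia.
    exists s; split; first lia.
    by move: ns; rewrite /shift_noise e'; congr (is_true (noise _ _)); cbn [vx vy]; lia.
  have g' : good_block p q noise.
    move=> d; have [s [hs ns]] := g d; exists s; split=> //.
    by move: ns; rewrite /shift_noise e'; congr (is_true (noise _ _)); lia.
  have [d [t [h1 h2 [s [hs ns]]]]] : beyond_noise p q noise.
    apply: contrapT => nb'; apply: hA; split=> //; first by rewrite LL'.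
  case: d h1 h2 ns; cbn [vx vy] => h1 h2 ns; try lia.
  - case: nb; exists dE, (t + 1); rewrite e'; split; cbn [vx vy]; try lia.
    exists s; split; first lia.
    by move: ns; rewrite /shift_noise e'; congr (is_true (noise _ _)); cbn [vx vy]; lia.
  - case: (Z.eq_dec s (t - 1)) => es.
      by move: ns; congr (is_true (noise _ _)); lia.
    case: nb; exists dW, (t - 1); rewrite e'; split; cbn [vx vy]; try lia.
    exists s; split; first lia.
    by move: ns; rewrite /shift_noise e'; congr (is_true (noise _ _)); cbn [vx vy]; lia.
Qed.

Lemma last_digit m b : (b.+2 <= m)%N -> (pow2 m - 1) mod pow2 b.+2 / pow2 b = 3.
Proof.
move=> bm; have m0 := pow2_gt0 b; have e4 := pow2SS b.
have e := Z.div_mod (pow2 m) (pow2 b.+2) ltac:(lia).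
rewrite pow2_mod_le // in e.
rewrite -(Z.mod_unique (pow2 m - 1) _ (pow2 m / pow2 b.+2 - 1) (pow2 b.+2 - 1)).
- by symmetry; apply: (Z.div_unique _ _ _ (pow2 b - 1)); lia.
- by left; lia.
- by lia.
Qed.

Lemma digit_low p b : adic p -> (b.+2 <= N)%N ->
  digit p b = (p N mod pow2 b.+2) / pow2 b.
Proof. by move=> ap h; rewrite adic_mod_le. Qed.

(** Outside of the axes of the block a line belongs to a level whose lines
    stay within one block, at places where no arm is cut, so the exchange is
    constant along it. *)
Lemma flipped_off_axis_step (L L' : bool) p q b noise : adic p -> adic q ->
  has_val q b -> q N <> 2 * pow2 n -> (p N <> pow2 N - 1 -> L = L') ->
  lined (digit p b) ->
  flipped L p q noise = flipped L' (adic_add 1 p) q (shift_noise 1 0 noise).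
Proof.
move=> ap aq vb hq LL' lb; have m0 := pow2_gt0 n.
have e4 : pow2 N = 4 * pow2 n := pow2SS n.
have hp := adic_range N ap; have hq' := adic_range N aq.
have e' := adic_succ N ap.
case: (Z.eq_dec (q N) 0) => q0.
  by rewrite /flipped; congr asbool; apply: propext; split=> -[_ []].
have bN : (b < n.+1)%N.
  rewrite ltnNge; apply/negP; move/has_valP: vb => vb.
  rewrite leq_eqVlt => /orP[/eqP eb|h].
    by rewrite -eb in vb; case: hq; rewrite /N vb pow2S.
  case: q0; rewrite -(adic_mod_le aq (n := N) (m := b.+1)) ?vb ?pow2_mod_le //.
  exact: leqW.
have dl := digit_low ap bN; have mb := pow2_gt0 b; have eb2 := pow2SS b.
have pM : p N <> pow2 N - 1.
  by move=> e; move: lb; rewrite dl e last_digit.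
have p0 : p N <> 0.
  move=> e; move: lb; rewrite dl e Z.mod_0_l; last lia.
  by rewrite Z.div_0_l //; lia.
move: e'; case: Z.eqb_spec => // _ e'.
have far d t : 2 * pow2 n - q N + t * vy d = 0 -> pow2 n < t ->
    p N = 2 * pow2 n \/ p N = 2 * pow2 n - 1 -> False.
  move=> ht tn hpc; have hn : (b <= n)%N by [].
  move: (lb) hn; rewrite leq_eqVlt => _ /orP[/eqP eb|hb].
    subst b; have [z [hz [_ [e2 e1]]]] := adic_split n aq.
    have hz2 : z = 0 \/ z = 1 \/ z = 2 \/ z = 3 by lia.
    have hqn := adic_range n aq; move/has_valP: vb => vb; rewrite vb in e1.
    change (q N = z * pow2 n + q n) in e2.
    case: d ht; cbn [vy] => ht; move: hz2 => [ez|[ez|[ez|ez]]]; subst z;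
      change (0 mod 2) with 0 in e1; change (1 mod 2) with 1 in e1;
      change (2 mod 2) with 0 in e1; change (3 mod 2) with 1 in e1; lia.
  have hb1 : (b.+2 <= n.+1)%N by [].
  have z := pow2_mod_le hb1; rewrite pow2S in z.
  move: lb; rewrite dl; case: hpc => ->.
    by rewrite z Z.div_0_l //; lia.
  by rewrite -pow2S last_digit.
have cut1 : ~ beyond_noise p q noise.
  move=> [d [t [h1 h2 [s [hs ns]]]]].
  by apply: (far d t h2); [lia|left; case: d h1 h2 {ns}; cbn [vx vy]; lia].
have cut2 : ~ beyond_noise (adic_add 1 p) q (shift_noise 1 0 noise).
  move=> [d [t [h1 h2 [s [hs ns]]]]]; rewrite e' in h1.
  by apply: (far d t h2); [lia|right; case: d h1 h2 {ns}; cbn [vx vy]; lia].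
have g : good_block p q noise <->
    good_block (adic_add 1 p) q (shift_noise 1 0 noise).
  rewrite /good_block /far_arm e'.
  by split=> gd d; have [s [hs ns]] := gd d; exists s; split=> //; move: ns;
     rewrite /shift_noise; congr (is_true (noise _ _)); lia.
rewrite /flipped; congr asbool; apply: propext; rewrite LL' // e'.
by split=> -[l1 [l2 l3] /g l4 l5]; split=> //; split=> //; lia.
Qed.

Lemma flipped_step (L L' : bool) p q b noise : adic p -> adic q ->
  has_val q b -> (p N <> pow2 N - 1 -> L = L') -> lined (digit p b) ->
  flipped L p q noise != flipped L' (adic_add 1 p) q (shift_noise 1 0 noise) ->
  q N = 2 * pow2 n /\ (noise 0 0 \/ noise 1 0).
Proof.
move=> ap aq vb LL' lb; case: (Z.eq_dec (q N) (2 * pow2 n)) => e h.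
  by split=> //; exact: flipped_axis_step LL' h.
by move: h; rewrite (flipped_off_axis_step noise ap aq vb e LL' lb) eqxx.
Qed.

Lemma flipped_swap L p q noise :
  flipped L p q noise = flipped L q p (fun i j => noise j i).
Proof.
have far pp qq ns d t : far_arm pp qq ns d t ->
    far_arm qq pp (fun i j => ns j i) (swap_side d) t.
  move=> [s [hs h]]; exists s; split=> //; move: h.
  by case: d.
have goodi pp qq ns : good_block pp qq ns -> good_block qq pp (fun i j => ns j i).
  by move=> g d; have := far _ _ _ _ _ (g (swap_side d)); rewrite swap_sideK.
have beyondi pp qq ns : beyond_noise pp qq ns -> beyond_noise qq pp (fun i j => ns j i).
  move=> [d [t [h1 h2 /far h3]]]; exists (swap_side d), t; split=> //.
    by case: d h2 {h1 h3}.
  by case: d h1 {h2 h3}.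
rewrite /flipped; congr asbool; apply: propext.
split=> -[l [l1 l2] /goodi l3 l4]; split=> //.
- by move=> /beyondi.
- by move=> /beyondi.
Qed.

Definition has_valuation p := exists b, has_val p b.

(** The value [0%N] for the 2-adic integer 0 is arbitrary; this event has
    probability 0. *)
Definition valuation p : nat :=
  if pselect (has_valuation p) is left h then ex_minn h else 0%N.

Lemma valuationP p : has_valuation p -> has_val p (valuation p).
Proof.
by rewrite /valuation; case: pselect => // h _; case: ex_minnP.
Qed.

Lemma valuation_eq p b : adic p -> has_val p b -> valuation p = b.
Proof. by move=> ap vb; apply: (has_val_inj ap _ vb); apply: valuationP; exists b. Qed.

Definition left_block p : bool := Z.even (digit p N).

Definition tiling_cell p q noise : cell :=
  xor_colour (flipped (left_block p) p q noise)
    (base_cell (valuation p) (valuation q) p q).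

Lemma tiling_cell_ok p q noise : adic p -> adic q ->
  has_valuation p -> has_valuation q -> cell_ok (tiling_cell p q noise).
Proof.
by move=> ap aq vp vq; apply/xor_colour_ok/base_cell_ok => //; exact: valuationP.
Qed.

Lemma adic_pred_succ p : adic p -> adic_pred (adic_add 1 p) = p.
Proof. by move=> a; rewrite /adic_pred adic_addA; exact: adic_add0. Qed.

(** Recolouring leaves arrows alone. *)
Lemma tiling_out_east p q noise noise' : adic p ->
  out (tiling_cell (adic_add 1 p) q noise') dW = ~~ out (tiling_cell p q noise) dE.
Proof. by move=> ap; rewrite /= adic_pred_succ. Qed.

Lemma tiling_out_north p q noise noise' : adic q ->
  out (tiling_cell p (adic_add 1 q) noise') dS = ~~ out (tiling_cell p q noise) dN.
Proof. by move=> ap; rewrite /= adic_pred_succ. Qed.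

Lemma left_block_step p : adic p -> p N <> pow2 N - 1 ->
  left_block p = left_block (adic_add 1 p).
Proof.
move=> ap h; have ap' := adic_add_adic 1 ap.
have [z [hz [e0 [e2 e1]]]] := adic_split N ap.
have [z' [hz' [e0' [e2' e1']]]] := adic_split N ap'.
rewrite /left_block e0 e0'; congr Z.even.
move: e2'; rewrite !adic_succ // e2 pow2SS.
have hp := adic_range N ap; have m0 := pow2_gt0 N.
by case: Z.eqb_spec => ?; case: Z.eqb_spec => ?; nia.
Qed.

(** The edge rules can fail only next to an obscured cell, on the axis of a
    block. *)
Lemma tiling_line_east p q noise : adic p -> adic q -> has_valuation q ->
  line (tiling_cell (adic_add 1 p) q (shift_noise 1 0 noise)) dW =
    line (tiling_cell p q noise) dE \/
  q N = 2 * pow2 n /\ (noise 0 0 \/ noise 1 0).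
Proof.
move=> ap aq vq; rewrite /= adic_pred_succ // /hline.
case lb : (lined _) => /=; last by left.
have [->|h] := eqVneq (flipped (left_block p) p q noise)
  (flipped (left_block (adic_add 1 p)) (adic_add 1 p) q (shift_noise 1 0 noise)).
  by left.
right; apply: (flipped_step ap aq (valuationP vq) _ lb h).
exact: left_block_step.
Qed.

Lemma tiling_line_north p q noise : adic p -> adic q -> has_valuation p ->
  line (tiling_cell p (adic_add 1 q) (shift_noise 0 1 noise)) dS =
    line (tiling_cell p q noise) dN \/
  p N = 2 * pow2 n /\ (noise 0 0 \/ noise 0 1).
Proof.
move=> ap aq vp; rewrite /= adic_pred_succ // /vline.
case lb : (lined _) => /=; last by left.
have [->|h] := eqVneq (flipped (left_block p) p q noise)
  (flipped (left_block p) p (adic_add 1 q) (shift_noise 0 1 noise)).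
  by left.
right; rewrite flipped_swap (flipped_swap _ p) in h.
by have := flipped_step (noise := fun i j => noise j i) aq ap (valuationP vp)
  (fun _ => erefl) lb h.
Qed.

Lemma adic1 p : adic p -> p 1%N = 0 \/ p 1%N = 1.
Proof. by move=> ap; have := adic_range 1 ap; rewrite /pow2 /=; lia. Qed.

Lemma tiling_bump p q noise : adic p -> adic q -> has_valuation p -> has_valuation q ->
  bump (tiling_cell p q noise) = (p 1%N =? 1) && (q 1%N =? 1).
Proof.
move=> ap aq vp vq /=.
suff aux r : adic r -> has_valuation r -> (valuation r == 0%N) = (r 1%N =? 1).
  by rewrite !aux.
move=> ar vr; have v0 : has_val r 0 = (r 1%N =? 1) by [].
rewrite -v0; apply/eqP/idP => [<-|h]; first exact: valuationP.
exact: valuation_eq.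
Qed.

(** Bumpy cells lie in odd rows and columns, hence neither on the axes nor on
    the boundary of a block. *)
Lemma adic_odd_low p : adic p -> p 1%N = 1 -> p N <> 0 /\ p N <> 2 * pow2 n.
Proof.
move=> ap p1; have := adic_mod_le ap (n := 1) (m := N) isT.
rewrite p1 => h; split=> e; move: h; rewrite e // /pow2 -/(pow2 n).
by change (2 ^ Z.of_nat 1) with 2; rewrite Z.mul_comm Z.mod_mul.
Qed.

(** Level 0 lines have the even colour [false], which is exchanged exactly in
    the good blocks on the chosen side. *)
Lemma tiling_bump_colour p q noise : adic p -> adic q ->
  has_valuation p -> has_valuation q -> p 1%N = 1 -> q 1%N = 1 ->
  good_block p q noise ->
  has_colour (tiling_cell p q noise) (left_block p).
Proof.
move=> ap aq vp vq p1 q1 g.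
have [p0 ph] := adic_odd_low ap p1; have [q0 qh] := adic_odd_low aq q1.
have -> : tiling_cell p q noise = xor_colour (left_block p) (base_cell 0 0 p q).
  rewrite /tiling_cell (valuation_eq ap (b := 0%N)) ?(valuation_eq aq (b := 0%N)) //.
  - congr xor_colour; apply/asboolP/idP => [[]//|l]; split=> //.
    by move=> [d [t [h1 h2 _]]]; case: d h1 h2; cbn [vx vy]; lia.
  - by apply/has_valP; rewrite q1.
  - by apply/has_valP; rewrite p1.
have v0p : has_val p 0 by apply/has_valP; rewrite p1.
have v0q : has_val q 0 by apply/has_valP; rewrite q1.
have [zp dp] := digit_eq ap v0p erefl; have [zq dq] := digit_eq aq v0q erefl.
exists (digit p 0 =? 1), (digit q 0 =? 1) => -[] /=;
  rewrite /hline /vline ?dp ?dq; case: zp => zp; case: zq => zq;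
  by rewrite ?zp ?zq.
Qed.

Lemma left_block_period p : adic p ->
  left_block (adic_add (pow2 N) p) = ~~ left_block p.
Proof.
move=> ap; have ap' := adic_add_adic (pow2 N) ap.
have [z [hz [e0 [e2 e1]]]] := adic_split N ap.
have [z' [hz' [e0' [e2' e1']]]] := adic_split N ap'.
rewrite /left_block e0 e0'.
have hp := adic_range N ap; have m0 := pow2_gt0 N.
have eN : adic_add (pow2 N) p N = p N.
  by rewrite /adic_add -{1}(Z.mul_1_l (pow2 N)) Z.mod_add ?Z.mod_small; lia.
move: e2'; rewrite eN /adic_add e2 pow2SS.
have [h|h] : z = 3 \/ z < 3 by lia.
  rewrite h -(Z.mod_unique (_ + _) _ 1 (p N)); [|lia|lia].
  by move=> e; have -> : z' = 0 by nia.
rewrite Z.mod_small; last by nia.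
move=> e; have -> : z' = z + 1 by nia.
by rewrite Z.even_add; case: Z.even.
Qed.

End Flip.
End Hierarchy.

(** * Tiles as cells *)

Definition dir_of_side (d : side) : dir :=
  match d with dE => east | dN => north | dW => west | dS => south end.
Definition side_of_dir (i : dir) : side :=
  match nat_of_ord i with 0%N => dE | 1%N => dN | 2%N => dW | _ => dS end.

Lemma dir_of_sideK : cancel dir_of_side side_of_dir.
Proof. by case. Qed.

Lemma side_of_dirK : cancel side_of_dir dir_of_side.
Proof. by case=> [[|[|[|[|m]]]] hm] //; apply: val_inj. Qed.

Definition raw_cell (u : rawtile) : cell :=
  Cell (fun d => (u.1 (dir_of_side d)).1)
       (fun d => omap (fun l => (bool_of_color l.1, side_of_dir l.2))
                      (u.1 (dir_of_side d)).2) u.2.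

Definition cell_raw (x : cell) : rawtile :=
  ([ffun i => (out x (side_of_dir i),
      omap (fun l => (color_of_bool l.1, dir_of_side l.2))
           (line x (side_of_dir i)))], bump x).

Lemma color_of_boolK : cancel color_of_bool bool_of_color.
Proof. by case. Qed.

Lemma cell_rawK x : raw_cell (cell_raw x) = x.
Proof.
case: x => o l b; rewrite /raw_cell /=; congr Cell.
  by apply/funext => d; rewrite ffunE /= dir_of_sideK.
apply/funext => d; rewrite ffunE /= dir_of_sideK.
by case: (l d) => [[c s]|] //=; rewrite color_of_boolK dir_of_sideK.
Qed.

(** Words in the two reflections [flip] and [swap]; they carry the symmetry
    lemmas on cells to the symmetries of tiles given by [dihedral]. *)
Fixpoint act (w : seq bool) (d : side) : side :=
  if w is b :: w' then (if b then swap_side else flip_side) (act w' d) else d.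
Fixpoint act_cell (w : seq bool) (x : cell) : cell :=
  if w is b :: w' then (if b then swap_cell else flip_cell) (act_cell w' x) else x.

Lemma act_cell_ok w x : cell_ok x -> cell_ok (act_cell w x).
Proof.
by elim: w => //= -[] w IH /IH; [exact: swap_cell_ok|exact: flip_cell_ok].
Qed.

Lemma out_act w x d : out (act_cell w x) (act w d) = out x d.
Proof. by elim: w => //= -[] w /= <-; rewrite ?swap_sideK ?flip_sideK. Qed.

Lemma line_act w x d : line (act_cell w x) (act w d) =
  omap (fun l => (l.1, act w l.2)) (line x d).
Proof.
elim: w => [|[] w /= IH] /=; rewrite ?swap_sideK ?flip_sideK ?IH.
- by case: line => [[]|].
- by case: line => [[]|].
- by case: line => [[]|].
Qed.

Lemma bump_act w x : bump (act_cell w x) = bump x.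
Proof. by elim: w => //= -[]. Qed.

Lemma act_surj w d : exists d', d = act w d'.
Proof.
elim: w d => [|[] w IH] d /=; first by exists d.
- by have [d' e] := IH (swap_side d); exists d'; rewrite -e swap_sideK.
- by have [d' e] := IH (flip_side d); exists d'; rewrite -e flip_sideK.
Qed.

Definition dihedral_word (g : bool * 'Z_4) : seq bool :=
  match g.1, nat_of_ord g.2 with
  | false, 0%N => [::]
  | false, 1%N => [:: false; true]
  | false, 2%N => [:: false; true; false; true]
  | false, _ => [:: true; false]
  | true, 0%N => [:: true; false; true]
  | true, 1%N => [:: true]
  | true, 2%N => [:: false]
  | true, _ => [:: false; true; false]
  end.

Lemma dihedral_act g d :
  side_of_dir (dihedral g (dir_of_side d)) = act (dihedral_word g) d.
Proof.
by case: g => -[] [[|[|[|[|m]]]] hm] //; case: d; vm_compute.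
Qed.

Lemma tile_image_act g t u : tile_image g t u ->
  raw_cell u = act_cell (dihedral_word g) (raw_cell t).
Proof.
move=> /andP[/eqP hb /forallP h].
have e d : u.1 (dir_of_side (act (dihedral_word g) d)) =
    edge_image g (t.1 (dir_of_side d)).
  by rewrite -dihedral_act side_of_dirK; apply/eqP.
have ho : out (raw_cell u) = out (act_cell (dihedral_word g) (raw_cell t)).
  apply/funext => d0; have [d ->] := act_surj (dihedral_word g) d0.
  by rewrite out_act /= e.
have hl : line (raw_cell u) = line (act_cell (dihedral_word g) (raw_cell t)).
  apply/funext => d0; have [d ->] := act_surj (dihedral_word g) d0.
  rewrite line_act /= e /=; case: (t.1 _) => o [[c s]|] //=.
  by rewrite -dihedral_act side_of_dirK.
have hbb : bump (raw_cell u) = bump (act_cell (dihedral_word g) (raw_cell t)).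
  by rewrite bump_act.
case: (raw_cell u) ho hl hbb => o l b.
by case: (act_cell _ _) => o' l' b' /= -> -> ->.
Qed.

Lemma corner_ok c b : cell_ok (raw_cell (corner c b)).
Proof.
apply: (@CrossOk _ true true (bool_of_color c)) => -[] /=; rewrite ffunE //=.
Qed.

Lemma arm_ok v h : (v != h) || (v == None) -> cell_ok (raw_cell (arm v h)).
Proof.
move=> vh; apply: (@ArmOk _ dS) => //=.
- by case; rewrite ffunE.
- by case; rewrite /= !ffunE.
- by move=> c s; rewrite ffunE /=; case: h {vh} => //= a [_ <-].
- by move=> c s; rewrite ffunE /=; case: v {vh} => //= a [_ <-]; right.
move=> c s c' s'; rewrite !ffunE /=.
case: v h vh => [a|] [a'|] //= vh [<- _] [<- _] e.
by move: vh; case: a e; case: a'.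
Qed.

Lemma is_tile_ok u : is_tile u -> cell_ok (raw_cell u).
Proof.
move=> /existsP[g /hasP[t ht /tile_image_act ->]]; apply: act_cell_ok.
move: ht; rewrite !inE => /orP[/eqP->|]; first exact: corner_ok.
do 3! [move=> /orP[/eqP->|]; first exact: corner_ok].
do 6! [move=> /orP[/eqP->|]; first exact: arm_ok].
by move=> /eqP->; exact: arm_ok.
Qed.

(** The symmetry that maps the basic arm to the arm pointing to [d0] with its
    longitudinal line shifted to [s]. *)
Definition arm_symmetry (d0 s : side) : bool * 'Z_4 :=
  let d' := match d0 with
    | dE | dW => swap_side d0 | _ => opp_side (swap_side d0) end in
  if side_eqb s d' then (false, dir_of_side d0 + 1) else (true, dir_of_side d0 + 3).

(** The normal form of an arm with outgoing side [d0]: the longitudinal line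
    [v] is shifted to [s], the perpendicular line [h] away from [d0]. *)
Definition arm_cell d0 s (v h : option bool) : cell :=
  Cell (fun d => side_eqb d d0)
       (fun d => if side_eqb d d0 || side_eqb (opp_side d) d0
                 then omap (fun c => (c, s)) v
                 else omap (fun c => (c, opp_side d0)) h) false.

Lemma ok_is_tile x : cell_ok x -> is_tile (cell_raw x).
Proof.
case=> [fe fn c ho hl|d0 hb ho hop hp hs hc].
  apply/existsP; exists (match fe, fn with
    | true, true => (false, 0) | false, true => (true, 2)
    | true, false => (true, 0) | false, false => (false, 2) end).
  apply/hasP; exists (corner (color_of_bool c) (bump x)).
    by case: c {hl}; case: bump; rewrite !inE eqxx ?orbT.
  rewrite /tile_image eqxx /=; apply/forallP => i; rewrite !ffunE ho hl.
  by case: i => [[|[|[|[|m]]]] hm] //; case: fe {hl}; case: fn; case: c;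
     vm_compute.
have hE := hop dE; have hN := hop dN.
have [h [hh hhl]] : exists h : option bool, 
    line x (swap_side d0) = omap (fun c => (c, opp_side d0)) h /\
    forall c s, line x d0 = Some (c, s) -> h <> Some c.
  case e : (line x (swap_side d0)) => [[c s]|]; last by exists None; split.
  exists (Some c); rewrite (hp _ _ e); split=> // c' s' e' [ecc].
  exact: (hc _ _ _ _ e' e).
have [v [s [hv [hss hvl]]]] : exists (v : option bool) s,
    line x d0 = omap (fun c => (c, s)) v /\
    (s = swap_side d0 \/ s = opp_side (swap_side d0)) /\
    (forall c, v = Some c -> h <> Some c).
  case e : (line x d0) => [[c s]|]; last first.
    by exists None, (swap_side d0); split=> //; split=> //; left.
  exists (Some c), s; split=> //; split; first exact: hs e.
  by move=> c' [<-]; exact: hhl e.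
have -> : x = arm_cell d0 s v h.
  case: x hb ho hop hp hs hc hE hN hh hhl hv => o l b /= -> ho _ _ _ _ hE hN hh _ hv.
  congr Cell; apply/funext => d; first exact: ho.
  by move: hh hv; case: (d0); case: d; rewrite /= ?hE ?hN => hh hv.
apply/existsP; exists (arm_symmetry d0 s).
apply/hasP; exists (arm (omap color_of_bool v) (omap color_of_bool h)).
  have : v = None \/ h != v.
    by case: v hvl {hv} => [c|] hvl; [right; apply/eqP; exact: hvl|left].
  by case: v {hv hvl} => [[]|]; case: h {hh hhl} => [[]|] // -[] // _;
    rewrite !inE eqxx ?orbT.
rewrite /tile_image /=; apply/forallP => i; rewrite !ffunE.
case: i => [[|[|[|[|m]]]] hm] //.
- by case: hss => ->; case: (d0); case: (v) => [[]|]; case: (h) => [[]|]; vm_compute.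
- by case: hss => ->; case: (d0); case: (v) => [[]|]; case: (h) => [[]|]; vm_compute.
- by case: hss => ->; case: (d0); case: (v) => [[]|]; case: (h) => [[]|]; vm_compute.
- by case: hss => ->; case: (d0); case: (v) => [[]|]; case: (h) => [[]|]; vm_compute.
Qed.

Definition tile_cell (t : tile) : cell := raw_cell (val t).
Definition tile_of_cell (x : cell) : tile :=
  insubd (exist is_tile (arm None None) arm_is_tile) (cell_raw x).

Lemma tile_cell_ok t : cell_ok (tile_cell t).
Proof. exact/is_tile_ok/(valP t). Qed.

Lemma tile_of_cellK x : cell_ok x -> tile_cell (tile_of_cell x) = x.
Proof.
move=> /ok_is_tile ok; rewrite /tile_cell /tile_of_cell val_insubd ok.
exact: cell_rawK.
Qed.

Lemma bumpyE t : bumpy t = bump (tile_cell t). Proof. by []. Qed.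

(** * Local rules of the tileset *)

Section Patterns.
Local Open Scope fmap_scope.

Lemma fnd_subpattern d (A : pointedFinType) (I : {fset 'rV[int]_d})
    (x : config d A) k :
  (subpattern I x).[? k] = if k \in I then Some (x k : A) else None.
Proof.
case: (boolP (k \in I)) => kI; last by rewrite not_fnd.
by rewrite (in_fnd (f := subpattern I x) kI) ffunE.
Qed.

Lemma subpatternP d (A : pointedFinType) (w : pattern d A) (x : config d A) :
  subpattern (domf w) x = w <->
  forall k, k \in domf w -> w.[? k] = Some (x k : A).
Proof.
rewrite -fmapP; split=> h k.
  by move=> kw; rewrite -h fnd_subpattern kw.
rewrite fnd_subpattern; case: ifP => kw; first by rewrite h.
by rewrite not_fnd // kw.
Qed.

Lemma fnd_unobscured d (A : pointedFinType) (w : pattern d A) k :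
  (unobscured w).[? k] = omap (fun a => (a, false)) w.[? k].
Proof.
case: (boolP (k \in domf w)) => kI; last by rewrite !not_fnd.
by rewrite (in_fnd (f := unobscured w) kI) ffunE (in_fnd kI).
Qed.

Definition pt (i j : Z) : 'rV[int]_2 :=
  \row_k (if k == 0 then int_of_Z i else int_of_Z j).

Lemma ptD i j k l : pt i j + pt k l = pt (Z.add i k) (Z.add j l).
Proof.
apply/rowP => x; rewrite !mxE; case: ifP => _.
- by symmetry; exact: (raddfD int_of_Z i k).
- by symmetry; exact: (raddfD int_of_Z j l).
Qed.

Lemma pt_east : unit_east = pt (Zpos xH) Z0.
Proof. by apply/rowP => -[[|[|m]] hm] //; rewrite !mxE. Qed.

Lemma pt_north : unit_north = pt Z0 (Zpos xH).
Proof. by apply/rowP => -[[|[|m]] hm] //; rewrite !mxE. Qed.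

Lemma pt00 : 0 = pt Z0 Z0.
Proof. by apply/rowP => k; rewrite !mxE; case: ifP. Qed.

Lemma pt_surj k : exists i j, k = pt i j.
Proof.
exists (Z_of_int (k 0 0)), (Z_of_int (k 0 1)); apply/rowP => x.
rewrite mxE !Z_of_intK; case: ifP => [/eqP->//|/negbT x0].
by congr (k 0 _); case: x x0 => -[|[|m]] hm // _; apply: val_inj.
Qed.

Lemma pt_inj i j k l : pt i j = pt k l -> i = k /\ j = l.
Proof.
move=> /rowP e; have := e 0; have := e 1; rewrite !mxE /=.
by move=> /(can_inj int_of_ZK) -> /(can_inj int_of_ZK) ->.
Qed.

Definition cells (y : config 2 tile) : Z -> Z -> cell :=
  fun i j => tile_cell (y (pt i j)).

Lemma tile_edge (t : tile) (i : dir) : (val t).1 i =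
  (out (tile_cell t) (side_of_dir i),
   omap (fun l => (color_of_bool l.1, dir_of_side l.2))
     (line (tile_cell t) (side_of_dir i))).
Proof.
rewrite /= side_of_dirK; case: ((val t).1 i) => o [[c s]|] //=.
by rewrite bool_of_colorK side_of_dirK.
Qed.

Lemma edge_matchP i a b d d' : d = side_of_dir i -> d' = side_of_dir (i + 2) ->
  edge_match i a b <->
  (out (tile_cell b) d' = ~~ out (tile_cell a) d /\
   line (tile_cell b) d' = line (tile_cell a) d).
Proof.
move=> -> ->; rewrite /edge_match !tile_edge.
move: (out (tile_cell a) _) (out (tile_cell b) _) => oa ob.
move: (line (tile_cell a) _) (line (tile_cell b) _) => la lb /=; split.
  move=> /andP[h1 /eqP h2]; split; first by case: oa h1; case: ob.
  move: h2; case: la lb => [[c s]|] [[c' s']|] //=.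
  by move=> [/(can_inj color_of_boolK) -> /(can_inj dir_of_sideK) ->].
by move=> [-> ->]; rewrite eqxx andbT; case: oa.
Qed.

Definition edge_matchE a b := @edge_matchP east a b dE dW erefl erefl.
Definition edge_matchN a b := @edge_matchP north a b dN dS erefl erefl.

Definition bump_count (y : config 2 tile) (k : 'rV[int]_2) : nat :=
  bumpy (y k) + bumpy (y (k + unit_east)) + bumpy (y (k + unit_north)) +
  bumpy (y (k + (unit_east + unit_north))).

Lemma fnd_domino v (a b : tile) k : (domino v a b).[? k] =
  if k == v then Some b else if k == 0 then Some a else None.
Proof. by rewrite /domino !fnd_set fnd_fmap0. Qed.

Lemma mem_domino v (a b : tile) k : (k \in domf (domino v a b)) =
  (k == v) || (k == 0).
Proof. by rewrite /domino !dom_setf !inE orbF. Qed.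

Lemma fnd_square q k : (square q).[? k] =
  if k == unit_east + unit_north then Some (tnth q 3) else
  if k == unit_north then Some (tnth q 2) else
  if k == unit_east then Some (tnth q 1) else
  if k == 0 then Some (tnth q 0) else None.
Proof. by rewrite /square !fnd_set fnd_fmap0. Qed.

Lemma mem_square q k : (k \in domf (square q)) =
  [|| k == unit_east + unit_north, k == unit_north, k == unit_east | k == 0].
Proof. by rewrite /square !dom_setf !inE orbF. Qed.

Lemma Omega_east y k : Omega RB y -> edge_match east (y k) (y (k + unit_east)).
Proof.
move=> hy; apply/negPn/negP => h.
apply: (hy (domino unit_east (y k) (y (k + unit_east))) k).
  rewrite /RB !inE; apply/orP; left; apply/orP; left.
  by apply/imfsetP; exists (y k, y (k + unit_east)).
apply/subpatternP => l; rewrite mem_domino fnd_domino /config_shift.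
by case: eqP => [->//|_] /= /eqP ->; rewrite eqxx addr0.
Qed.

Lemma Omega_north y k : Omega RB y -> edge_match north (y k) (y (k + unit_north)).
Proof.
move=> hy; apply/negPn/negP => h.
apply: (hy (domino unit_north (y k) (y (k + unit_north))) k).
  rewrite /RB !inE; apply/orP; left; apply/orP; right.
  by apply/imfsetP; exists (y k, y (k + unit_north)).
apply/subpatternP => l; rewrite mem_domino fnd_domino /config_shift.
by case: eqP => [->//|_] /= /eqP ->; rewrite eqxx addr0.
Qed.

Lemma Omega_bump_count y k : Omega RB y -> bump_count y k = 1%N.
Proof.
move=> hy; apply/eqP/negPn/negP => h.
pose q := [tuple y k : tile; y (k + unit_east) : tile; y (k + unit_north) : tile;
                 y (k + (unit_east + unit_north)) : tile].
apply: (hy (square q) k).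
  rewrite /RB !inE; apply/orP; right.
  by apply/imfsetP; exists q => //; rewrite !inE /= addn0 !addnA.
apply/subpatternP => l; rewrite mem_square fnd_square /config_shift.
case: eqP => [->//|_]; case: eqP => [->//|_]; case: eqP => [->//|_] /= /eqP ->.
by rewrite eqxx addr0.
Qed.

Lemma bump_count_pt y i j : bump_count y (pt i j) =
  (bump (cells y i j) + bump (cells y (Z.add i (Zpos xH)) j) +
   bump (cells y i (Z.add j (Zpos xH))) +
   bump (cells y (Z.add i (Zpos xH)) (Z.add j (Zpos xH))))%N.
Proof. by rewrite /bump_count pt_east pt_north !ptD !Z.add_0_r Z.add_0_l. Qed.

(** From here on, clean tilings are studied as valid arrays of cells. *)
Lemma Omega_valid y : Omega RB y -> valid (cells y).
Proof.
move=> hy; have hE i j := Omega_east (pt i j) hy; have hN i j := Omega_north (pt i j) hy.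
have hb i j := Omega_bump_count (pt i j) hy.
have bc := bump_count_pt y.
have step i j : cells y (Z.add i (Zpos xH)) j = tile_cell (y (pt i j + unit_east)).
  by rewrite pt_east ptD Z.add_0_r.
have stepN i j : cells y i (Z.add j (Zpos xH)) = tile_cell (y (pt i j + unit_north)).
  by rewrite pt_north ptD Z.add_0_r.
split=> i j.
- exact: tile_cell_ok.
- by rewrite step; case/edge_matchE: (hE i j).
- by rewrite step; case/edge_matchE: (hE i j).
- by rewrite stepN; case/edge_matchN: (hN i j).
- by rewrite stepN; case/edge_matchN: (hN i j).
- have := hb i j; rewrite bc; do 4 case: (bump _); by auto.
move=> i' j' hi hj b b'.
have : (i' = Z.sub i (Zpos xH) \/ i' = i \/ i' = Z.add i (Zpos xH)) by lia.
have : (j' = Z.sub j (Zpos xH) \/ j' = j \/ j' = Z.add j (Zpos xH)) by lia.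
have e0 k : Z.add (Z.sub k (Zpos xH)) (Zpos xH) = k by lia.
case=> [ej|[ej|ej]]; case=> [ei|[ei|ei]]; subst i' j'; last first.
all: try (by split).
all: exfalso.
- by have := hb i j; rewrite bc b b'; do 2 case: (bump _).
- by have := hb i j; rewrite bc b b'; do 2 case: (bump _).
- have := hb (Z.sub i (Zpos xH)) j; rewrite bc e0 b b'; by do 2 case: (bump _).
- by have := hb i j; rewrite bc b b'; do 2 case: (bump _).
- have := hb (Z.sub i (Zpos xH)) j; rewrite bc e0 b b'; by do 2 case: (bump _).
- have := hb i (Z.sub j (Zpos xH)); rewrite bc e0 b b'; by do 2 case: (bump _).
- have := hb i (Z.sub j (Zpos xH)); rewrite bc e0 b b'; by do 2 case: (bump _).
- have := hb (Z.sub i (Zpos xH)) (Z.sub j (Zpos xH)); rewrite bc !e0 b b'; by do 2 case: (bump _).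
Qed.

(** The unobscured patterns only constrain dominoes whose two cells are
    visible. The 2 by 2 rule will hold everywhere, obscured or not. *)
Lemma noisy_Omega (z : config 2 (tile * bool)%type) :
  (forall k, ~~ (z k).2 -> ~~ (z (k + unit_east)).2 ->
     edge_match east (z k).1 (z (k + unit_east)).1) ->
  (forall k, ~~ (z k).2 -> ~~ (z (k + unit_north)).2 ->
     edge_match north (z k).1 (z (k + unit_north)).1) ->
  (forall k, bump_count (pi1 z) k = 1%N) ->
  Omega (unobscured_patterns RB) z.
Proof.
move=> hE hN hb w k /imfsetP[/= v hv ->] /subpatternP e.
have {}e l a : v.[? l] = Some a -> (z (k + l) : tile * bool) = (a, false).
  move=> hl; have lv : l \in domf v by rewrite -(fndSome v l) hl.
  by have := e l lv; rewrite fnd_unobscured hl /= => -[].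
have dom u a b : u <> 0 -> v = domino u a b ->
    (z k : tile * bool) = (a, false) /\ (z (k + u) : tile * bool) = (b, false).
  move=> u0 ev; split.
    rewrite -[k in LHS]addr0; apply: e; rewrite ev fnd_domino eqxx.
    by case: eqP => // h; case: u0.
  by apply: e; rewrite ev fnd_domino eqxx.
have E0 : unit_east <> 0 by rewrite pt_east pt00 => /pt_inj[].
have N0 : unit_north <> 0 by rewrite pt_north pt00 => /pt_inj[].
move: hv; rewrite /RB !inE => /orP[/orP[]|] /imfsetP[/= q hq ev].
- have [e1 e2] := dom _ _ _ E0 ev.
  by move: hq (hE k); rewrite inE e1 e2 /= => /negbTE-> /(_ isT isT).
- have [e1 e2] := dom _ _ _ N0 ev.
  by move: hq (hN k); rewrite inE e1 e2 /= => /negbTE-> /(_ isT isT).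
move: hq (hb k); rewrite inE /bump_count /pi1.
have EN0 : unit_east + unit_north <> 0.
  by rewrite pt_east pt_north ptD pt00 => /pt_inj[].
have -> : (z k : tile * bool) = (tnth q 0, false).
  rewrite -[k in LHS]addr0; apply: e; rewrite ev fnd_square.
  by do 3! (case: eqP => [/esym//|_]); rewrite eqxx.
have -> : (z (k + unit_east) : tile * bool) = (tnth q 1, false).
  apply: e; rewrite ev fnd_square pt_east pt_north ptD.
  case: eqP => [/pt_inj[]|_]; first by lia.
  case: eqP => [/pt_inj[]|_]; first by lia.
  by rewrite eqxx.
have -> : (z (k + unit_north) : tile * bool) = (tnth q 2, false).
  apply: e; rewrite ev fnd_square pt_east pt_north ptD.
  case: eqP => [/pt_inj[]|_]; first by lia.
  by rewrite eqxx.
have -> : (z (k + (unit_east + unit_north)) : tile * bool) = (tnth q 3, false).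
  by apply: e; rewrite ev fnd_square eqxx.
case: q {ev} => -[|a [|b [|c [|d' [|]]]]] // hq.
rewrite !(tnth_nth point) /= addn0 !addnA => h1 h2.
by rewrite h2 in h1.
Qed.

End Patterns.

(** * Product Bernoulli measures *)

Lemma image_probability (R : realType) d d' (T : measurableType d)
    (T' : measurableType d') (P : probability T R) (f : T -> T') :
  measurable_fun setT f ->
  exists Q : probability T' R, forall A, Q A = P (f @^-1` A).
Proof. by move=> mf; exists (distribution P (mfun_Sub (mem_set mf))). Qed.

(** Normalisation turns a measure of total mass 1 into a bundled probability. *)
Lemma measure_probability (R : realType) d (T : measurableType d)
    (mu : {measure set T -> \bar R}) : mu setT = 1%E ->
  exists P : probability T R, forall A, P A = mu A.
Proof.
move=> mu1; exists (mnormalize mu (dirac point)) => A.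
by rewrite /= /mnormalize mu1 onee_eq0 /= invr1 mule1.
Qed.

Definition coordinate_sets (I : choiceType) : set (set (I -> bool)) :=
  [set A | exists i b, A = [set x | x i = b]].

Definition bits (I : choiceType) : Type := g_sigma_algebraType (@coordinate_sets I).
HB.instance Definition _ (I : choiceType) := Measurable.on (bits I).

Lemma measurable_bits d (T : measurableType d) (I : choiceType) (f : T -> bits I) :
  (forall i, measurable_fun setT (fun x => f x i)) -> measurable_fun setT f.
Proof.
move=> mf; apply: (@measurability _ _ T (bits I) setT f (@coordinate_sets I)) => // _ [_ [i [b ->]] <-].
have mb : measurable [set b] by [].
exact: (mf i measurableT _ mb).
Qed.

Section UnitInterval.
Variable R : realType.

Lemma unit_interval_probability :
  exists U : probability (measurableTypeR R) R,
    forall A, U A = lebesgue_measure (A `&` `[0, 1[).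
Proof.
have [|P hP] := measure_probability (mu := mrestr lebesgue_measure
    (measurable_itv (`[0, 1[ : interval R))).
  by rewrite /= /mrestr setTI lebesgue_measure_itv /= lte_fin ltr01 sube0.
by exists P => A; rewrite hP.
Qed.

Variable unit_measure : probability (measurableTypeR R) R.
Hypothesis unit_measureE : forall A,
  unit_measure A = lebesgue_measure (A `&` `[0, 1[).

Variable p : nat -> R.
Hypothesis p01 : forall n, 0 <= p n <= 1.

(** Arithmetic decoding: the real [x] of the unit interval yields the bits
    [random_bit x n] by successively cutting the current interval in
    proportion [p n] and [1 - p n], so that the set of [x] with a given prefix
    is an interval, the [word_interval], of length the product of the
    probabilities. *)
Fixpoint subinterval (x : R) (n : nat) : R * R :=
  if n is m.+1 then
    let: (a, l) := subinterval x m in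
    if x < a + p m * l then (a, p m * l) else (a + p m * l, (1 - p m) * l)
  else (0, 1).

Definition random_bit (x : R) (n : nat) : bool :=
  x < (subinterval x n).1 + p n * (subinterval x n).2.

Fixpoint word_interval (w : nat -> bool) (n : nat) : R * R :=
  if n is m.+1 then
    let: (a, l) := word_interval w m in
    if w m then (a, p m * l) else (a + p m * l, (1 - p m) * l)
  else (0, 1).

Lemma word_length w n :
  (word_interval w n).2 = \prod_(i < n) bernoulli_pmf (p i) (w i).
Proof.
elim: n => [|n IH] /=; first by rewrite big_ord0.
rewrite big_ord_recr /= -IH mulrC; case: (word_interval w n) => a l /=.
by rewrite /bernoulli_pmf; case: ifP.
Qed.

Lemma word_length_ge0 w n : 0 <= (word_interval w n).2.
Proof. by rewrite word_length prodr_ge0 // => i _; exact: bernoulli_pmf_ge0. Qed.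

Lemma word_interval_sub w n :
  0 <= (word_interval w n).1 /\ (word_interval w n).1 + (word_interval w n).2 <= 1.
Proof.
elim: n => [|n] /=; first by rewrite add0r.
have := word_length_ge0 w n; case: (word_interval w n) => a l /= l0 [a0 al].
have /andP[p0 p1] := p01 n.
have pl : 0 <= p n * l by rewrite mulr_ge0.
have pl' : 0 <= (1 - p n) * l by rewrite mulr_ge0 // subr_ge0.
have e : p n * l + (1 - p n) * l = l by rewrite -mulrDl addrC subrK mul1r.
case: ifP => _ /=; split.
- by [].
- by apply: le_trans al; rewrite lerD2l ler_piMl.
- by rewrite addr_ge0.
- by rewrite -addrA e.
Qed.

Lemma random_word x w n : 0 <= x < 1 ->
  (forall i, (i < n)%N -> random_bit x i = w i) <->
  (word_interval w n).1 <= x < (word_interval w n).1 + (word_interval w n).2.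
Proof.
move=> x01.
suff : ((forall i, (i < n)%N -> random_bit x i = w i) ->
        subinterval x n = word_interval w n) /\
   ((forall i, (i < n)%N -> random_bit x i = w i) <->
  (word_interval w n).1 <= x < (word_interval w n).1 + (word_interval w n).2) by case.
elim: n => [|n [IH1 IH2]]; first by split => //; rewrite /= add0r; split.
have step : (forall i, (i < n.+1)%N -> random_bit x i = w i) <->
    (forall i, (i < n)%N -> random_bit x i = w i) /\ random_bit x n = w n.
  split=> [h|[h hn] i]; first by split=> [i hi|]; apply: h => //; exact: ltnW.
  by rewrite ltnS leq_eqVlt => /orP[/eqP->//|]; exact: h.
split.
  move=> /step[/IH1 e]; rewrite /random_bit e /= e.
  by case: (word_interval w n) => a l /= ->.
split.
  move=> /step[h]; rewrite /random_bit (IH1 h) /=; move/IH2: h.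
  case: (word_interval w n) => a l /= /andP[ax xl] <-.
  case: ifP => [->|/negbT]; first by rewrite ax.
  rewrite -leNgt => -> /=; rewrite -addrA -mulrDl [p n + _]addrC subrK mul1r.
  exact: xl.
move=> h; apply/step.
have h' : forall i, (i < n)%N -> random_bit x i = w i.
  apply/IH2; move: h (word_length_ge0 w n) => /=.
  case: (word_interval w n) => a l /=; have /andP[p0 p1] := p01 n.
  case: ifP => _ /= /andP[h1 h2] l0.
    by rewrite h1 /=; apply: lt_le_trans h2 _; rewrite lerD2l ler_piMl.
  move: h2; rewrite -addrA -mulrDl [p n + _]addrC subrK mul1r => ->.
  by rewrite andbT; apply: le_trans h1; rewrite lerDl mulr_ge0.
split=> //; rewrite /random_bit (IH1 h'); move: h => /=.
case: (word_interval w n) => a l /=; case: ifP => _ /= /andP[h1 h2] //.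
by rewrite ltNge h1.
Qed.

Lemma measurable_subinterval n :
  measurable_fun setT (fun x => (subinterval x n).1) /\
  measurable_fun setT (fun x => (subinterval x n).2).
Proof.
elim: n => [|n [IH1 IH2]] /=; first by split; exact: measurable_cst.
have mpl c : measurable_fun setT (fun x => c * (subinterval x n).2).
  by apply: measurable_funM => //; exact: measurable_cst.
have ma : measurable_fun setT (fun x => (subinterval x n).1 + p n * (subinterval x n).2).
  exact: measurable_funD.
have mc : measurable_fun setT (fun x : R => x < (subinterval x n).1 + p n * (subinterval x n).2).
  by apply: measurable_fun_ltr => //; exact: measurable_id.
split.
- rewrite (_ : (fun x => _) = fun x => if x < (subinterval x n).1 + p n * (subinterval x n).2
    then (subinterval x n).1 else (subinterval x n).1 + p n * (subinterval x n).2).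
    exact: measurable_fun_ifT.
  by apply/funext => x; case: (subinterval x n) => a l /=; case: ifP.
- rewrite (_ : (fun x => _) = fun x => if x < (subinterval x n).1 + p n * (subinterval x n).2
    then p n * (subinterval x n).2 else (1 - p n) * (subinterval x n).2).
    exact: measurable_fun_ifT.
  by apply/funext => x; case: (subinterval x n) => a l /=; case: ifP.
Qed.

Lemma measurable_random_bit n : measurable_fun setT (fun x => random_bit x n).
Proof.
have [m1 m2] := measurable_subinterval n.
apply: measurable_fun_ltr; first exact: measurable_id.
by apply: measurable_funD => //; apply: measurable_funM => //; exact: measurable_cst.
Qed.

Lemma measurable_random_bit_eq n b : measurable [set x | random_bit x n = b].
Proof.
have mb : measurable [set b] by [].
by have := measurable_random_bit n measurableT mb; rewrite setTI.
Qed.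

Lemma random_word_measure w n :
  unit_measure [set x | forall i, (i < n)%N -> random_bit x i = w i] =
  (\prod_(i < n) bernoulli_pmf (p i) (w i))%:E.
Proof.
rewrite -word_length unit_measureE.
have [a0 al] := word_interval_sub w n; have l0 := word_length_ge0 w n.
rewrite (_ : _ `&` _ = `[(word_interval w n).1,
    (word_interval w n).1 + (word_interval w n).2[%classic).
  rewrite lebesgue_measure_itv /= lte_fin.
  move: l0; rewrite le_eqVlt => /orP[/eqP<-|l0]; first by rewrite addr0 ltxx.
  by rewrite ltrDl l0 -EFinB addrAC subrr add0r.
apply/seteqP; split=> x /=; rewrite !in_itv /=.
  by move=> [h x01]; apply/random_word.
move=> h; have x01 : 0 <= x < 1.
  by case/andP: h => h1 h2; rewrite (le_trans a0 h1) (lt_le_trans h2 al).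
by split=> //; apply/random_word.
Qed.

(** Bits outside of [S] are summed out one at a time. *)
Lemma random_cylinder_measure (S : pred nat) w n :
  unit_measure [set x | forall i, (i < n)%N -> S i -> random_bit x i = w i] =
  (\prod_(i < n | S i) bernoulli_pmf (p i) (w i))%:E.
Proof.
move: {2}(#|[pred i : 'I_n | ~~ S i]|) (erefl #|[pred i : 'I_n | ~~ S i]|) => k.
elim: k S w => [|k IH] S w hk.
  have hS (i : 'I_n) : S i.
    have := card0_eq hk i; rewrite !inE; by move=> /negbFE.
  rewrite (eq_bigl predT) => [|i]; last by rewrite hS.
  rewrite -random_word_measure; congr (unit_measure _); apply/seteqP; split=> x /= h i hi.
    by apply: h => //; exact: (hS (Ordinal hi)).
  by move=> _; exact: h.
have /card_gt0P[i0] : (0 < #|[pred i : 'I_n | ~~ S i]|)%N by rewrite hk.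
rewrite inE => Si0.
pose S' := fun i : nat => (i == i0) || S i.
pose w' b := fun i : nat => if i == i0 then b else w i.
have hk' : #|[pred i : 'I_n | ~~ S' i]| = k.
  apply/eqP; rewrite -eqSS -hk (cardD1 i0 [pred i : 'I_n | ~~ S i]) inE Si0 add1n eqSS.
  by apply/eqP/eq_card => i; rewrite !inE /S' negb_or.
have mE b : measurable [set x : R | forall i, (i < n)%N -> S' i -> random_bit x i = w' b i].
  rewrite (_ : [set x | _] = \bigcap_(i in [set i | (i < n)%N /\ S' i])
      [set x | random_bit x i = w' b i]).
    apply: bigcap_measurable => [|i _]; last exact: measurable_random_bit_eq.
    by exists i0 => /=; split=> //; rewrite /S' eqxx.
  by apply/seteqP; split=> x /= h i; [case=> hi hs; apply: h|move=> hi hs; apply: h].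
rewrite (_ : [set x | _] =
  [set x | forall i, (i < n)%N -> S' i -> random_bit x i = w' true i] `|`
  [set x | forall i, (i < n)%N -> S' i -> random_bit x i = w' false i]); last first.
  apply/seteqP; split=> x /=.
    move=> h; case e : (random_bit x i0); [left|right] => i hi;
      rewrite /S' /w' ; case: eqP => [->//|_] /=; exact: h.
  case=> h i hi Si; have := h i hi; rewrite /S' /w' Si orbT;
    case: eqP => [ei|_]; try (by apply).
    by case/negP: Si0; rewrite -ei.
  by case/negP: Si0; rewrite -ei.
have dj : [set x : R | forall i, (i < n)%N -> S' i -> random_bit x i = w' true i] `&`
    [set x : R | forall i, (i < n)%N -> S' i -> random_bit x i = w' false i] = set0.
  apply/seteqP; split=> x //= -[h1 h2].
  have := h1 i0 (ltn_ord i0); have := h2 i0 (ltn_ord i0).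
  by rewrite /S' /w' eqxx /= => -> // /(_ isT).
rewrite measureU; [|exact: mE|exact: mE|exact: dj].
rewrite [X in (X + _)%E](IH S' (w' true) hk') [X in (_ + X)%E](IH S' (w' false) hk').
rewrite -EFinD; congr (_%:E).
have prod b : \prod_(i < n | S' i) bernoulli_pmf (p i) (w' b i) =
    bernoulli_pmf (p i0) b * \prod_(i < n | S i) bernoulli_pmf (p i) (w i).
  rewrite (bigD1 i0) /= ?/S' ?eqxx // /w' eqxx; congr (_ * _).
  apply: eq_big => [i|i /andP[_ /negbTE]].
    rewrite -[X in _ = X]andbT; case: (eqVneq i i0) => [->|ne] /=.
      by rewrite andbF (negbTE Si0).
    by rewrite -(inj_eq val_inj) in ne; rewrite (negbTE ne) !andbT.
  by rewrite -(inj_eq val_inj) => ->.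
by rewrite !prod -mulrDl /bernoulli_pmf addrC subrK mul1r.
Qed.

End UnitInterval.

(** Independent bits with prescribed biases, indexed by any countable type:
    the index is pickled, and unused natural numbers get bias 0. *)
Theorem bernoulli_space (R : realType) (I : countType) (p : I -> R) :
  (forall i, 0 <= p i <= 1) ->
  exists P : probability (bits I) R, forall (J : seq I) (w : I -> bool), uniq J ->
    P [set x | forall i, i \in J -> x i = w i] =
    (\prod_(i <- J) bernoulli_pmf (p i) (w i))%:E.
Proof.
move=> p01; pose q n := if choice.unpickle n is Some i then p i else 0.
have q01 n : 0 <= q n <= 1.
  by rewrite /q; case: (choice.unpickle n) => [i|]; rewrite ?p01 // lexx ler01.
pose f (x : measurableTypeR R) : bits I := fun i => random_bit q x (choice.pickle i).
have mf : measurable_fun setT f.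
  by apply: measurable_bits => i; exact: measurable_random_bit.
have [U UE] := unit_interval_probability R.
have [P hP] := image_probability U mf.
exists P => J w uJ; rewrite hP.
pose w' n := if choice.unpickle n is Some i then w i else false.
pose n := (\max_(i <- J) (choice.pickle i).+1)%N.
have Jn i : i \in J -> (choice.pickle i < n)%N.
  by move=> iJ; rewrite /n (big_rem i) //= leq_max leqnn.
have := random_cylinder_measure UE q01 (mem (map choice.pickle J)) w' n.
rewrite (_ : [set x | _] = f @^-1` [set x | forall i, i \in J -> x i = w i]).
  move=> ->; congr (_%:E).
  rewrite -(big_mkord (fun i => i \in map choice.pickle J) (fun i => bernoulli_pmf (q i) (w' i))).
  rewrite -big_filter (perm_big (map choice.pickle J)) /=.
    by rewrite big_map; apply: eq_bigr => i _; rewrite /q /w' choice.pickleK.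
  apply: uniq_perm; [exact/filter_uniq/iota_uniq| |].
    by rewrite map_inj_uniq //; exact: pcan_inj (@choice.pickleK I).
  move=> i; rewrite mem_filter mem_index_iota /=.
  apply/andP/idP => [[]//|h]; split=> //.
  by case/mapP: h => j jJ ->; exact: Jn.
apply/seteqP; split=> x /=.
  move=> h i iJ; rewrite /f (h _ (Jn _ iJ)) ?map_f //.
  by rewrite /w' choice.pickleK.
move=> h i hi /mapP[j jJ ej]; rewrite ej; have := h j jJ; rewrite /f => ->.
by rewrite /w' choice.pickleK.
Qed.

(** * Maps measurable for every subset of their codomain *)

Section DiscreteMeasurable.
Context d (T : measurableType d).

(** Measurability for the discrete sigma-algebra on the codomain. It is
    preserved by any map out of the codomain, and by choices depending on a
    countable parameter, so functions read off from coordinates are measurable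
    without any measurable structure on their values. *)
Definition discretely_measurable S (f : T -> S) :=
  forall A : set S, measurable (f @^-1` A).

Lemma measurable_exists (S : countType) (P : S -> T -> Prop) :
  (forall s, measurable [set t | P s t]) -> measurable [set t | exists s, P s t].
Proof.
move=> mP; rewrite (_ : [set t | _] = \bigcup_s [set t | P s t]).
  by apply: countable_bigcupT_measurable => // s; exact: mP.
by apply/seteqP; split=> t [s h]; exists s.
Qed.

Lemma measurable_forall (S : countType) (P : S -> T -> Prop) :
  (forall s, measurable [set t | P s t]) -> measurable [set t | forall s, P s t].
Proof.
move=> mP; rewrite -[X in measurable X]setCK; apply: measurableC.
rewrite (_ : ~` _ = [set t | exists s, ~ P s t]).
  by apply: measurable_exists => s; exact: measurableC (mP s).
by apply/seteqP; split=> t /= /existsNP.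
Qed.

Lemma measurable_imply (P Q : T -> Prop) : measurable [set t | P t] ->
  measurable [set t | Q t] -> measurable [set t | P t -> Q t].
Proof.
move=> mP mQ; rewrite (_ : [set t | _] = ~` [set t | P t] `|` [set t | Q t]).
  by apply: measurableU => //; exact: measurableC.
apply/seteqP; split=> t /= h; last by case: h.
by case: (pselect (P t)) => p; [right; exact: h|left].
Qed.

Lemma measurable_cst_prop (P : Prop) : measurable [set t : T | P].
Proof.
case: (pselect P) => p.
  by rewrite (_ : [set t | _] = setT) //; apply/seteqP; split.
by rewrite (_ : [set t | _] = set0) //; apply/seteqP; split.
Qed.

(** Partition according to the countably many values of [f]. *)
Lemma discretely_measurable_bind (S : countType) U (f : T -> S) (g : S -> T -> U) :
  discretely_measurable f -> (forall s, discretely_measurable (g s)) ->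
  discretely_measurable (fun t => g (f t) t).
Proof.
move=> mf mg A.
rewrite (_ : _ @^-1` _ = [set t | exists s, f t = s /\ A (g s t)]).
  apply: measurable_exists => s.
  exact: (measurableI _ _ (mf [set s]) (mg s A)).
by apply/seteqP; split=> t /=; [exists (f t)|case=> s [<-]].
Qed.

Lemma discretely_measurable_comp S U (f : T -> S) (h : S -> U) :
  discretely_measurable f -> discretely_measurable (fun t => h (f t)).
Proof. by move=> mf A; exact: (mf (h @^-1` A)). Qed.

Lemma discretely_measurable_cst S (s : S) : discretely_measurable (fun _ => s).
Proof. by move=> A; exact: measurable_cst_prop. Qed.

Lemma discretely_measurable_count (S : countType) (f : T -> S) :
  (forall s, measurable [set t | f t = s]) -> discretely_measurable f.
Proof.
move=> mf A; rewrite (_ : _ @^-1` _ = [set t | exists s, f t = s /\ A s]).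
  apply: measurable_exists => s.
  exact: (measurableI _ _ (mf s) (measurable_cst_prop (A s))).
by apply/seteqP; split=> t /=; [exists (f t)|case=> s [<-]].
Qed.

Lemma discretely_measurable_bool (P : T -> Prop) : measurable [set t | P t] ->
  discretely_measurable (fun t => `[< P t >]).
Proof.
move=> mP; apply: discretely_measurable_count => -[].
  rewrite (_ : [set t | _] = [set t | P t]) //.
  by apply/seteqP; split=> t /= /asboolP.
rewrite (_ : [set t | _] = ~` [set t | P t]); first exact: measurableC.
by apply/seteqP; split=> t /=; [move/negbT/asboolPn|move/asboolPn/negbTE].
Qed.

Lemma measurable_exists2 (F : nat -> set T) m :
  (forall i, measurable (F i)) -> measurable [set t | exists2 i, (i < m)%N & F i t].
Proof.
move=> mF; rewrite (_ : [set t | _] = [set t | exists i, (i < m)%N /\ F i t]).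
  by apply: measurable_exists => i; apply: measurableI => //; exact: measurable_cst_prop.
by apply/seteqP; split=> t /=; [case=> i h1 h2; exists i|case=> i [h1 h2]; exists i].
Qed.

End DiscreteMeasurable.

Section ConfigMeasurable.
Variables (d : nat) (A : pointedFinType).
Local Notation T := (prod_topology (fun _ : 'rV[int]_d => discrete_topology A)).

(** The cylinders around [x] generate a filter that converges to [x] for the
    product topology. *)
Lemma open_cylinder (U : set T) (x : T) : open U -> U x ->
  exists J : seq 'rV[int]_d, forall y : T, (forall k, k \in J -> y k = x k) -> U y.
Proof.
move=> oU Ux.
pose F : set_system T := fun B : set T => exists J : seq 'rV[int]_d,
  forall y : T, (forall k, k \in J -> y k = x k) -> B y.
have FF : Filter F.
  split; first by exists [::].
    move=> B C [J hJ] [K hK]; exists (J ++ K) => y h; split.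
      by apply: hJ => k kJ; apply: h; rewrite mem_cat kJ.
    by apply: hK => k kK; apply: h; rewrite mem_cat kK orbT.
  by move=> B C BC [J hJ]; exists J => y /hJ; exact: BC.
have : F --> x.
  apply/cvg_sup => i B.
  rewrite (@nbhsE (initial_topology
    (fun f : 'rV[int]_d -> discrete_topology A => f i))) => -[V [[W oW <-] Wx] VB].
  exists [:: i] => y h; apply: VB; rewrite /preimage /=.
  by have := h i (mem_head _ _) => ->.
by apply; apply: open_nbhs_nbhs.
Qed.

Lemma discretely_measurable_coord (k : 'rV[int]_d) :
  discretely_measurable (fun x : config d A => (x k : A)).
Proof.
move=> B; apply: sub_sigma_algebra.
have /continuousP : continuous (fun x : T => x k).
  exact: (@proj_continuous _ (fun _ : 'rV[int]_d => discrete_topology A) k).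
by apply; exact: discrete_open.
Qed.

(** There are countably many finite words, hence each open set of
    configurations is a countable union of cylinders. *)
Lemma measurable_config d' (S : measurableType d') (f : S -> config d A) :
  (forall k, discretely_measurable (fun t => f t k : A)) -> measurable_fun setT f.
Proof.
move=> mf; apply: (@measurability _ _ S (config d A) setT f (@open T)) => //.
move=> _ [U oU <-]; rewrite setTI.
pose cyl (s : seq ('rV[int]_d * A)) := [set y : T | forall p, p \in s -> y p.1 = p.2].
rewrite (_ : _ @^-1` _ = [set t | exists s : seq ('rV[int]_d * A),
    cyl s (f t) /\ cyl s `<=` U]).
  apply: measurable_exists => s; apply: measurableI; last exact: measurable_cst_prop.
  apply: measurable_forall => p; apply: measurable_imply; first exact: measurable_cst_prop.
  exact: (mf p.1 [set p.2]).
apply/seteqP; split=> t /=; last by case=> s [h]; exact.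
move=> Uft; have [J hJ] := open_cylinder oU Uft.
exists [seq (k, f t k : A) | k <- J]; split=> [p /mapP[k _ ->]//|y hy].
by apply: hJ => k kJ; exact: (hy (k, f t k : A) (map_f _ kJ)).
Qed.

End ConfigMeasurable.

Lemma measurable_pi1 (A B : pointedFinType) d :
  measurable_fun setT (@pi1 d A B).
Proof.
apply: measurable_config => k; rewrite /pi1.
apply: (discretely_measurable_comp (fun t : A * B => t.1)).
exact: (discretely_measurable_coord (A := (A * B)%type)).
Qed.

Lemma measurable_pi2 (A B : pointedFinType) d :
  measurable_fun setT (@pi2 d A B).
Proof.
apply: measurable_config => k; rewrite /pi2.
apply: (discretely_measurable_comp (fun t : A * B => t.2)).
exact: (discretely_measurable_coord (A := (A * B)%type)).
Qed.

Lemma measurable_preimage d d' (T : measurableType d) (T' : measurableType d')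
  (f : T -> T') B : measurable_fun setT f -> measurable B -> measurable (f @^-1` B).
Proof. by move=> mf mB; rewrite -[X in measurable X]setTI; exact: mf. Qed.

Section OmegaMeasurable.
Local Open Scope fmap_scope.

Lemma Omega_measurable d (A : pointedFinType) (F : {fset pattern d A}) :
  measurable (Omega F).
Proof.
pose w i : pattern d A := nth [fmap] (enum_fset F) i.
rewrite (_ : Omega F = [set x | forall i k, (i < size (enum_fset F))%N ->
    subpattern (domf (w i)) (config_shift k x) <> w i]).
  apply: measurable_forall => i; apply: measurable_forall => k.
  apply: measurable_imply; first exact: measurable_cst_prop.
  apply: (measurableC (A := [set x |
    subpattern (domf (w i)) (config_shift k x) = w i])).
  rewrite (_ : [set x | _] = [set x : config d A | forall l, l \in domf (w i) ->
     (w i).[? l] = Some (x (k + l) : A)]).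
    apply: measurable_forall => l; apply: measurable_imply.
      exact: measurable_cst_prop.
    exact: (discretely_measurable_coord (A := A) (k + l) [set a | (w i).[? l] = Some a]).
  by apply/seteqP; split=> x /= /subpatternP.
apply/seteqP; split=> x /= h.
  by move=> i k hi; apply: h; exact: mem_nth.
move=> v k vF; have := h (index v (enum_fset F)) k.
by rewrite index_mem /w nth_index //; apply.
Qed.

End OmegaMeasurable.

(** * The stationary seed *)

Section Residues.
Local Open Scope Z_scope.

Fixpoint residue (u : nat -> bool) (n : nat) : Z :=
  if n is m.+1 then residue u m + (if u m then pow2 m else 0) else 0.

Lemma residue_range u n : 0 <= residue u n < pow2 n.
Proof.
elim: n => [|n IH] /=; first by rewrite /pow2 /=; lia.
by rewrite pow2S; case: (u n); lia.
Qed.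

Lemma residue_adic u : adic (residue u).
Proof.
move=> n; split; first exact: residue_range.
have h := residue_range u n => /=; case: (u n); last by rewrite Z.add_0_r Z.mod_small.
by rewrite -{1}(Z.mul_1_l (pow2 n)) Z.mod_add ?Z.mod_small //; lia.
Qed.

(** The inverse of [residue]: the [n]-th bit tells whether the residue changes
    from [n] to [n.+1]. *)
Definition adic_bits (p : nat -> Z) (n : nat) : bool := ~~ (p n.+1 =? p n).

Lemma adic_bitsK p : adic p -> residue (adic_bits p) = p.
Proof.
move=> ap; apply/funext => n; elim: n => [|n IH] /=.
  by have := adic_range 0 ap; rewrite /pow2 /=; lia.
rewrite IH /adic_bits; have [z [hz [_ [_ e]]]] := adic_split n ap.
have m0 := pow2_gt0 n.
have [ez|ez] : z mod 2 = 0 \/ z mod 2 = 1 by liam.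
  by rewrite e ez; case: Z.eqb_spec => ?; cbn [negb]; lia.
by rewrite e ez; case: Z.eqb_spec => ?; cbn [negb]; lia.
Qed.

Lemma residue_bits u n : adic_bits (residue u) n = u n.
Proof.
rewrite /adic_bits /=; have m0 := pow2_gt0 n.
by case: (u n); case: Z.eqb_spec => //; lia.
Qed.

Lemma residue_ext u u' n : residue u n = residue u' n <->
  forall i, (i < n)%N -> u i = u' i.
Proof.
split=> [h i hi|].
  have e m : (m <= n)%N -> residue u m = residue u' m.
    move=> mn; rewrite -(adic_mod_le (residue_adic u) mn) h.
    exact: adic_mod_le (residue_adic u') mn.
  rewrite -(residue_bits u) -(residue_bits u') /adic_bits.
  by rewrite (e i) ?(e i.+1) // ltnW.
elim: n => //= n IH h; rewrite IH => [|i hi]; last by apply: h; exact: ltnW.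
by rewrite h.
Qed.

Lemma adic_add_inj k p q n : adic p -> adic q ->
  adic_add k p n = adic_add k q n -> p n = q n.
Proof.
move=> ap aq e; have m0 := pow2_gt0 n.
have h r : adic r -> (adic_add k r n - k) mod pow2 n = r n.
  move=> ar; rewrite /adic_add Zminus_mod_idemp_l.
  have -> : r n + k - k = r n by lia.
  by rewrite Z.mod_small //; exact: adic_range.
by rewrite -(h p ap) e h.
Qed.

Lemma no_valuation p : adic p -> ~ has_valuation p -> forall m, p m = 0.
Proof.
move=> ap nv; elim=> [|m IH]; first by have := adic_range 0 ap; rewrite /pow2 /=; lia.
have [z [hz [_ [_ e]]]] := adic_split m ap.
have [ez|ez] : z mod 2 = 0 \/ z mod 2 = 1 by liam.
  by rewrite e ez IH.
by case: nv; exists m; apply/has_valP; rewrite e ez IH; lia.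
Qed.

End Residues.

Definition site := 'rV[int]_2.
(** A seed consists of the bits of two 2-adic integers, which place the origin
    in the hierarchy, and of one noise bit for each site. *)
Definition seed_index : countType := ((nat + nat) + 'rV[int]_2)%type.
Definition seed := bits seed_index.

Definition colx (k : site) : Z := Z_of_int (k 0 0).
Definition rowx (k : site) : Z := Z_of_int (k 0 1).

Lemma pt_col k : pt (colx k) (rowx k) = k.
Proof. by have [i [j ->]] := pt_surj k; rewrite /colx /rowx !mxE /= !int_of_ZK. Qed.

Lemma colx_pt i j : colx (pt i j) = i.
Proof. by rewrite /colx mxE /= int_of_ZK. Qed.
Lemma rowx_pt i j : rowx (pt i j) = j.
Proof. by rewrite /rowx mxE /= int_of_ZK. Qed.

Lemma colxD k l : colx (k + l) = Z.add (colx k) (colx l).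
Proof. by rewrite -{1}(pt_col k) -{1}(pt_col l) ptD colx_pt. Qed.
Lemma rowxD k l : rowx (k + l) = Z.add (rowx k) (rowx l).
Proof. by rewrite -{1}(pt_col k) -{1}(pt_col l) ptD rowx_pt. Qed.

Definition hpos (o : seed) : nat -> Z := residue (fun i => o (inl (inl i))).
Definition vpos (o : seed) : nat -> Z := residue (fun i => o (inl (inr i))).
Definition noise_at (o : seed) (k : site) : Z -> Z -> bool :=
  fun i j => o (inr (k + pt i j)).

(** The action of [k] on seeds that corresponds to the shift of
    configurations. On the 2-adic components it is an addition, with carries,
    for which uniform bits are invariant. *)
Definition translate (k : site) (o : seed) : seed := fun i =>
  match i with
  | inl (inl m) => adic_bits (adic_add (colx k) (hpos o)) m
  | inl (inr m) => adic_bits (adic_add (rowx k) (vpos o)) m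
  | inr l => o (inr (k + l))
  end.

Lemma hpos_adic o : adic (hpos o). Proof. exact: residue_adic. Qed.
Lemma vpos_adic o : adic (vpos o). Proof. exact: residue_adic. Qed.

Lemma hpos_translate k o : hpos (translate k o) = adic_add (colx k) (hpos o).
Proof. by apply: adic_bitsK; exact/adic_add_adic/hpos_adic. Qed.
Lemma vpos_translate k o : vpos (translate k o) = adic_add (rowx k) (vpos o).
Proof. by apply: adic_bitsK; exact/adic_add_adic/vpos_adic. Qed.

(** Cylinders described by residues instead of bits; unlike bit cylinders they
    are permuted by [translate]. *)
Definition agree (m : nat) (J : seq site) (o : seed) : set seed :=
  [set o' | [/\ hpos o' m = hpos o m, vpos o' m = vpos o m &
     forall k, k \in J -> o' (inr k) = o (inr k)]].

Definition agree_index (m : nat) (J : seq site) : seq seed_index :=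
  [seq inl (inl i) | i <- iota 0 m] ++ [seq inl (inr i) | i <- iota 0 m] ++
  [seq inr k | k <- J].

Lemma agreeE m J o :
  agree m J o = [set o' | forall i, i \in agree_index m J -> o' i = o i].
Proof.
apply/seteqP; split=> o' /=.
  move=> [/residue_ext h1 /residue_ext h2 h3] i; rewrite !mem_cat.
  case/or3P => /mapP[x]; rewrite ?mem_iota ?add0n => hx ->.
  - exact: h1.
  - exact: h2.
  - exact: h3.
move=> h; split.
- apply/residue_ext => i hi; apply: h; rewrite mem_cat map_f //.
  by rewrite mem_iota add0n.
- apply/residue_ext => i hi; apply: h; rewrite !mem_cat map_f ?orbT //.
  by rewrite mem_iota add0n.
by move=> k hk; apply: h; rewrite !mem_cat map_f ?orbT.
Qed.

Definition agree_sets : set (set seed) :=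
  [set A | A = set0 \/ exists m J o, A = agree m J o].

Lemma agree_measurable m J o : measurable (agree m J o).
Proof.
rewrite agreeE; apply: measurable_forall => i; apply: measurable_imply.
  exact: measurable_cst_prop.
by apply: sub_sigma_algebra; exists i, (o i).
Qed.

Lemma agree_setI : setI_closed agree_sets.
Proof.
move=> A B [->| [m [J [ s0 ->]]]]; first by left; rewrite set0I.
case=> [->| [m' [J' [ s0' ->]]]]; first by left; rewrite setI0.
case: (pselect (exists o2, (agree m J s0 `&` agree m' J' s0') o2)); last first.
  by move=> h; left; apply/seteqP; split=> // x hx; case: h; exists x.
move=> [ o2 [h1 h2]]; right; exists (maxn m m'), (J ++ J'), o2.
have ext x y a b : adic x -> adic y -> (a <= b)%N -> x b = y b -> x a = y a.
  by move=> ax ay ab e; rewrite -(adic_mod_le ax ab) e adic_mod_le.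
have mx x y : adic x -> adic y -> x m = y m -> x m' = y m' ->
    x (maxn m m') = y (maxn m m').
  by rewrite /maxn; case: ifP.
case: h1 => a1 a2 a3; case: h2 => b1 b2 b3.
apply/seteqP; split=> x /=.
  move=> -[[c1 c2 c3] [d1 d2 d3]]; split.
  - by apply: mx; try exact: hpos_adic; rewrite ?c1 ?d1.
  - by apply: mx; try exact: vpos_adic; rewrite ?c2 ?d2.
  - by move=> k; rewrite mem_cat => /orP[] hk; [rewrite c3 ?a3|rewrite d3 ?b3].
move=> [c1 c2 c3]; split; split.
- by rewrite -a1; apply: ext c1; [exact: hpos_adic|exact: hpos_adic|exact: leq_maxl].
- by rewrite -a2; apply: ext c2; [exact: vpos_adic|exact: vpos_adic|exact: leq_maxl].
- by move=> k hk; rewrite c3 ?mem_cat ?hk // a3.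
- by rewrite -b1; apply: ext c1; [exact: hpos_adic|exact: hpos_adic|exact: leq_maxr].
- by rewrite -b2; apply: ext c2; [exact: vpos_adic|exact: vpos_adic|exact: leq_maxr].
- by move=> k hk; rewrite c3 ?mem_cat ?hk ?orbT // b3.
Qed.

(** Finitely many coordinates take finitely many values, so each generator is
    a countable union of sets [agree]. *)
Lemma agree_generate : (measurable : set (set seed)) = <<s agree_sets >>.
Proof.
apply/seteqP; split; last first.
  apply: smallest_sub; first exact: sigma_algebra_measurable.
  by move=> A [->| [m [J [ s0 ->]]]]; [exact: measurable0|exact: agree_measurable].
apply: smallest_sub; first exact: smallest_sigma_algebra.
move=> A [i [b ->]].
have [m [J hi]] : exists m J, i \in agree_index m J.
  case: i => [[i|i]|k].
  - by exists i.+1, [::]; rewrite mem_cat map_f // mem_iota add0n /=.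
  - by exists i.+1, [::]; rewrite !mem_cat map_f ?orbT // mem_iota add0n /=.
  - by exists 0%N, [:: k]; rewrite !mem_cat map_f ?orbT // mem_head.
pose os (s : seq bool) : seed := fun i => nth false s (index i (agree_index m J)).
rewrite (_ : [set x | _] = \bigcup_s (if os s i == b then agree m J (os s) else set0)).
  apply: (@countable_bigcupT_measurable _ (g_sigma_algebraType agree_sets)) => // s.
  apply: sub_sigma_algebra; case: ifP => _; last by left.
  by right; exists m, J, (os s).
apply/seteqP; split=> o /=.
  move=> ob; exists (map o (agree_index m J)) => //.
  have e j : j \in agree_index m J -> os (map o (agree_index m J)) j = o j.
    by move=> hj; rewrite /os (nth_map j) ?index_mem // nth_index.
  by rewrite e // ob eqxx agreeE => j hj; rewrite e.
move=> [s _]; case: eqP => // e; rewrite agreeE => h.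
by rewrite h // e.
Qed.

Lemma translateK k o : translate k (translate (- k) o) = o.
Proof.
have ck : Z.add (colx (- k)) (colx k) = Z0.
  by rewrite -colxD addNr pt00 colx_pt.
have rk : Z.add (rowx (- k)) (rowx k) = Z0.
  by rewrite -rowxD addNr pt00 rowx_pt.
apply/funext => -[[m|m]|l] /=.
- rewrite hpos_translate adic_addA ck adic_add0 ?residue_bits //; exact: hpos_adic.
- rewrite vpos_translate adic_addA rk adic_add0 ?residue_bits //; exact: vpos_adic.
- by rewrite addrA addNr add0r.
Qed.

Lemma translate_agree k m J o :
  translate k @^-1` agree m J o =
  agree m [seq k + l | l <- J] (translate (- k) o).
Proof.
rewrite -{1}(translateK k o); apply/seteqP; split=> x /=.
  rewrite /agree /= !hpos_translate !vpos_translate => -[h1 h2 h3]; split.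
  - apply: adic_add_inj h1; first exact: hpos_adic.
    exact/adic_add_adic/hpos_adic.
  - apply: adic_add_inj h2; first exact: vpos_adic.
    exact/adic_add_adic/vpos_adic.
  - by move=> l /mapP[l' hl' ->]; have := h3 l' hl'.
rewrite /agree /= => -[h1 h2 h3]; rewrite !hpos_translate !vpos_translate; split.
- by rewrite /adic_add h1 hpos_translate.
- by rewrite /adic_add h2 vpos_translate.
- by move=> l hl; apply: h3; exact: map_f.
Qed.

Lemma measurable_translate k : measurable_fun setT (translate k).
Proof.
apply: (@measurability _ _ seed seed setT (translate k) agree_sets).
  exact: agree_generate.
move=> _ [A [->| [m [J [ s0 ->]]]] <-]; first by rewrite preimage_set0 setI0.
by rewrite setTI translate_agree; exact: agree_measurable.
Qed.

Section SeedMeasure.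
Variable R : realType.
Variable eps : R.
Hypothesis eps01 : 0 <= eps <= 1.

Definition seed_weight (i : seed_index) : R := if i is inr _ then eps else 2^-1.

Lemma seed_weight01 i : 0 <= seed_weight i <= 1.
Proof.
case: i => [i|k] //=; rewrite invr_ge0 ler0n /= invf_le1 ?ltr0n //.
by rewrite ler1n.
Qed.

Variable P : probability seed R.
Hypothesis PE : forall (J : seq seed_index) (w : seed_index -> bool), uniq J ->
    P [set x | forall i, i \in J -> x i = w i] =
    (\prod_(i <- J) bernoulli_pmf (seed_weight i) (w i))%:E.

Lemma bernoulli_half b : bernoulli_pmf 2^-1 b = 2^-1 :> R.
Proof. by rewrite /bernoulli_pmf; case: ifP => // _; rewrite {1}(splitr 1) div1r addrK. Qed.

Lemma agree_measure m J o : uniq J -> P (agree m J o) =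
  (2^-1 ^+ m * 2^-1 ^+ m * \prod_(k <- J) bernoulli_pmf eps (o (inr k)))%:E.
Proof.
move=> uJ; rewrite agreeE PE; last first.
  rewrite !cat_uniq !map_inj_uniq ?iota_uniq ?uJ /= ?andbT //; last by move=> ? ? [].
  - apply/andP; split; apply/hasPn => x; rewrite ?mem_cat.
      by case/orP => /mapP[y _ ->]; apply/negP => /mapP[].
    by case/mapP => y _ ->; apply/negP => /mapP[].
  - by move=> ? ? [].
  - by move=> ? ? [].
congr (_%:E); rewrite !big_cat /= !big_map mulrA; congr (_ * _ * _).
- rewrite (eq_bigr (fun=> 2^-1)) => [|i _]; last first.
    exact: bernoulli_half.
  by rewrite big_const_seq iter_mulr_1 count_predT size_iota.
- rewrite (eq_bigr (fun=> 2^-1)) => [|i _]; last first.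
    exact: bernoulli_half.
  by rewrite big_const_seq iter_mulr_1 count_predT size_iota.
Qed.

Lemma agree_undup m J o : agree m (undup J) o = agree m J o.
Proof.
apply/seteqP; split=> x [h1 h2 h3]; split=> // k; rewrite ?mem_undup => hk;
  by apply: h3; rewrite ?mem_undup.
Qed.

(** Both measures agree on the sets [agree], a generating class stable under
    intersection; a translation maps such a set to one with the same number of
    residues and the same noise word. *)
Lemma translate_invariant k A : measurable A -> P (translate k @^-1` A) = P A.
Proof.
move=> mA.
have [Q hQ] := image_probability P (measurable_translate k).
rewrite -hQ; apply: (measure_unique agree_sets (fun=> setT)) => //.
- exact: agree_generate.
- exact: agree_setI.
- move=> _; right; exists 0%N, [::], (fun=> false).
  by apply/seteqP; split.
- by apply/seteqP; split=> // x _; exists 0%N.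
- move=> B; case=> [->| [m [J [ s0 ->]]]]; first by rewrite !measure0.
  transitivity (P (translate k @^-1` agree m J s0)); first exact: hQ.
  rewrite -[in LHS]agree_undup translate_agree.
  rewrite agree_measure; last by rewrite map_inj_uniq ?undup_uniq //; exact: addrI.
  rewrite -[in RHS]agree_undup; symmetry.
  apply: etrans (agree_measure m s0 (undup_uniq J)) _; symmetry.
  rewrite big_map; congr (_%:E); congr (_ * _); apply: eq_bigr => l _ /=.
  by rewrite addrA addNr add0r.
by move=> _; apply: le_lt_trans (probability_le1 Q measurableT) _; rewrite ltry.
Qed.

End SeedMeasure.

(** * The random noisy tiling *)

Definition hloc (o : seed) (k : site) := adic_add (colx k) (hpos o).
Definition vloc (o : seed) (k : site) := adic_add (rowx k) (vpos o).

Lemma hloc_adic o k : adic (hloc o k).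
Proof. exact/adic_add_adic/hpos_adic. Qed.
Lemma vloc_adic o k : adic (vloc o k).
Proof. exact/adic_add_adic/vpos_adic. Qed.

Section RandomConfig.
Variable n : nat.

Definition random_cell (o : seed) (k : site) : cell :=
  tiling_cell n (hloc o k) (vloc o k) (noise_at o k).

Definition random_config (o : seed) : config 2 (tile * bool)%type :=
  fun k => (tile_of_cell (random_cell o k), o (inr k)).

Lemma hloc_translate k o l : hloc (translate k o) l = hloc o (k + l).
Proof. by rewrite /hloc hpos_translate adic_addA colxD. Qed.
Lemma vloc_translate k o l : vloc (translate k o) l = vloc o (k + l).
Proof. by rewrite /vloc vpos_translate adic_addA rowxD. Qed.
Lemma noise_translate k o l : noise_at (translate k o) l = noise_at o (k + l).
Proof.
apply/funext => i; apply/funext => j.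
by rewrite /noise_at /= addrA.
Qed.

Lemma random_config_translate k o :
  random_config (translate k o) = config_shift k (random_config o).
Proof.
apply/funext => l; rewrite /random_config /config_shift.
by rewrite /random_cell hloc_translate vloc_translate noise_translate.
Qed.

Lemma seed_coord_measurable (i : seed_index) :
  discretely_measurable (fun o : seed => o i : bool).
Proof.
apply: discretely_measurable_count => b.
by apply: sub_sigma_algebra; exists i, b.
Qed.

Lemma residue_measurable (f : nat -> seed_index) m :
  discretely_measurable (fun o : seed => residue (fun i => o (f i)) m).
Proof.
elim: m => [|m IH] /=; first exact: discretely_measurable_cst.
apply: (discretely_measurable_bind (g := fun z (o : seed) =>
  Z.add z (if o (f m) then pow2 m else Z0)) IH) => z.
apply: (discretely_measurable_comp (fun b : bool => Z.add z (if b then pow2 m else Z0))).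
exact: seed_coord_measurable.
Qed.

Lemma hloc_measurable k m : discretely_measurable (fun o => hloc o k m).
Proof.
exact: (discretely_measurable_comp (fun z => Z.modulo (Z.add z (colx k)) (pow2 m))
  (residue_measurable (fun i => inl (inl i)) m)).
Qed.

Lemma vloc_measurable k m : discretely_measurable (fun o => vloc o k m).
Proof.
exact: (discretely_measurable_comp (fun z => Z.modulo (Z.add z (rowx k)) (pow2 m))
  (residue_measurable (fun i => inl (inr i)) m)).
Qed.

Lemma mkseq_measurable (f : seed -> nat -> Z) m :
  (forall i, discretely_measurable (fun o => f o i)) ->
  discretely_measurable (fun o => mkseq (f o) m).
Proof.
move=> mf; elim: m => [|m IH]; first exact: discretely_measurable_cst.
rewrite (_ : (fun o => _) = (fun o => (fun s o => rcons s (f o m)) (mkseq (f o) m) o)).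
  apply: (discretely_measurable_bind (g := fun s o => rcons s (f o m)) IH) => s.
  exact: (discretely_measurable_comp (fun z => rcons s z) (mf m)).
apply/funext => o.
by rewrite /mkseq -addn1 iotaD map_cat cats1.
Qed.

Lemma valuation_measurable (f : seed -> nat -> Z) :
  (forall o, adic (f o)) -> (forall i, discretely_measurable (fun o => f o i)) ->
  discretely_measurable (fun o => valuation (f o)).
Proof.
move=> af mf; apply: discretely_measurable_count => b.
have mv b' : measurable [set o | has_val (f o) b'].
  exact: (discretely_measurable_comp (fun z => Z.eqb z (pow2 b')) (mf b'.+1) [set true]).
rewrite (_ : [set o | _] = [set o | has_val (f o) b] `|`
   ([set o | b = 0%N] `&` [set o | forall b', ~ has_val (f o) b'])).
  apply: measurableU => //; apply: measurableI; first exact: measurable_cst_prop.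
  by apply: measurable_forall => b'; exact: measurableC (mv b').
apply/seteqP; split=> o /=.
  move=> <-; case: (pselect (has_valuation (f o))) => h.
    by left; exact: valuationP.
  right; split; last by move=> b' hb'; apply: h; exists b'.
  by rewrite /valuation; case: pselect.
case=> [h|[-> h]]; first exact: valuation_eq.
by rewrite /valuation; case: pselect => // -[b' hb']; case: (h b').
Qed.

Lemma noise_measurable k i j : discretely_measurable (fun o => noise_at o k i j).
Proof. exact: seed_coord_measurable. Qed.

Lemma noise_loc_measurable k (i j : Z -> Z -> Z) m : measurable
  [set o | noise_at o k (i (hloc o k m) (vloc o k m)) (j (hloc o k m) (vloc o k m))].
Proof.
suff : discretely_measurable (fun o =>
    noise_at o k (i (hloc o k m) (vloc o k m)) (j (hloc o k m) (vloc o k m))).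
  by move=> /(_ [set true]).
apply: (discretely_measurable_bind (g := fun z o =>
    noise_at o k (i z (vloc o k m)) (j z (vloc o k m))) (hloc_measurable k m)) => z.
apply: (discretely_measurable_bind (g := fun z' o =>
    noise_at o k (i z z') (j z z')) (vloc_measurable k m)) => z'.
exact: noise_measurable.
Qed.

Lemma measurable_exists_side (Q : side -> seed -> Prop) :
  (forall d, measurable [set o | Q d o]) -> measurable [set o | exists d, Q d o].
Proof.
move=> mQ; rewrite (_ : [set o | _] = [set o | exists i : 'Z_4, Q (side_of_dir i) o]).
  by apply: measurable_exists => i; exact: mQ.
apply/seteqP; split=> o /= -[d h]; last by exists (side_of_dir d).
by exists (dir_of_side d); rewrite dir_of_sideK.
Qed.

Lemma measurable_forall_side (Q : side -> seed -> Prop) :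
  (forall d, measurable [set o | Q d o]) -> measurable [set o | forall d, Q d o].
Proof.
move=> mQ; rewrite (_ : [set o | _] = [set o | forall i : 'Z_4, Q (side_of_dir i) o]).
  by apply: measurable_forall => i; exact: mQ.
apply/seteqP; split=> o /= h d; first exact: h.
by rewrite -(dir_of_sideK d); exact: h.
Qed.

Lemma far_arm_measurable k d t : measurable
  [set o | far_arm n (hloc o k) (vloc o k) (noise_at o k) d t].
Proof.
apply: measurable_exists => s; apply: measurableI; first exact: measurable_cst_prop.
exact: (noise_loc_measurable k
  (fun z _ => Z.add (Z.sub (Z.mul 2 (pow2 n)) z) (Z.mul s (vx d)))
  (fun _ z => Z.add (Z.sub (Z.mul 2 (pow2 n)) z) (Z.mul s (vy d))) n.+2).
Qed.

Lemma good_block_measurable k : measurable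
  [set o | good_block n (hloc o k) (vloc o k) (noise_at o k)].
Proof. by apply: measurable_forall_side => d; exact: far_arm_measurable. Qed.

Lemma flipped_measurable k : discretely_measurable (fun o =>
  flipped n (left_block n (hloc o k)) (hloc o k) (vloc o k) (noise_at o k)).
Proof.
apply: discretely_measurable_bool.
have mh (S : set Z) m := hloc_measurable k m S.
have mv (S : set Z) m := vloc_measurable k m S.
rewrite (_ : [set o | _] = [set o | left_block n (hloc o k)] `&`
  ([set o | hloc o k n.+2 <> Z0] `&` [set o | vloc o k n.+2 <> Z0]) `&`
  [set o | good_block n (hloc o k) (vloc o k) (noise_at o k)] `&`
  [set o | ~ beyond_noise n (hloc o k) (vloc o k) (noise_at o k)]); last first.
  by apply/seteqP; split=> o /=; [case=> ? [? ?] ? ?; do ?split|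
     case=> -[[? [? ?]] ?] ?; split].
apply: measurableI.
  apply: measurableI; last exact: good_block_measurable.
  apply: measurableI; last first.
    apply: measurableI; first exact: (mh [set z | z <> Z0] n.+2).
    exact: (mv [set z | z <> Z0] n.+2).
  exact: (mh [set z | Z.even (Z.div z (pow2 n.+2))] n.+4).
apply: (measurableC (A := [set o |
  beyond_noise n (hloc o k) (vloc o k) (noise_at o k)])).
apply: measurable_exists_side => d; apply: measurable_exists => t.
rewrite (_ : [set o | _] =
  [set o | Z.add (Z.sub (Z.mul 2 (pow2 n)) (hloc o k n.+2)) (Z.mul t (vx d)) = Z0] `&`
  [set o | Z.add (Z.sub (Z.mul 2 (pow2 n)) (vloc o k n.+2)) (Z.mul t (vy d)) = Z0] `&`
  [set o | far_arm n (hloc o k) (vloc o k) (noise_at o k) d t]); last first.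
  by apply/seteqP; split=> o /=; [case|case=> -[]].
apply: measurableI; last exact: far_arm_measurable.
apply: measurableI.
- exact: (mh [set z | Z.add (Z.sub (Z.mul 2 (pow2 n)) z) (Z.mul t (vx d)) = Z0] n.+2).
- exact: (mv [set z | Z.add (Z.sub (Z.mul 2 (pow2 n)) z) (Z.mul t (vy d)) = Z0] n.+2).
Qed.

(** A cell of given valuations depends on finitely many residues only, which
    makes it measurable. *)
Lemma base_cell_trunc a b p q m : (a.+2 < m)%N -> (b.+2 < m)%N ->
  base_cell a b p q = base_cell a b (nth Z0 (mkseq p m)) (nth Z0 (mkseq q m)).
Proof.
move=> am bm; rewrite /base_cell /hline /vline /digit /adic_pred /adic_add.
by rewrite !nth_mkseq.
Qed.

Lemma random_cell_measurable k U (h : cell -> U) :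
  discretely_measurable (fun o => h (random_cell o k)).
Proof.
rewrite /random_cell /tiling_cell.
apply: (discretely_measurable_bind (g := fun f o => h (xor_colour f
  (base_cell (valuation (hloc o k)) (valuation (vloc o k)) (hloc o k) (vloc o k))))
  (flipped_measurable k)) => f.
apply: (discretely_measurable_bind (g := fun a o => h (xor_colour f
  (base_cell a (valuation (vloc o k)) (hloc o k) (vloc o k))))).
  by apply: valuation_measurable => [ o|i]; [exact: hloc_adic|exact: hloc_measurable].
move=> a; apply: (discretely_measurable_bind (g := fun b o => h (xor_colour f
  (base_cell a b (hloc o k) (vloc o k))))).
  by apply: valuation_measurable => [ o|i]; [exact: vloc_adic|exact: vloc_measurable].
move=> b; pose m := (maxn a b).+3.
have am : (a.+2 < m)%N by rewrite /m !ltnS leq_maxl.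
have bm : (b.+2 < m)%N by rewrite /m !ltnS leq_maxr.
rewrite (_ : (fun o => _) = fun o => h (xor_colour f
   (base_cell a b (nth Z0 (mkseq (hloc o k) m)) (nth Z0 (mkseq (vloc o k) m))))).
  apply: (discretely_measurable_bind (g := fun s o => h (xor_colour f
    (base_cell a b (nth Z0 s) (nth Z0 (mkseq (vloc o k) m)))))
    (mkseq_measurable m (hloc_measurable k))) => s.
  exact: (discretely_measurable_comp (fun s' => h (xor_colour f
    (base_cell a b (nth Z0 s) (nth Z0 s')))) (mkseq_measurable m (vloc_measurable k))).
by apply/funext => o; rewrite (base_cell_trunc _ _ am bm).
Qed.

Lemma random_config_measurable : measurable_fun setT random_config.
Proof.
apply: measurable_config => k; rewrite /random_config.
apply: (discretely_measurable_bind (g := fun t (o : seed) => (t, o (inr k) : bool))).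
  exact: random_cell_measurable.
by move=> t; apply: discretely_measurable_comp; exact: seed_coord_measurable.
Qed.

(** The seeds for which no row and no column has infinite level. *)
Definition proper_seed (o : seed) := forall k,
  has_valuation (hloc o k) /\ has_valuation (vloc o k).

Lemma has_valuation_measurable (f : seed -> nat -> Z) :
  (forall m, discretely_measurable (fun o => f o m)) ->
  measurable [set o | has_valuation (f o)].
Proof.
move=> mf; apply: measurable_exists => b.
exact: (discretely_measurable_comp (fun z => Z.eqb z (pow2 b)) (mf b.+1) [set true]).
Qed.

Lemma proper_seed_measurable : measurable proper_seed.
Proof.
apply: measurable_forall => k; apply: measurableI; apply: has_valuation_measurable.
- exact: hloc_measurable.
- exact: vloc_measurable.
Qed.

Lemma random_cell_ok o k : proper_seed o -> cell_ok (random_cell o k).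
Proof.
move=> /(_ k)[hh hv]; apply: tiling_cell_ok => //.
- exact: hloc_adic.
- exact: vloc_adic.
Qed.

Lemma random_tileK o k : proper_seed o ->
  tile_cell (random_config o k).1 = random_cell o k.
Proof. by move=> po; rewrite /= tile_of_cellK //; exact: random_cell_ok. Qed.

Lemma hloc_pt o k i j : hloc o (k + pt i j) = adic_add i (hloc o k).
Proof. by rewrite /hloc adic_addA colxD colx_pt. Qed.
Lemma vloc_pt o k i j : vloc o (k + pt i j) = adic_add j (vloc o k).
Proof. by rewrite /vloc adic_addA rowxD rowx_pt. Qed.
Lemma noise_pt o k i j : noise_at o (k + pt i j) = shift_noise i j (noise_at o k).
Proof.
apply/funext => i'; apply/funext => j'.
by rewrite /noise_at /shift_noise -addrA ptD.
Qed.

Lemma random_cell_east o k : random_cell o (k + unit_east) =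
  tiling_cell n (adic_add (Zpos xH) (hloc o k)) (vloc o k)
    (shift_noise (Zpos xH) Z0 (noise_at o k)).
Proof.
rewrite /random_cell pt_east hloc_pt vloc_pt noise_pt (adic_add0 (p := vloc o k)) //.
exact: vloc_adic.
Qed.

Lemma random_cell_north o k : random_cell o (k + unit_north) =
  tiling_cell n (hloc o k) (adic_add (Zpos xH) (vloc o k))
    (shift_noise Z0 (Zpos xH) (noise_at o k)).
Proof.
rewrite /random_cell pt_north hloc_pt vloc_pt noise_pt (adic_add0 (p := hloc o k)) //.
exact: hloc_adic.
Qed.

Lemma noise00 o k : noise_at o k Z0 Z0 = o (inr k).
Proof. by rewrite /noise_at -pt00 addr0. Qed.
Lemma noise10 o k : noise_at o k (Zpos xH) Z0 = o (inr (k + unit_east)).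
Proof. by rewrite /noise_at pt_east. Qed.
Lemma noise01 o k : noise_at o k Z0 (Zpos xH) = o (inr (k + unit_north)).
Proof. by rewrite /noise_at pt_north. Qed.

Lemma cells_matchE a b x y : tile_cell a = x -> tile_cell b = y ->
  out y dW = ~~ out x dE -> line y dW = line x dE -> edge_match east a b.
Proof. by move=> <- <- h1 h2; apply: (proj2 (edge_matchE a b)); split. Qed.

Lemma cells_matchN a b x y : tile_cell a = x -> tile_cell b = y ->
  out y dS = ~~ out x dN -> line y dS = line x dN -> edge_match north a b.
Proof. by move=> <- <- h1 h2; apply: (proj2 (edge_matchN a b)); split. Qed.

Lemma random_east o k : proper_seed o ->
  edge_match east (random_config o k).1 (random_config o (k + unit_east)).1 \/
  vloc o k n.+2 = Z.mul 2 (pow2 n) /\ (o (inr k) \/ o (inr (k + unit_east))).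
Proof.
move=> po; have [_ hv] := po k; have ah := hloc_adic o k; have av := vloc_adic o k.
have [e|[e1 e2]] := tiling_line_east n (noise_at o k) ah av hv; last first.
  by right; split=> //; rewrite noise00 noise10 in e2.
left; apply: (cells_matchE (random_tileK k po) (random_tileK (k + unit_east) po));
  rewrite random_cell_east //; exact: tiling_out_east.
Qed.

Lemma random_north o k : proper_seed o ->
  edge_match north (random_config o k).1 (random_config o (k + unit_north)).1 \/
  hloc o k n.+2 = Z.mul 2 (pow2 n) /\ (o (inr k) \/ o (inr (k + unit_north))).
Proof.
move=> po; have [hh _] := po k; have ah := hloc_adic o k; have av := vloc_adic o k.
have [e|[e1 e2]] := tiling_line_north n (noise_at o k) ah av hh; last first.
  by right; split=> //; rewrite noise00 noise01 in e2.
left; apply: (cells_matchN (random_tileK k po) (random_tileK (k + unit_north) po));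
  rewrite random_cell_north //; exact: tiling_out_north.
Qed.

Lemma random_bumpy o k : proper_seed o -> bumpy (random_config o k).1 =
  Z.eqb (hloc o k 1%N) (Zpos xH) && Z.eqb (vloc o k 1%N) (Zpos xH).
Proof.
move=> po; have [hh hv] := po k; rewrite bumpyE (random_tileK k po).
by apply: tiling_bump => //; [exact: hloc_adic|exact: vloc_adic].
Qed.

Lemma adic_succ1 p : adic p ->
  Z.eqb (adic_add (Zpos xH) p 1%N) (Zpos xH) = ~~ Z.eqb (p 1%N) (Zpos xH).
Proof.
by move=> ap; rewrite adic_succ //; case: (adic1 n ap) => ->.
Qed.

Lemma random_bump_count o k : proper_seed o ->
  bump_count (pi1 (random_config o)) k = 1%N.
Proof.
move=> po; pose f l : bool := bumpy (random_config o l).1.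
have fE : f = fun l => Z.eqb (hloc o l 1%N) (Zpos xH) && Z.eqb (vloc o l 1%N) (Zpos xH).
  by apply/funext => l; exact: random_bumpy.
change (f k + f (k + unit_east)%R + f (k + unit_north)%R +
  f (k + (unit_east + unit_north))%R = 1)%N.
rewrite fE; have ah := hloc_adic o k; have av := vloc_adic o k.
rewrite pt_east pt_north ptD !hloc_pt !vloc_pt !Z.add_0_r !Z.add_0_l.
rewrite !(adic_add0 ah) !(adic_add0 av) !(adic_succ1 ah) !(adic_succ1 av).
by case: Z.eqb; case: Z.eqb.
Qed.

Lemma random_Omega o : proper_seed o ->
  Omega (unobscured_patterns RB) (random_config o).
Proof.
move=> po; apply: noisy_Omega => k.
- by move=> /= /negbTE b0 /negbTE b1; case: (random_east k po) => // -[_]; rewrite b0 b1 => -[].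
- by move=> /= /negbTE b0 /negbTE b1; case: (random_north k po) => // -[_]; rewrite b0 b1 => -[].
- exact: random_bump_count.
Qed.

(** A mismatch occurs only on an axis of a block, and a bumpy cell is never
    there. *)
Lemma random_bumpy_east o k : proper_seed o ->
  bumpy (random_config o k).1 || bumpy (random_config o (k + unit_east)).1 ->
  edge_match east (random_config o k).1 (random_config o (k + unit_east)).1.
Proof.
move=> po hb; have {hb} e1 : vloc o k 1%N = Zpos xH.
  case/orP: hb; [rewrite (random_bumpy k po)|rewrite (random_bumpy (k + unit_east) po)];
    move=> /andP[_ /Z.eqb_eq e1] //.
  by move: e1; rewrite pt_east vloc_pt (adic_add0 (vloc_adic o k)).
have [//|[e _]] := random_east k po.
by have [_] := adic_odd_low n (vloc_adic o k) e1.
Qed.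

Lemma random_bumpy_north o k : proper_seed o ->
  bumpy (random_config o k).1 || bumpy (random_config o (k + unit_north)).1 ->
  edge_match north (random_config o k).1 (random_config o (k + unit_north)).1.
Proof.
move=> po hb; have {hb} e1 : hloc o k 1%N = Zpos xH.
  case/orP: hb; [rewrite (random_bumpy k po)|rewrite (random_bumpy (k + unit_north) po)];
    move=> /andP[/Z.eqb_eq e1 _] //.
  by move: e1; rewrite pt_north hloc_pt (adic_add0 (hloc_adic o k)).
have [//|[e _]] := random_north k po.
by have [_] := adic_odd_low n (hloc_adic o k) e1.
Qed.

End RandomConfig.

(** * Opposite colours are frequent in the noisy tiling *)

Definition opposite (h : site) (x : config 2 tile) : Prop :=
  [/\ bumpy (x 0), bumpy (x h) & exists c,
      has_colour (tile_cell (x 0)) c /\ has_colour (tile_cell (x h)) (~~ c)].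

(** The rules around the origin, required only if the origin is bumpy. They
    hold in the noisy tiling even at obscured cells. *)
Definition well_placed (x : config 2 tile) : Prop := bumpy (x 0) ->
  [/\ edge_match east (x 0) (x unit_east),
      edge_match east (x (- unit_east)) (x 0),
      edge_match north (x 0) (x unit_north),
      edge_match north (x (- unit_north)) (x 0) & bump_count x 0 = 1%N].

Lemma opposite_measurable h : measurable [set x : config 2 tile | opposite h x].
Proof.
suff : discretely_measurable (fun x : config 2 tile => (x 0 : tile, x h : tile)).
  move=> /(_ [set t | [/\ bumpy t.1, bumpy t.2 & exists c,
    has_colour (tile_cell t.1) c /\ has_colour (tile_cell t.2) (~~ c)]]).
  by congr measurable.
apply: (discretely_measurable_bind (g := fun (t : tile) (x : config 2 tile) => (t, x h : tile))).
  exact: discretely_measurable_coord.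
by move=> t; apply: discretely_measurable_comp; exact: discretely_measurable_coord.
Qed.

Lemma well_placed_measurable : measurable [set x : config 2 tile | well_placed x].
Proof.
pose J := [:: 0; unit_east; - unit_east; unit_north; - unit_north; unit_east + unit_north].
pose F (x : config 2 tile) := map (fun k => x k : tile) J.
have mF K : discretely_measurable (fun x : config 2 tile => map (fun k => x k : tile) K).
  elim: K => [|k K IH] /=; first exact: discretely_measurable_cst.
  apply: (discretely_measurable_bind (g := fun (t : tile) (x : config 2 tile) =>
    t :: map (fun k => x k : tile) K)); first exact: discretely_measurable_coord.
  by move=> t; exact: discretely_measurable_comp.
have := mF J [set s | let t i := nth (point : tile) s i in bumpy (t 0%N) ->
  [/\ edge_match east (t 0%N) (t 1%N), edge_match east (t 2%N) (t 0%N),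
      edge_match north (t 0%N) (t 3%N), edge_match north (t 4%N) (t 0%N) &
      (bumpy (t 0%N) + bumpy (t 1%N) + bumpy (t 3%N) + bumpy (t 5%N))%N = 1%N]].
congr measurable; apply/seteqP; split=> x /=;
  by rewrite /well_placed /bump_count !add0r.
Qed.

Lemma hloc0 o : hloc o 0 = hpos o.
Proof. by rewrite /hloc pt00 colx_pt adic_add0 //; exact: hpos_adic. Qed.
Lemma vloc0 o : vloc o 0 = vpos o.
Proof. by rewrite /vloc pt00 rowx_pt adic_add0 //; exact: vpos_adic. Qed.

Definition good_at n (k : site) (o : seed) :=
  good_block n (hloc o k) (vloc o k) (noise_at o k).

Definition period n : site := pt (pow2 n.+2) Z0.

(** Consecutive blocks of a row are on opposite sides of the alternation, so
    when both are good their bumpy cells have different colours. *)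
Lemma random_opposite n o : proper_seed o ->
  hpos o 1%N = Zpos xH -> vpos o 1%N = Zpos xH ->
  good_at n 0 o -> good_at n (period n) o ->
  opposite (period n) (pi1 (random_config n o)).
Proof.
move=> po h1 v1 g0 gh.
have eh : hloc o (period n) = adic_add (pow2 n.+2) (hloc o 0).
  by have := hloc_pt o 0 (pow2 n.+2) Z0; rewrite add0r.
have ev : vloc o (period n) = vloc o 0.
  have := vloc_pt o 0 (pow2 n.+2) Z0; rewrite add0r adic_add0 //.
  exact: vloc_adic.
have h1' : hloc o (period n) 1%N = Zpos xH.
  rewrite eh hloc0 /adic_add h1.
  rewrite (_ : pow2 n.+2 = Z.mul (pow2 n.+1) (pow2 1)); last first.
    by rewrite pow2S Z.mul_comm.
  by rewrite Z.mod_add.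
have [hh hv] := po 0; have [hh' hv'] := po (period n).
have b0 : bumpy (pi1 (random_config n o) 0).
  by rewrite /pi1 (random_bumpy n 0 po) hloc0 vloc0 h1 v1.
have bh : bumpy (pi1 (random_config n o) (period n)).
  by rewrite /pi1 (random_bumpy n (period n) po) h1' ev vloc0 v1.
split=> //; exists (left_block n (hloc o 0)); split.
  rewrite /pi1 (random_tileK n 0 po); apply: tiling_bump_colour => //.
  - exact: hloc_adic.
  - exact: vloc_adic.
  - by rewrite hloc0.
  - by rewrite vloc0.
rewrite /pi1 (random_tileK n (period n) po) -left_block_period; last exact: hloc_adic.
rewrite -eh; apply: tiling_bump_colour => //.
- exact: hloc_adic.
- exact: vloc_adic.
- by rewrite ev vloc0.
Qed.

Lemma random_well_placed n o : proper_seed o -> well_placed (pi1 (random_config n o)).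
Proof.
move=> po b0.
have hE := random_bumpy_east (n := n) (k := 0) po; have hW := random_bumpy_east (n := n) (k := - unit_east) po.
have hN := random_bumpy_north (n := n) (k := 0) po; have hS := random_bumpy_north (n := n) (k := - unit_north) po.
rewrite add0r in hE; rewrite add0r in hN; rewrite addNr in hW; rewrite addNr in hS.
split.
- by apply: hE; apply/orP; left.
- by apply: hW; apply/orP; right.
- by apply: hN; apply/orP; left.
- by apply: hS; apply/orP; right.
- exact: random_bump_count.
Qed.

Section UnionBound.
Context d (T : measurableType d) (R : realType) (P : probability T R).

Lemma union_bound (F : nat -> set T) (m : nat) (c : R) :
  (forall i, measurable (F i)) -> (forall i, (P (F i) <= c%:E)%E) ->
  (P [set t | exists2 i, (i < m)%N & F i t] <= (c *+ m)%:E)%E.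
Proof.
move=> mF hF; elim: m => [|m IH].
  rewrite (_ : [set t | _] = set0) ?measure0 ?mulr0n //.
  by apply/seteqP; split=> t //= -[].
have mm := measurable_exists2 m mF.
rewrite (_ : [set t | _] = [set t | exists2 i, (i < m)%N & F i t] `|` F m).
  apply: le_trans (measureU2 P mm (mF m)) _.
  by rewrite mulrSr EFinD; apply: leeD; [exact: IH|exact: hF].
apply/seteqP; split=> t /=.
  by move=> [i]; rewrite ltnS leq_eqVlt => /orP[/eqP->|h] Fi; [right|left; exists i].
by case=> [[i h Fi]|h]; [exists i => //; exact: ltnW|exists m].
Qed.

Lemma measure_sub_add (A B C : set T) : measurable A -> measurable B ->
  measurable C -> A `<=` B `|` C -> (P A <= P B + P C)%E.
Proof.
move=> mA mB mC sABC; apply: le_trans (measureU2 _ mB mC).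
by apply: le_measure; rewrite ?inE //; exact: measurableU.
Qed.

Lemma full_measure (A B : set T) : measurable A -> measurable B ->
  P (~` B) = 0%E -> B `<=` A -> P A = 1%E.
Proof.
move=> mA mB B0 BA; apply/eqP; rewrite eq_le probability_le1 //=.
have := measure_sub_add measurableT mA (measurableC mB).
rewrite probability_setT B0 adde0; apply=> t _.
by case: (pselect (B t)) => h; [left; exact: BA|right].
Qed.

Lemma countable_null (S : countType) (F : S -> set T) :
  (forall s, measurable (F s)) -> (forall s, P (F s) = 0%E) ->
  P [set t | exists s, F s t] = 0%E.
Proof.
move=> mF F0; pose G i := if choice.unpickle i is Some s then F s else set0.
have mG i : measurable (G i) by rewrite /G; case: choice.unpickle.
rewrite (_ : [set t | _] = \bigcup_i G i).
  apply/negligibleP; first exact: bigcupT_measurable.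
  apply: negligible_bigcup => i; apply/negligibleP => //.
  by rewrite /G; case: choice.unpickle => [s|]; [exact: F0|exact: measure0].
apply/seteqP; split=> t /=.
  by case=> s Fs; exists (choice.pickle s) => //; rewrite /G choice.pickleK.
by case=> i _; rewrite /G; case: choice.unpickle => // s Fs; exists s.
Qed.

End UnionBound.

Lemma pow2_nat n : pow2 n = Z.of_nat (2 ^ n)%N.
Proof.
elim: n => [|n IH] //; rewrite pow2S IH expnS; lia.
Qed.

(** The sites where an obscured cell of the arm [d] of the block of [k] is
    sought, when the origin has residues [a] and [b] modulo the side of the
    block. *)
Definition arm_cells n (k : site) (d : side) (a b : nat) : seq site :=
  [seq k + pt (Z.add (Z.sub (Z.mul 2 (pow2 n))
                (Z.modulo (Z.add (Z.of_nat a) (colx k)) (pow2 n.+2)))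
                (Z.mul (Z.of_nat s) (vx d)))
              (Z.add (Z.sub (Z.mul 2 (pow2 n))
                (Z.modulo (Z.add (Z.of_nat b) (rowx k)) (pow2 n.+2)))
                (Z.mul (Z.of_nat s) (vy d)))
   | s <- iota (2 ^ n).+1 (2 ^ n).-1].

Lemma arm_cells_uniq n k d a b : uniq (arm_cells n k d a b).
Proof.
rewrite map_inj_uniq ?iota_uniq // => s s' /addrI/pt_inj[].
by case: d; cbn [vx vy]; lia.
Qed.

(** Prescribing the residues of the origin makes this event a cylinder. *)
Definition clear_arm n k d a b : set seed :=
  [set o | [/\ hpos o n.+2 = Z.of_nat a, vpos o n.+2 = Z.of_nat b &
     forall l, l \in arm_cells n k d a b -> o (inr l) = false]].

Lemma hpos_measurable m (A : set Z) : measurable [set o | A (hpos o m)].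
Proof. exact: (residue_measurable (fun i => inl (inl i)) m A). Qed.
Lemma vpos_measurable m (A : set Z) : measurable [set o | A (vpos o m)].
Proof. exact: (residue_measurable (fun i => inl (inr i)) m A). Qed.

Lemma clear_arm_measurable n k d a b : measurable (clear_arm n k d a b).
Proof.
rewrite (_ : clear_arm n k d a b =
  [set o | hpos o n.+2 = Z.of_nat a] `&` [set o | vpos o n.+2 = Z.of_nat b] `&`
  [set o | forall l, l \in arm_cells n k d a b -> o (inr l) = false]); last first.
  by apply/seteqP; split=> o /=; [case|case=> -[]].
apply: measurableI; first by apply: measurableI;
  [exact: (hpos_measurable _ [set z | z = _])|exact: (vpos_measurable _ [set z | z = _])].
apply: measurable_forall => l; apply: measurable_imply; first exact: measurable_cst_prop.
exact: (seed_coord_measurable (inr l) [set false]).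
Qed.

Lemma bad_block_clear n k o : ~ good_at n k o ->
  exists2 i, (i < 4)%N & exists2 a, (a < 2 ^ n.+2)%N & exists2 b, (b < 2 ^ n.+2)%N &
    clear_arm n k (side_of_dir (inord i : 'I_4)) a b o.
Proof.
move=> /existsNP[d nd]; exists (dir_of_side d : 'I_4) => //.
have rng x : (Z.le 0 x /\ Z.lt x (pow2 n.+2)) -> exists2 a, (a < 2 ^ n.+2)%N & x = Z.of_nat a.
  rewrite pow2_nat => -[x0 x1]; exists (Z.to_nat x); last by lia.
  by apply/ssrnat.ltP; lia.
have [a an ea] := rng _ (adic_range n.+2 (hpos_adic o)).
have [b bn eb] := rng _ (adic_range n.+2 (vpos_adic o)).
exists a => //; exists b => //; rewrite inord_val dir_of_sideK; split=> // l.
case/mapP => s; rewrite mem_iota => hs ->.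
apply/negP => ho; apply: nd; exists (Z.of_nat s); split.
  rewrite pow2_nat; move: hs; have /ssrnat.ltP : (0 < 2 ^ n)%N by rewrite expn_gt0.
  by move: (2 ^ n)%N => m m0 /andP[/ssrnat.leP h1 /ssrnat.ltP h2]; split; lia.
by rewrite /noise_at /hloc /vloc /adic_add ea eb.
Qed.

Section Estimates.
Variable R : realType.
Variable eps : R.
Hypothesis eps01 : 0 <= eps <= 1.
Variable P : probability seed R.
Hypothesis PE : forall (J : seq seed_index) (w : seed_index -> bool), uniq J ->
    P [set x | forall i, i \in J -> x i = w i] =
    (\prod_(i <- J) bernoulli_pmf (seed_weight eps i) (w i))%:E.

(** An arm has [(2 ^ n).-1] candidate sites, independently obscured with
    probability [eps]. *)
Lemma clear_arm_le n k d a b : (P (clear_arm n k d a b) <=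
  ((1 - eps) ^+ (2 ^ n).-1 * 2^-1 ^+ n.+2 * 2^-1 ^+ n.+2)%:E)%E.
Proof.
have e0 : 0 <= 1 - eps by rewrite subr_ge0; case/andP: eps01.
case: (pselect (exists o, clear_arm n k d a b o)) => [[ o [h1 h2 h3]]|no]; last first.
  rewrite (_ : clear_arm _ _ _ _ _ = set0) ?measure0 ?lee_fin.
    by apply: mulr_ge0; [apply: mulr_ge0|]; apply: exprn_ge0; rewrite ?invr_ge0 ?ler0n.
  by apply/seteqP; split=> // o ho; case: no; exists o.
rewrite (_ : clear_arm _ _ _ _ _ = agree n.+2 (arm_cells n k d a b) o).
  rewrite (agree_measure PE _ _ (arm_cells_uniq n k d a b)) lee_fin.
  rewrite big_seq (eq_bigr (fun=> 1 - eps)) => [|l hl]; last by rewrite h3.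
  rewrite -big_seq big_const_seq iter_mulr_1 count_predT size_map size_iota.
  by rewrite mulrC mulrA.
apply/seteqP; split=> x [x1 x2 x3]; split; rewrite ?h1 ?h2 //.
- by move=> l hl; rewrite x3 // h3.
- by rewrite -h1.
- by rewrite -h2.
- by move=> l hl; rewrite x3 // h3.
Qed.

Lemma good_at_measurable n k : measurable [set o | good_at n k o].
Proof. exact: good_block_measurable. Qed.

(** Sum over the four arms; the sum over the residues of the origin is an
    average. *)
Lemma bad_block_le n k : (P (~` [set o | good_at n k o]) <=
  ((1 - eps) ^+ (2 ^ n).-1 *+ 4)%:E)%E.
Proof.
pose q := (1 - eps) ^+ (2 ^ n).-1.
have e2 : 2^-1 ^+ n.+2 *+ (2 ^ n.+2) = 1 :> R.
  by rewrite -mulr_natr natrX -exprMn mulVf ?expr1n // pnatr_eq0.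
pose F d a b := clear_arm n k d a b.
have mF d a : measurable [set t | exists2 b, (b < 2 ^ n.+2)%N & F d a b t].
  by apply: measurable_exists2 => b; exact: clear_arm_measurable.
have mF' d : measurable [set t | exists2 a, (a < 2 ^ n.+2)%N &
    exists2 b, (b < 2 ^ n.+2)%N & F d a b t].
  exact: (measurable_exists2 (2 ^ n.+2) (mF d)).
have F1 d a : (P [set t | exists2 b, (b < 2 ^ n.+2)%N & F d a b t] <=
    (q * 2^-1 ^+ n.+2)%:E)%E.
  have := union_bound (P := P) (2 ^ n.+2) (fun b => clear_arm_measurable n k d a b)
    (fun b => clear_arm_le n k d a b).
  by rewrite -mulrnAr e2 mulr1.
have F2 d : (P [set t | exists2 a, (a < 2 ^ n.+2)%N &
    exists2 b, (b < 2 ^ n.+2)%N & F d a b t] <= q%:E)%E.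
  have := union_bound (P := P) (2 ^ n.+2) (mF d) (F1 d).
  by rewrite -mulrnAr e2 mulr1.
have := union_bound (P := P) 4 (fun i => mF' (side_of_dir (inord i : 'I_4)))
  (fun i => F2 (side_of_dir (inord i : 'I_4))).
apply: le_trans; apply: le_measure; rewrite ?inE.
- by apply: measurableC; exact: good_at_measurable.
- exact: (measurable_exists2 4 (fun i => mF' (side_of_dir (inord i : 'I_4)))).
- by move=> o; exact: bad_block_clear.
Qed.

Lemma prefix_le (f : nat -> seed_index) m (a : Z) : injective f ->
  (forall i, exists j, f i = inl j) ->
  (P [set o | residue (fun i => o (f i)) m = a] <= (2^-1 ^+ m)%:E)%E.
Proof.
move=> finj fl.
case: (pselect (exists o : seed, residue (fun i => o (f i)) m = a)) => [[ o ho]|no]; last first.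
  rewrite (_ : [set o | _] = set0) ?measure0 ?lee_fin ?exprn_ge0 ?invr_ge0 //.
  by apply/seteqP; split=> // o ho; case: no; exists o.
rewrite (_ : [set o | _] = [set x | forall i, i \in map f (iota 0 m) -> x i = o i]).
  rewrite PE ?map_inj_uniq ?iota_uniq // big_map lee_fin.
  rewrite (eq_bigr (fun=> 2^-1)) => [|i _].
    by rewrite big_const_seq iter_mulr_1 count_predT size_iota.
  have [j ->] := fl i.
  exact: bernoulli_half.
apply/seteqP; split=> x /=.
  rewrite -ho => /residue_ext h i /mapP[j]; rewrite mem_iota add0n => hj ->.
  exact: h.
by move=> h; rewrite -ho; apply/residue_ext => i hi; apply: h; rewrite map_f // mem_iota.
Qed.

Lemma small_null (A : set seed) : measurable A ->
  (forall m, (P A <= (2^-1 ^+ m)%:E)%E) -> P A = 0%E.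
Proof.
move=> mA hA; apply/eqP; rewrite eq_le measure_ge0 andbT.
have fA : P A \is a fin_num by apply: fin_num_measure.
rewrite -(fineK fA) lee_fin.
have cv : ((2^-1 : R) ^+ m) @[m --> \oo] --> (0 : R).
  by apply: cvg_expr; rewrite ger0_norm ?invr_ge0 // invf_lt1 // ltr1n.
rewrite -(cvg_lim _ cv) //; apply: limr_ge; first by apply/cvg_ex; exists 0.
by near=> m; rewrite -lee_fin fineK.
Unshelve. all: by end_near.
Qed.

Lemma adic_add_eq0 p k m : adic p -> adic_add k p m = Z0 ->
  p m = Z.modulo (Z.opp k) (pow2 m).
Proof.
move=> ap e; rewrite -(Z.mod_small (p m) (pow2 m)); last exact: adic_range.
have -> : p m = Z.sub (Z.add (p m) k) k by lia.
by rewrite -Zminus_mod_idemp_l; move: e; rewrite /adic_add => ->.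
Qed.

(** Without valuation the position is the 2-adic integer 0, an atom of
    probability 0. *)
Lemma no_valuation_null (pos : seed -> nat -> Z) (f : nat -> seed_index) k :
  (forall o, pos o = residue (fun i => o (f i))) -> injective f ->
  (forall i, exists j, f i = inl j) ->
  P [set o | ~ has_valuation (adic_add k (pos o))] = 0%E.
Proof.
move=> posE finj fl.
have mp m (S : set Z) : measurable [set o | S (pos o m)].
  have := residue_measurable f m S; congr measurable.
  by apply/seteqP; split=> o /=; rewrite posE.
have mN : measurable [set o | ~ has_valuation (adic_add k (pos o))].
  apply: (measurableC (A := [set o | exists b, has_val (adic_add k (pos o)) b])).
  apply: measurable_exists => b.
  exact: (mp b.+1 [set z | Z.eqb (Z.modulo (Z.add z k) (pow2 b.+1)) (pow2 b)]).
apply: small_null => // m.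
apply: le_trans (prefix_le m (Z.modulo (Z.opp k) (pow2 m)) finj fl).
apply: le_measure; rewrite ?inE //.
  have := mp m [set z | z = Z.modulo (Z.opp k) (pow2 m)]; congr measurable.
  by apply/seteqP; split=> o /=; rewrite posE.
have ad o : adic (pos o) by rewrite posE; exact: residue_adic.
move=> o no /=; rewrite -posE; apply: adic_add_eq0 => //.
exact: no_valuation (adic_add_adic k (ad o)) no m.
Qed.

Lemma proper_full : P (~` proper_seed) = 0%E.
Proof.
have -> : ~` proper_seed = [set o | exists k,
    ([set o | ~ has_valuation (hloc o k)] `|` [set o | ~ has_valuation (vloc o k)]) o].
  apply/seteqP; split=> o /=.
    move=> /existsNP[k hk]; exists k.
    case: (pselect (has_valuation (hloc o k))) => h; last by left.
    by right=> h'; apply: hk.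
  by case=> k [] h po; apply: h; have [] := po k.
have mh k : measurable [set o | ~ has_valuation (hloc o k)].
  exact: measurableC (has_valuation_measurable (hloc_measurable k)).
have mv k : measurable [set o | ~ has_valuation (vloc o k)].
  exact: measurableC (has_valuation_measurable (vloc_measurable k)).
apply: countable_null => k; first exact: measurableU.
apply/eqP; rewrite eq_le measure_ge0 andbT.
apply: le_trans (measureU2 P (mh k) (mv k)) _.
have inl_eq k' := no_valuation_null (pos := hpos) (f := fun i => inl (inl i)) k'
  (fun=> erefl) (fun _ _ e => ltac:(by case: e)) (fun i => ex_intro _ _ erefl).
have inr_eq k' := no_valuation_null (pos := vpos) (f := fun i => inl (inr i)) k'
  (fun=> erefl) (fun _ _ e => ltac:(by case: e)) (fun i => ex_intro _ _ erefl).
have Eh : P [set o | ~ has_valuation (hloc o k)] = 0%E := inl_eq (colx k).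
have Ev : P [set o | ~ has_valuation (vloc o k)] = 0%E := inr_eq (rowx k).
by rewrite -[leRHS]adde0; apply: leeD; rewrite le_eqVlt;
  apply/orP; left; apply/eqP; [exact: Eh|exact: Ev].
Qed.

(** The origin is bumpy with probability [1/4], its residues being odd; then
    it remains to avoid two bad blocks, of probability at most
    [4 (1 - eps) ^ (2 ^ n - 1)] each. *)
Lemma opposite_probability n : ((4^-1 - (1 - eps) ^+ (2 ^ n).-1 *+ 8)%:E <=
  P [set o | opposite (period n) (pi1 (random_config n o))])%E.
Proof.
set E := [set o | _].
have mE : measurable E.
  have mc : measurable_fun setT (fun o => pi1 (random_config n o)).
    by apply: measurableT_comp; [exact: measurable_pi1|exact: random_config_measurable].
  exact: measurable_preimage mc (opposite_measurable (period n)).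
pose A := agree 1 [::] (fun=> true).
have PA : P A = (4^-1)%:E.
  rewrite (agree_measure PE) // big_nil mulr1 !expr1 -invfM.
  by congr (_^-1%:E); rewrite -natrM.
have mg k : measurable (~` [set o | good_at n k o]).
  by apply: measurableC; exact: good_at_measurable.
have mp : measurable (~` proper_seed) by apply: measurableC; exact: proper_seed_measurable.
have sA : A `<=` E `|` (~` [set o | good_at n 0 o] `|`
    (~` [set o | good_at n (period n) o] `|` ~` proper_seed)).
  move=> o [h v _].
  case: (pselect (good_at n 0 o)) => g0; last by right; left.
  case: (pselect (good_at n (period n) o)) => gh; last by right; right; left.
  case: (pselect (proper_seed o)) => po; last by right; right; right.
  by left; apply: random_opposite.
have := measure_sub_add P (agree_measurable _ _ _) mE
  (measurableU _ _ (mg 0) (measurableU _ _ (mg (period n)) mp)) sA.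
rewrite PA => h1.
have h2 := measureU2 P (mg 0) (measurableU _ _ (mg (period n)) mp).
have h3 := measureU2 P (mg (period n)) mp.
rewrite EFinB leeBlDr //.
apply: le_trans h1 _; apply: leeD => //.
apply: le_trans h2 _.
have -> : (1 - eps) ^+ (2 ^ n).-1 *+ 8 =
  (1 - eps) ^+ (2 ^ n).-1 *+ 4 + (1 - eps) ^+ (2 ^ n).-1 *+ 4 by rewrite -mulrnDr.
rewrite EFinD; apply: leeD; first exact: bad_block_le.
apply: le_trans h3 _; rewrite -[leRHS]adde0; apply: leeD; first exact: bad_block_le.
by rewrite le_eqVlt; apply/orP; left; apply/eqP; exact: proper_full.
Qed.

End Estimates.

(** The constant [24^-1] is what the final count leaves room for:
    [1/4 - 1/24 = 5/24]. *)
Lemma noisy_law (R : realType) (eps : R) : 0 < eps <= 1 ->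
  exists (H : Z) (lam : probability (config 2 (tile * bool)%type) R),
  [/\ Z.lt 0 H, noisy_lifts RB eps lam,
      lam [set z | well_placed (pi1 z)] = 1%E &
      ((4^-1 - 24^-1)%:E <= lam [set z | opposite (pt H Z0) (pi1 z)])%E].
Proof.
move=> /andP[e0 e1].
have e01 : 0 <= eps <= 1 by rewrite (ltW e0).
have [P PE] := bernoulli_space (seed_weight01 e01).
have z01 : 0 <= 1 - eps < 1 by rewrite subr_ge0 e1 gtrBl.
have [m hm] : exists m, (1 - eps) ^+ m *+ 8 <= 24^-1.
  have cv : ((1 - eps) ^+ m) @[m --> \oo] --> (0 : R).
    by apply: cvg_expr; case/andP: z01 => ? ?; rewrite ger0_norm.
  have /cvgrPdist_lt /(_ (192^-1)) := cv.
  rewrite invr_gt0 ltr0n => /(_ isT)[m _ hm]; exists m.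
  have := hm m (leqnn m); rewrite sub0r normrN ger0_norm; last first.
    by apply: exprn_ge0; case/andP: z01.
  move=> /ltW h; rewrite -mulr_natr.
  by lra.
pose n := m.
have hn : (1 - eps) ^+ (2 ^ n).-1 *+ 8 <= 24^-1.
  apply: le_trans hm; rewrite lerMn2r /=; case/andP: z01 => z0 z1.
  by apply: ler_wiXn2l => //; [exact: ltW|rewrite -ltnS prednK ?expn_gt0 // ltn_expl].
have mPhi := random_config_measurable n.
have [lam lamE] := image_probability P mPhi.
have full (A : set (config 2 (tile * bool)%type)) : measurable A ->
    (forall o, proper_seed o -> A (random_config n o)) -> lam A = 1%E.
  move=> mA hA; rewrite lamE.
  have mB := measurable_preimage mPhi mA.
  exact: (full_measure mB proper_seed_measurable (proper_full e01 PE) hA).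
exists (pow2 n.+2), lam; split; first exact: pow2_gt0.
- split.
    split; last by apply: full; [exact: Omega_measurable|exact: random_Omega].
    move=> k B mB; rewrite /pushforward !lamE.
    have mB' := measurable_preimage mPhi mB.
    rewrite -(translate_invariant PE k mB'); congr (P _).
    apply/seteqP; split=> o; rewrite /preimage /= random_config_translate //.
  exists eps; first by rewrite (ltW e0) lexx.
  move=> w; rewrite /pushforward lamE.
  pose J : seq seed_index := [seq inr k | k <- enum_fset (domf w)].
  pose v (i : seed_index) := if i is inr k then odflt false (fnd w k) else false.
  have := PE J v; rewrite map_inj_uniq ?fset_uniq //; last by move=> ? ? [].
  move=> /(_ isT); rewrite big_map /= big_seq_fsetE /=.
  rewrite (_ : [set x | forall i, _] = random_config n @^-1`
    (@pi2 2 tile bool @^-1` [set x | subpattern (domf w) x = w])).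
    by move=> ->; congr (_%:E); apply: eq_bigr => i _; rewrite -Some_fnd.
  apply/seteqP; split=> o /=.
    move=> h; apply/subpatternP => k kw; have := h _ (map_f inr kw).
    by rewrite /pi2 /= => ->; rewrite -[k]/(val (FSetSub kw)) -Some_fnd.
  by move=> /subpatternP h i /mapP[k kw ->]; rewrite /v h.
- apply: full => [|o po]; last exact: random_well_placed.
  exact: measurable_preimage (@measurable_pi1 tile bool 2) well_placed_measurable.
- rewrite lamE; apply: le_trans (opposite_probability e01 PE n).
  by rewrite lee_fin lerD2l lerN2.
Qed.

(** * Besicovitch distance and disagreement at the origin *)

Section Disagreement.
Variables (R : realType) (d : nat) (A : pointedFinType).
Variable lam : probability (config d (A * A)%type) R.

Definition disagree (k : 'rV[int]_d) : set (config d (A * A)%type) :=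
  [set z | (z k).1 != (z k).2].

Definition diff_density (n : nat) (z : config d (A * A)%type) : \bar R :=
  ((num_diff n (pi1 z) (pi2 z))%:R / ((n.*2.+1) ^ d)%:R)%:E.

Lemma disagree_measurable k : measurable (disagree k).
Proof. exact: (discretely_measurable_coord (A := (A * A)%type) k [set p | p.1 != p.2]). Qed.

Lemma diff_densityE n z : diff_density n z =
  ((((n.*2.+1) ^ d)%:R^-1)%:E *
   \sum_(v : 'rV['I_(n.*2.+1)]_d) (\1_(disagree (cube_point v)) z)%:E)%E.
Proof.
rewrite /diff_density mulrC EFinM; congr (_ * _)%E.
rewrite sumEFin; congr (_%:E); rewrite /num_diff cardsE -sum1_card natr_sum.
rewrite big_mkcond; apply: eq_bigr => v _; rewrite indicE unfold_in /=.
have -> : (z \in disagree (cube_point v)) = ((z (cube_point v)).1 != (z (cube_point v)).2).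
  by apply/idP/idP; rewrite inE.
by rewrite /pi1 /pi2; case: ifP.
Qed.

Lemma diff_density_measurable n : measurable_fun setT (diff_density n).
Proof.
rewrite (_ : diff_density n = fun z => ((((n.*2.+1) ^ d)%:R^-1)%:E *
   \sum_(v : 'rV['I_(n.*2.+1)]_d) (\1_(disagree (cube_point v)) z)%:E)%E).
  apply: measurable_funeM; apply: emeasurable_sum => v.
  apply/measurable_EFinP; apply: measurable_indic; exact: disagree_measurable.
by apply/funext => z; exact: diff_densityE.
Qed.

Lemma diff_density_ge0 n z : (0 <= diff_density n z)%E.
Proof. by rewrite lee_fin divr_ge0. Qed.

Lemma diff_density_le1 n z : (diff_density n z <= 1)%E.
Proof.
rewrite lee_fin ler_pdivrMr ?ltr0n ?expn_gt0 // mul1r ler_nat.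
apply: leq_trans (max_card _) _.
by rewrite card_mx card_ord mul1n.
Qed.

Hypothesis lam_inv : shift_invariant lam.

Lemma disagree_invariant k : lam (disagree k) = lam (disagree 0).
Proof.
rewrite -(lam_inv k (disagree_measurable 0)) /pushforward; congr (lam _).
by apply/seteqP; split=> z; rewrite /preimage /= /disagree /config_shift /= addr0.
Qed.

(** The density of disagreements in any cube has mean the probability of
    disagreement at the origin. *)
Lemma integral_diff_density n : (\int[lam]_z diff_density n z = lam (disagree 0))%E.
Proof.
have mI (v : 'rV['I_(n.*2.+1)]_d) :
    measurable_fun setT (fun z => (\1_(disagree (cube_point v)) z)%:E : \bar R).
  by apply/measurable_EFinP; apply: measurable_indic; exact: disagree_measurable.
rewrite (eq_integral (fun z => ((((n.*2.+1) ^ d)%:R^-1)%:E *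
   \sum_(v : 'rV['I_(n.*2.+1)]_d) (\1_(disagree (cube_point v)) z)%:E)%E)); last first.
  by move=> z _; exact: diff_densityE.
rewrite ge0_integralZl //; last first.
- by move=> z _; apply: sume_ge0 => v _; rewrite lee_fin.
- by apply: emeasurable_sum => v; exact: mI.
rewrite ge0_integral_sum //.
rewrite (eq_bigr (fun=> lam (disagree 0))) => [|v _]; last first.
  rewrite integral_indic //; last exact: disagree_measurable.
  by rewrite setIT; exact: disagree_invariant.
have fA : lam (disagree 0) \is a fin_num by apply: fin_num_measure; exact: disagree_measurable.
rewrite -(fineK fA) sumEFin -EFinM; congr (_%:E).
by rewrite sumr_const card_mx card_ord mul1n -[fine _ *+ _]mulr_natl mulrA mulVf ?mul1r // pnatr_eq0 -lt0n expn_gt0.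
Qed.

(** The upper densities over the cubes of size at least [n] have mean at least
    [lam (disagree 0)], and they converge boundedly to the Besicovitch
    distance. *)
Lemma disagree_le_dH :
  (lam (disagree 0) <= \int[lam]_z dH R (pi1 z) (pi2 z))%E.
Proof.
pose s n z : \bar R := esups (fun m => diff_density m z) n.
have s0 n z : (0 <= s n z)%E.
  apply: le_trans (diff_density_ge0 n z) _; apply: ereal_sup_ubound; exists n => //=.
have s1 n z : (s n z <= 1)%E.
  by apply: ge_ereal_sup => _ [m _ <-]; exact: diff_density_le1.
have ms n : measurable_fun setT (s n).
  by apply: measurable_fun_esups => m; exact: diff_density_measurable.
have mdH : measurable_fun setT (fun z => limn_esup (fun m => diff_density m z)).
  by apply: measurable_fun_limn_esup => m; exact: diff_density_measurable.
pose l z := limn_esup (fun m => diff_density m z).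
have sl : {ae lam, forall z, setT z -> s ^~ z @ \oo --> l z}.
  by apply: aeW => z _; rewrite /l limn_esup_lim; exact: is_cvg_esups.
have sb : {ae lam, forall z n, setT z -> (`|s n z| <= cst 1 z)%E}.
  by apply: aeW => z n _; rewrite gee0_abs.
have [_ _] := dominated_convergence measurableT ms mdH sl
  (finite_measure_integrable_cst lam 1 measurableT) sb.
move=> cv; rewrite -(cvg_lim _ cv) //; apply: lime_ge; first by apply/cvg_ex; eexists; exact: cv.
apply: nearW => n /=; rewrite -(integral_diff_density n).
apply: ge0_le_integral => //.
- by move=> z _; exact: diff_density_ge0.
- exact: diff_density_measurable.
- by move=> z _; apply: ereal_sup_ubound; exists n => //=.
Qed.

End Disagreement.

(** * Clean tilings have no recurrent opposite pair *)

(** Two opposite pairs in one row would give two colour changes. *)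
Lemma opposite_once (y : config 2 tile) (H m : Z) : Omega RB y -> Z.lt 0 H ->
  Z.lt 0 m -> opposite (pt H Z0) y ->
  ~ opposite (pt H Z0) (config_shift (pt (Z.mul m H) Z0) y).
Proof.
move=> /Omega_valid vy H0 m0 [b0 bH [c [hc hc']]].
rewrite /opposite /config_shift addr0 ptD Z.add_0_r => -[b1 b2 [e [he he']]].
rewrite pt00 in b0 hc.
have le1 : Z.le (Z.add Z0 H) (Z.mul m H) by nia.
have le2 : Z.le (Z.add Z0 H) (Z.add (Z.mul m H) H) by nia.
have ne : c <> ~~ c by case: c {hc hc'}.
have once x := @bump_colour_once _ Z0 Z0 H x c (~~ c) _ vy H0.
have e1 := once _ _ le1 b0 hc bH hc' ne b1 he.
have e2 := once _ _ le2 b0 hc bH hc' ne b2 he'.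
by move: e2; rewrite e1; case: (c).
Qed.

Section Recurrence.
Context d (T : measurableType d) (R : realType) (P : probability T R).

(** Otherwise the union of enough copies would have probability greater than
    1. *)
Lemma disjoint_copies_null (E : nat -> set T) :
  (forall i, measurable (E i)) -> (forall i, P (E i) = P (E 0%N)) ->
  trivIset setT E -> P (E 0%N) = 0%E.
Proof.
move=> mE PE tE.
have fE : P (E 0%N) \is a fin_num by exact: fin_num_measure.
have le1 m : fine (P (E 0%N)) *+ m <= 1.
  rewrite -lee_fin.
  have := probability_le1 P (bigsetU_measurable (index_enum 'I_m) (P := predT) (fun i _ => mE i)).
  rewrite measure_bigsetU //.
  rewrite (eq_bigr (fun=> (fine (P (E 0%N)))%:E)) => [|i _]; last by rewrite fineK //; exact: PE.
  by rewrite sumEFin sumr_const card_ord.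
apply/eqP; rewrite eq_le measure_ge0 andbT -(fineK fE) lee_fin leNgt.
apply/negP => p0.
have := archi_boundP (ltW (divr_gt0 ltr01 p0)).
rewrite ltr_pdivrMr // mulr_natl ltNge.
by rewrite le1.
Qed.

End Recurrence.

(** Apply [disjoint_copies_null] to the translates of the event by multiples
    of [H], which are disjoint by [opposite_once]. *)
Lemma clean_opposite_null (R : realType) (nu : probability (config 2 tile) R) H :
  shift_invariant nu -> nu (Omega RB) = 1%E -> Z.lt 0 H ->
  nu [set y | opposite (pt H Z0) y] = 0%E.
Proof.
move=> inv full H0.
have mO : measurable (Omega RB) by exact: Omega_measurable.
have mP : measurable [set y | opposite (pt H Z0) y] by exact: opposite_measurable.
have nO : nu (~` Omega RB) = 0%E.
  have := probability_setC nu mO; rewrite full => ->.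
  by rewrite subee.
pose s (j : nat) : config 2 tile -> config 2 tile := config_shift (pt (Z.mul (Z.of_nat j) H) Z0).
pose E0 := [set y | opposite (pt H Z0) y] `&` Omega RB.
have mE0 : measurable E0 by exact: measurableI.
pose E j := s j @^-1` E0.
have ms j : measurable_fun setT (s j).
  by apply: measurable_config => k; exact: discretely_measurable_coord.
have mE j : measurable (E j) by exact: measurable_preimage (ms j) mE0.
have EE j : nu (E j) = nu E0 by have := inv (pt (Z.mul (Z.of_nat j) H) Z0) E0 mE0.
have dis i j y : (i < j)%N -> E i y -> E j y -> False.
  move=> ij [ o1 O1] [ o2 _]; apply: (@opposite_once (s i y) H (Z.of_nat (j - i)%N)) => //.
    have : (0 < j - i)%N by rewrite subn_gt0.
    by move: (j - i)%N => k /ssrnat.ltP; lia.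
  rewrite (_ : config_shift _ _ = s j y) //.
  apply/funext => l; rewrite /s /config_shift addrA ptD; congr (y (pt _ _ + _)).
  by move/ssrnat.ltP: ij; rewrite -minusE; nia.
have null := disjoint_copies_null mE (fun j => etrans (EE j) (esym (EE 0%N))).
have E00 : nu E0 = 0%E.
  rewrite -(EE 0%N); apply: null; apply/trivIsetP => i j _ _ ij.
  apply/seteqP; split=> // y [yi yj]; case: (ltngtP i j) => h.
  - exact: dis h yi yj.
  - exact: dis h yj yi.
  - by rewrite h eqxx in ij.
apply/eqP; rewrite eq_le measure_ge0 andbT.
have := measure_sub_add nu mP mE0 (measurableC mO).
rewrite [X in (_ <= X + _)%E]E00 add0e.
move=> h; apply: le_trans (h _) _; last by rewrite le_eqVlt; apply/orP; left; apply/eqP; exact: nO.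
by move=> y oy; case: (pselect (Omega RB y)) => Oy; [left|right].
Qed.

(** A bumpy tile is a cross. *)
Lemma bumpy_out t d : bumpy t -> out (tile_cell t) d = true.
Proof.
rewrite bumpyE; case: (tile_cell_ok t) => [fe fn c ho _ _|d0 -> //].
exact: ho.
Qed.

Lemma bumpy_east a b : edge_match east a b -> bumpy a -> ~~ bumpy b.
Proof.
move=> /edge_matchE[ o _] ba; apply/negP => bb.
by move: o; rewrite !bumpy_out.
Qed.

Lemma bumpy_north a b : edge_match north a b -> bumpy a -> ~~ bumpy b.
Proof.
move=> /edge_matchN[ o _] ba; apply/negP => bb.
by move: o; rewrite !bumpy_out.
Qed.

(** The sites whose tiles determine the four edges at the origin, and its
    bumpiness through the square with corner at the origin. *)
Definition neighbourhood : seq site :=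
  [:: unit_east; - unit_east; unit_north; - unit_north; unit_east + unit_north].

(** Two bumpy tiles cannot share an edge, as both arrows would be outgoing;
    the diagonal neighbour is excluded by the 2 by 2 rule. *)
Lemma well_placed_neighbours x k : well_placed x -> bumpy (x 0) ->
  k \in neighbourhood -> ~~ bumpy (x k).
Proof.
move=> wx b0; have [E W N S c] := wx b0.
rewrite !inE => /or4P[/eqP->|/eqP->|/eqP->|/orP[]/eqP->].
- exact: bumpy_east E b0.
- by apply/negP => bW; move: b0; apply/negP; exact: bumpy_east W bW.
- exact: bumpy_north N b0.
- by apply/negP => bS; move: b0; apply/negP; exact: bumpy_north S bS.
- by move: c; rewrite /bump_count b0 !add0r; case: (bumpy (x (_ + _))) => //;
    do 2 case: (bumpy _).
Qed.

(** Matching leaves one possibility for each of the two edges once the other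
    is given. *)
Lemma edge_match_eq i a a' b b' :
  edge_match i a b -> edge_match i a' b' ->
  ((val a).1 i == (val a').1 i) = ((val b).1 (i + 2) == (val b').1 (i + 2)).
Proof.
rewrite /edge_match => /andP[+ /eqP +] /andP[+ /eqP +].
case: ((val a).1 i) ((val b).1 _) ((val a').1 i) ((val b').1 _) =>
  [ o l] [ p _] [ o' l'] [ p' _] /= op <- op' <-.
by rewrite !xpair_eqE; congr (_ && _); case: o p o' p' op op' => -[] [] [].
Qed.

Lemma dir_ind (P : dir -> Prop) :
  P east -> P north -> P (east + 2) -> P (north + 2) -> forall i, P i.
Proof.
move=> pE pN pW pS [[|[|[|[|m]]]] hm] //.
- by move: pE; congr P; exact: val_inj.
- by move: pN; congr P; exact: val_inj.
- by move: pW; congr P; exact: val_inj.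
- by move: pS; congr P; exact: val_inj.
Qed.

(** The neighbours give the four edges of [y 0], and they are not bumpy, so
    [y 0] is bumpy by the 2 by 2 rule. *)
Lemma bumpy_determined x y : well_placed x -> Omega RB y -> bumpy (x 0) ->
  (forall k, k \in neighbourhood -> y k = x k) -> y 0 = x 0 :> tile.
Proof.
move=> wx Oy b0 yx; have [E W N S c] := wx b0.
have nb k kn := negbTE (well_placed_neighbours (k := k) wx b0 kn).
have yE := Omega_east 0 Oy; have yW := Omega_east (- unit_east) Oy.
have yN := Omega_north 0 Oy; have yS := Omega_north (- unit_north) Oy.
rewrite add0r in yE; rewrite addNr in yW; rewrite add0r in yN; rewrite addNr in yS.
apply: val_inj; rewrite [LHS]surjective_pairing [RHS]surjective_pairing.
congr (_, _).
  apply/ffunP; apply: dir_ind; apply/eqP.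
  - by rewrite (edge_match_eq yE E) yx // !inE eqxx ?orbT.
  - by rewrite (edge_match_eq yN N) yx // !inE eqxx ?orbT.
  - by rewrite -(edge_match_eq yW W) yx // !inE eqxx ?orbT.
  - by rewrite -(edge_match_eq yS S) yx // !inE eqxx ?orbT.
rewrite -!/(bumpy _) b0; have := Omega_bump_count 0 Oy; rewrite /bump_count !add0r.
have e k : k \in neighbourhood -> bumpy (y k) = false by move=> kn; rewrite yx // nb.
rewrite (e unit_east) ?(e unit_north) ?(e (unit_east + unit_north)) ?inE ?eqxx ?orbT //.
by case: bumpy.
Qed.

(** * Couplings of a noisy and a clean tiling *)

Section CouplingBound.
Variables (R : realType) (mu nu : probability (config 2 tile) R).
Variable lam : probability (config 2 (tile * tile)%type) R.
Hypothesis coupled : couplings mu nu lam.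

Definition bumpy_first (k : site) : set (config 2 (tile * tile)%type) :=
  [set z | bumpy (z k).1].

Lemma bumpy_first_measurable k : measurable (bumpy_first k).
Proof. exact: (discretely_measurable_coord (A := (tile * tile)%type) k [set p | bumpy p.1]). Qed.

Lemma shifted_measure (S : set (tile * tile)) k :
  lam [set z | S (z k)] = lam [set z | S (z 0)].
Proof.
have [inv _ _] := coupled.
rewrite -(inv k _ (discretely_measurable_coord (A := (tile * tile)%type) 0 S)).
by rewrite /pushforward; congr (lam _); apply/seteqP; split=> z;
  rewrite /preimage /= /config_shift addr0.
Qed.

(** With [a] and [c] the probabilities of a disagreement at the origin where
    the first tile is bumpy, resp. is not: [2 a >= 5/24] because an opposite
    pair has to be destroyed at one of its two ends, and [a <= 5 c] because a
    bumpy tile cannot change alone. *)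
Lemma disagree_ge_eighth (h : site) :
  mu [set x | well_placed x] = 1%E -> nu (Omega RB) = 1%E ->
  ((4^-1 - 24^-1)%:E <= mu [set x | opposite h x])%E ->
  nu [set y | opposite h y] = 0%E ->
  ((1 / 8)%:E <= lam (disagree 0%R))%E.
Proof.
move=> wp cl op nop; have [inv c1 c2] := coupled.
have mD k := @disagree_measurable 2 tile k.
have mB k := bumpy_first_measurable k.
have mW : measurable [set x : config 2 tile | well_placed x] := well_placed_measurable.
have mO : measurable (Omega RB) by exact: Omega_measurable.
have mP : measurable [set x : config 2 tile | opposite h x] by exact: opposite_measurable.
have m1 B mB' := measurable_preimage (B := B) (@measurable_pi1 tile tile 2) mB'.
have m2 B mB' := measurable_preimage (B := B) (@measurable_pi2 tile tile 2) mB'.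
pose DB k := disagree k `&` bumpy_first k.
pose DC k := disagree k `&` ~` bumpy_first k.
have mDB k : measurable (DB k) by exact: measurableI.
have mDC k : measurable (DC k) by apply: measurableI => //; exact: measurableC.
have eDB k : lam (DB k) = lam (DB 0).
  exact: (shifted_measure [set p | (p.1 != p.2) /\ bumpy p.1] k).
have eDC k : lam (DC k) = lam (DC 0).
  exact: (shifted_measure [set p | (p.1 != p.2) /\ ~ bumpy p.1] k).
have split0 : lam (disagree 0) = (lam (DB 0%R) + lam (DC 0%R))%E.
  rewrite -measureU //; last first.
    by apply/seteqP; split=> z //= [[_ b] [_ nb]].
  by rewrite -setIUr setUv setIT.
have fin (X : set (config 2 (tile * tile)%type)) : measurable X -> exists2 r, 0 <= r & lam X = r%:E.
  move=> mX; exists (fine (lam X)); first exact: fine_ge0.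
  by rewrite fineK //; exact: fin_num_measure.
have [a a0 aE] := fin _ (mDB 0).
have [c c0 cE] := fin _ (mDC 0).
have null (X : set (config 2 tile)) (m : probability (config 2 tile) R)
    (f : config 2 (tile * tile)%type -> config 2 tile) : measurable X ->
    (forall B, measurable B -> pushforward lam f B = m B) -> m X = 1%E ->
    lam (f @^-1` (~` X)) = 0%E.
  move=> mX mf X1; have := mf _ (measurableC mX); rewrite /pushforward => ->.
  by have := probability_setC m mX; rewrite X1 subee.
have n1 := null _ _ _ mW c1 wp.
have n2 := null _ _ _ mO c2 cl.
(* An opposite pair of the first coordinate either remains in the second, or
   is broken at one of its ends. *)
have ineq1 : 4^-1 - 24^-1 <= a + a.
  have sub : @pi1 2 tile tile @^-1` [set x | opposite h x] `<=`
      (@pi2 2 tile tile @^-1` [set x | opposite h x]) `|` (DB 0 `|` DB h).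
    move=> z [b0 bh [e [e0 eh]]]; rewrite /pi1 in b0 bh e0 eh.
    case: (eqVneq (z 0).1 (z 0).2) => d0; last by right; left.
    case: (eqVneq (z h).1 (z h).2) => dh; last by right; right.
    by left; split; rewrite /pi2 -?d0 -?dh //; exists e.
  have := measure_sub_add lam (m1 _ mP) (m2 _ mP) (measurableU _ _ (mDB 0) (mDB h)) sub.
  have eo : lam (@pi1 2 tile tile @^-1` [set x | opposite h x]) = mu [set x | opposite h x] := c1 _ mP.
  have en : lam (@pi2 2 tile tile @^-1` [set x | opposite h x]) = 0%E := etrans (c2 _ mP) nop.
  rewrite [X in (X <= _)%E]eo [X in (_ <= X + _)%E]en add0e => le1.
  have := measureU2 lam (mDB 0) (mDB h).
  rewrite [X in (_ <= _ + X)%E]eDB [X in (_ <= X + _)%E]aE [X in (_ <= _ + X)%E]aE => le2.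
  by rewrite -lee_fin EFinD; exact: le_trans op (le_trans le1 le2).
(* If the second coordinate agrees with the first on the neighbourhood, it
   agrees at the origin. *)
have ineq2 : a <= c + (c + (c + (c + c))).
  pose N := [set z | exists2 k, k \in neighbourhood & DC k z].
  have sub : DB 0 `<=` (@pi1 2 tile tile @^-1` (~` [set x | well_placed x]) `|`
      @pi2 2 tile tile @^-1` (~` Omega RB)) `|`
      (DC unit_east `|` (DC (- unit_east) `|` (DC unit_north `|` (DC (- unit_north) `|`
       DC (unit_east + unit_north))))).
    move=> z [d0 b0].
    case: (pselect (well_placed (pi1 z))) => w; last by left; left.
    case: (pselect (Omega RB (pi2 z))) => O; last by left; right.
    right; apply: contrapT => no; move/negP: d0; apply; apply/eqP/esym.
    apply: (bumpy_determined w O) => // k kN.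
    apply: contrapT => /eqP; rewrite eq_sym => dk; apply: no.
    have nk := well_placed_neighbours w b0 kN.
    have : DC k z by split=> //; exact/negP.
    move: kN; rewrite !inE => /or4P[/eqP->|/eqP->|/eqP->|/orP[]/eqP->].
    - by left.
    - by right; left.
    - by right; right; left.
    - by right; right; right; left.
    - by right; right; right; right.
  have mN1 := m1 _ (measurableC mW); have mN2 := m2 _ (measurableC mO).
  have U2 X Y x y : measurable X -> measurable Y -> (lam X <= x)%E -> (lam Y <= y)%E ->
    (lam (X `|` Y) <= x + y)%E.
    by move=> mX mY lx ly; apply: le_trans (measureU2 lam mX mY) _; exact: leeD.
  have lc k : (lam (DC k) <= c%:E)%E by rewrite le_eqVlt eDC; apply/orP; left; apply/eqP.
  have m4 := measurableU _ _ (mDC (- unit_north)) (mDC (unit_east + unit_north)).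
  have m3 := measurableU _ _ (mDC unit_north) m4.
  have m2' := measurableU _ _ (mDC (- unit_east)) m3.
  have m1' := measurableU _ _ (mDC unit_east) m2'.
  have := measure_sub_add lam (mDB 0) (measurableU _ _ mN1 mN2) m1' sub.
  rewrite [X in (X <= _)%E]aE => le1.
  rewrite -lee_fin !EFinD; apply: le_trans le1 _.
  rewrite -[leRHS]add0e; apply: leeD.
    rewrite -[leRHS]add0e; apply: U2 => //.
      by rewrite le_eqVlt; apply/orP; left; apply/eqP; exact: n1.
    by rewrite le_eqVlt; apply/orP; left; apply/eqP; exact: n2.
  by do 4! (apply: (U2 _ _ _ _ _ _ (lc _)) => //).
rewrite split0 [X in (_ <= X + _)%E]aE [X in (_ <= _ + X)%E]cE -EFinD lee_fin.
lra.
Qed.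

End CouplingBound.

Lemma noisy_far (R : realType) (eps : R) : 0 < eps <= 1 ->
  exists2 mu : probability (config 2 tile) R, noisy_measures RB eps mu &
    ((1 / 8)%:E <= dB_set mu (inv_measures RB))%E.
Proof.
move=> e01; have [H [lam [H0 lift wp op]]] := noisy_law e01.
have [mu muE] := image_probability lam (@measurable_pi1 tile bool 2).
exists mu; first by exists lam => // B mB; exact: muE.
have wp' : mu [set x | well_placed x] = 1%E by rewrite muE.
have op' : ((4^-1 - 24^-1)%:E <= mu [set x | opposite (pt H Z0) x])%E by rewrite muE.
apply: le_ereal_inf_tmp => _ [nu [inv full] <-].
apply: le_ereal_inf_tmp => _ [pi coupled <-].
apply: le_trans (disagree_le_dH (let: And3 i _ _ := coupled in i)).
apply: (disagree_ge_eighth coupled wp' full op').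
exact: clean_opposite_null.
Qed.

Theorem proposition3p1 (R : realType) :
  (forall eps : R, 0 < eps <= 1 ->
     exists2 mu : probability (config 2 tile) R,
       noisy_measures RB eps mu &
       ((1 / 8)%:E <= dB_set mu (inv_measures RB))%E) /\
  ~ stable R RB.
Proof.
split=> [eps|[f [_ _ _ f0 fub]]]; first exact: noisy_far.
(* A modulus of stability would fall below [1/8] near 0. *)
have : \forall x \near 0^'+, f x < 1 / 8.
  by apply: (cvgr_lt 0) => //; rewrite divr_gt0.
move=> near8.
have [x [x0 x1 fx]] : exists x : R, [/\ 0 < x, x <= 1 & f x < 1 / 8].
  near (0 : R)^'+ => x; exists x; split.
  - by near: x; exact: nbhs_right_gt.
  - by near: x; apply: nbhs_right_le.
  - by near: x.
have [mu nmu far] := noisy_far (introT andP (conj x0 x1)).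
have := fub x; rewrite in_itv /= (ltW x0) x1 => /(_ isT) ub.
have := le_trans far (le_trans _ ub); rewrite lee_fin => /(_ _)/le_lt_trans/(_ fx).
rewrite ltxx => h; suff : false by [].
by apply: h; apply: ereal_sup_ubound; exists mu.
Unshelve. all: by end_near.
Qed.
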